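(* Let $k$ be a positive integer, let $\Lambda$ be a row-finite, source-free $k$-graph, let $G$ be a countable discrete group, and let $(G,\Lambda)$ be a pseudo free self-similar $k$-graph satisfying: (A1) $g\cdot v=v$ for all $g\in G$, $v\in\Lambda^0$; (A2) for every maximal tail $T$ of $\Lambda$, every cycline triple of $(G,\Lambda T)$ is a cycline pair of $(G,\Lambda T)$; (A3) for every $T\in M_\tau(\Lambda)$, the $k$-graph $H_T\Lambda T$ is strongly connected; (A4) for every maximal tail $T$ of $\Lambda$ and every $f\in\widehat{\mathrm{Per}}_{G,\Lambda T}$, the ideal $I_{T,f}$ is the closed two-sided ideal of $\mathcal{O}_{G,\Lambda}$ generated by $\{s_v : v\in\Lambda^0\setminus T\}$ together with $\{s_\mu-f(d(\mu)-d(\nu))s_\nu : (\mu,1_G,\nu)\text{ is a cycline pair of }(G,H_T\Lambda T)\}$. Let $W$ be a nonempty subset of $M_\gamma(\Lambda)$, let $Y$ be a nonempty subset of $M_\tau(\Lambda)$, for each $T\in Y$ let $D(T)$ be a nonempty subset of $\widehat{\mathrm{Per}}_{G,\Lambda T}$, let $S_0\in M_\gamma(\Lambda)$, let $T_0\in M_\tau(\Lambda)$, and let $f_0\in\widehat{\mathrm{Per}}_{G,\Lambda T_0}$. Closures of sets of ideals below are taken in $\mathrm{Prim}(\mathcal{O}_{G,\Lambda})$ with the Jacobson (hull-kernel) topology. Then: 1. $I_{S_0,1}\in\overline{\{I_{S,1}:S\in W\}}$ if and only if $S_0\subset\bigcup_{S\in W}S$. 2. $I_{T_0,f_0}\in\overline{\{I_{S,1}:S\in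 W\}}$ if and only if $T_0\subset\bigcup_{S\in W}S$. 3. $I_{S_0,1}\in\overline{\{I_{T,f}:T\in Y,\ f\in D(T)\}}$ if and only if $S_0\subset\bigcup_{T\in Y}T$. 4. $I_{T_0,f_0}\in\overline{\{I_{T,f}:T\in Y,\ f\in D(T)\}}$ if and only if one of the following holds: (a) there exists $T\in Y$ with $T\neq T_0$ and $T_0\subset T$; or (b) there is no $T\in Y$ with $T\neq T_0$ and $T_0\subset T$, and moreover $T_0\in Y$ and $f_0\in\overline{D(T_0)}$, where the closure is taken in the compact group $\widehat{\mathrm{Per}}_{G,\Lambda T_0}$.
   Context: **$k$-graphs.** A $k$-graph is a countable small category $\Lambda$ (identified with its set of morphisms, with range and source maps $r,s$; $\mu\nu$ is defined when $s(\mu)=r(\nu)$) with a functor $d:\Lambda\to\mathbb{N}^k$ (the degree map) such that whenever $d(\mu)=p+q$ there are unique $\alpha,\beta\in\Lambda$ with $d(\alpha)=p$, $d(\beta)=q$, $s(\alpha)=r(\beta)$, $\mu=\alpha\beta$. Put $\Lambda^p:=d^{-1}(p)$; $\Lambda^0$ is the set of objects (vertices). For $A,B\subset\Lambda$, $AB:=\{\mu\nu:\mu\in A,\nu\in B,s(\mu)=r(\nu)\}$; e.g. $v\Lambda^p$ is the set of paths of degree $p$ with range $v$, and $v\Lambda w$ the set of paths with range $v$ and source $w$. $\Lambda$ is row-finite if $|v\Lambda^p|<\infty$, and source-free if $v\Lambda^p\neq\emptyset$, for all $v\in\Lambda^0$, $p\in\mathbb{N}^k$. $\Lambda$ is strongly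 connected if $v\Lambda w\neq\emptyset$ for all $v,w\in\Lambda^0$. **Infinite paths.** $\Omega_k:=\{(p,q)\in\mathbb{N}^k\times\mathbb{N}^k:p\le q\}$ is a $k$-graph with $r(p,q)=(p,p)$, $s(p,q)=(q,q)$, $(p,q)(q,m)=(p,m)$, $d(p,q)=q-p$. An infinite path is a degree-preserving functor $x:\Omega_k\to\Lambda$; $\Lambda^\infty$ is the set of these, and $v\Lambda^\infty$ those with $x(0,0)=v$. $\sigma^n(x)(p,q):=x(p+n,q+n)$, and for $s(\mu)=x(0,0)$, $\mu x$ is the infinite path with $(\mu x)(0,d(\mu)+n)=\mu\,x(0,n)$. $x$ is cofinal in $\Lambda$ if for every $v\in\Lambda^0$ there is $m\in\mathbb{N}^k$ with $v\Lambda x(m,m)\neq\emptyset$. **Maximal tails.** A nonempty $T\subset\Lambda^0$ is a maximal tail if: (i) $v\in T$, $w\in\Lambda^0$, $w\Lambda v\neq\emptyset$ imply $w\in T$; (ii) $v\Lambda^pT\neq\emptyset$ for all $v\in T$, $p\in\mathbb{N}^k$; (iii) for all $v_1,v_2\in T$ there is $w\in T$ with $v_1\Lambda w\neq\emptyset$ and $v_2\Lambda w\neq\emptyset$. $M(\Lambda)$ is the set of maximal tails. For $T\in M(\Lambda)$, $\Lambda T$ (paths with source in $T$) is a row-finite source-free $k$-graph with vertex set $T$. **Self-similar $k$-graphs.** Let $G$ be a countable discrete group acting on the set $\Lambda$ and let $G\times\Lambda\to G$, $(g,\mu)\mapsto g|_\mu$ be a map. $(G,\Lambda)$ is a self-similar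 $k$-graph if $G\cdot\Lambda^p\subset\Lambda^p$ for all $p$; $s(g\cdot\mu)=g\cdot s(\mu)$, $r(g\cdot\mu)=g\cdot r(\mu)$; $g\cdot(\mu\nu)=(g\cdot\mu)(g|_\mu\cdot\nu)$ when $s(\mu)=r(\nu)$; $g|_v=g$ for $v\in\Lambda^0$; $g|_{\mu\nu}=(g|_\mu)|_\nu$ when $s(\mu)=r(\nu)$; $1_G|_\mu=1_G$; $(gh)|_\mu=g|_{h\cdot\mu}\,h|_\mu$. It is pseudo free if $g\cdot\mu=\mu$ and $g|_\mu=1_G$ for some $\mu$ imply $g=1_G$. $G$ acts on $\Lambda^\infty$ by $(g\cdot x)(p,q)=g|_{x(0,p)}\cdot x(p,q)$. If $G$ fixes all vertices, the action and restriction map restrict to $\Lambda T$ and to $H_T\Lambda T$ (defined below), making $(G,\Lambda T)$ and $(G,H_T\Lambda T)$ pseudo free self-similar $k$-graphs when $(G,\Lambda)$ is. **Algebras.** A Cuntz–Krieger $\Lambda$-family is a family of partial isometries $\{s_\lambda\}_{\lambda\in\Lambda}$ with: $\{s_v\}_{v\in\Lambda^0}$ mutually orthogonal projections; $s_{\mu\nu}=s_\mu s_\nu$ if $s(\mu)=r(\nu)$; $s_\mu^*s_\mu=s_{s(\mu)}$; $s_v=\sum_{\mu\in v\Lambda^p}s_\mu s_\mu^*$ for all $v\in\Lambda^0$, $p\in\mathbb{N}^k$. $\mathcal{O}^\dagger_{G,\Lambda}$ is the universal unital C*-algebra generated by a Cuntz–Krieger $\Lambda$-family $\{s_\mu\}$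 and unitaries $\{u_g\}_{g\in G}$ with $u_{gh}=u_gu_h$ and $u_gs_\mu=s_{g\cdot\mu}u_{g|_\mu}$. $\mathcal{O}_{G,\Lambda}:=\overline{\mathrm{span}}\{s_\mu u_gs_\nu^*:s(\mu)=g\cdot s(\nu)\}\subset\mathcal{O}^\dagger_{G,\Lambda}$. **Cycline triples and periodicity.** Let $(G,\Gamma)$ be a self-similar $k$-graph. A cycline triple of $(G,\Gamma)$ is $(\mu,g,\nu)$ with $\mu,\nu\in\Gamma$, $g\in G$, $s(\mu)=g\cdot s(\nu)$ and $\mu(g\cdot x)=\nu x$ for all $x\in s(\nu)\Gamma^\infty$. A cycline pair is a cycline triple with $g=1_G$. $\mathrm{Per}_{G,\Gamma}:=\{d(\mu)-d(\nu):(\mu,g,\nu)\text{ a cycline triple}\}$ and $\mathrm{Per}_\Gamma:=\{d(\mu)-d(\nu):(\mu,1_G,\nu)\text{ a cycline pair}\}$. $M_\gamma(\Lambda):=\{T\in M(\Lambda):\mathrm{Per}_{\Lambda T}=0\}$ and $M_\tau(\Lambda):=\{T\in M(\Lambda):\mathrm{Per}_{\Lambda T}\neq0\}$. For $T\in M(\Lambda)$, $H_T$ is the set of all $v\in T$ such that for all $p,q\in\mathbb{N}^k$ with $p-q\in\mathrm{Per}_{\Lambda T}$ and all $\mu\in v\Lambda^pT$ there is a unique $\nu\in v\Lambda^qT$ such that $(\mu,1_G,\nu)$ is a cycline pair of $(G,\Lambda T)$. It is known that, under the hypotheses (A1), (A2) of the claim, $H_T$ is nonempty and hereditary in $\Lambda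 T$ (so $H_T\Lambda T$ is a $k$-graph with vertex set $H_T$), and $\mathrm{Per}_{G,H_T\Lambda T}=\mathrm{Per}_{H_T\Lambda T}=\mathrm{Per}_{G,\Lambda T}=\mathrm{Per}_{\Lambda T}$ is a subgroup of $\mathbb{Z}^k$. A hat denotes the Pontryagin dual group (with its usual compact topology). **The ideals $I_{T,f}$.** Assume (A1) and (A2). Let $T\in M(\Lambda)$ and $f\in\widehat{\mathrm{Per}}_{\Lambda T}$. Choose any infinite path $x$ of $\Lambda T$ that is cofinal in $\Lambda T$, and any character $\widetilde f\in\widehat{\mathbb{Z}^k}$ extending $f$. Let $[x]:=\{y\in(\Lambda T)^\infty:\exists\,p,q\in\mathbb{N}^k,\ g\in G,\ \sigma^p(x)=g\cdot\sigma^q(y)\}$. There is an irreducible representation $\pi_{\widetilde f,x}$ of $\mathcal{O}_{G,\Lambda}$ on $\ell^2([x])$ determined by: $s_\mu\delta_y\mapsto\widetilde f(d(\mu))\delta_{\mu y}$ if $s(\mu)=y(0,0)$ and $0$ otherwise, and $u_g\delta_y\mapsto\delta_{g\cdot y}$. Define $I_{T,f}:=\ker\pi_{\widetilde f,x}$. It is known that $I_{T,f}$ does not depend on the choices of $x$ and $\widetilde f$, that $(T,f)\mapsto I_{T,f}$ is a bijection from $\coprod_{T\in M(\Lambda)}\{T\}\times\widehat{\mathrm{Per}}_{\Lambda T}$ onto $\mathrm{Prim}(\mathcal{O}_{G,\Lambda})$, and that $s_v\in I_{T,f}$ if and only if $v\notin T$. For $S\in M_\gamma(\Lambda)$, $1$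 denotes the unique character of the trivial group $\mathrm{Per}_{\Lambda S}$. *)

(* Defs.v *)
From HB Require Import structures.
From mathcomp Require Import all_boot all_order all_algebra.
From mathcomp Require Import all_classical reals topology normedtype.
From mathcomp Require Import complex.

Set Implicit Arguments.
Unset Strict Implicit.
Unset Printing Implicit Defensive.

Import Order.TTheory GRing.Theory Num.Theory.
Import numFieldNormedType.Exports.

Local Open Scope classical_set_scope.
Local Open Scope ring_scope.
Local Open Scope complex_scope.

Notation Nk k := {ffun 'I_k -> nat}.
Notation Zk k := {ffun 'I_k -> int}.

Definition degdiff (k : nat) (p q : Nk k) : Zk k :=
  [ffun i => (p i)%:Z - (q i)%:Z].

(* One-sorted presentation: an object is identified with its identity
   morphism, so [kr] and [ks] take values in morphisms.  [kcomp m n] is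
   meaningful only when [ks m = kr n]. *)
Record kgraph (k : nat) := KGraph {
  kmor :> countType;
  kr : kmor -> kmor;
  ks : kmor -> kmor;
  kcomp : kmor -> kmor -> kmor;
  kd : kmor -> Nk k;
  kr_kr : forall m, kr (kr m) = kr m;
  ks_kr : forall m, ks (kr m) = kr m;
  kr_ks : forall m, kr (ks m) = ks m;
  ks_ks : forall m, ks (ks m) = ks m;
  kr_comp : forall m n, ks m = kr n -> kr (kcomp m n) = kr m;
  ks_comp : forall m n, ks m = kr n -> ks (kcomp m n) = ks n;
  kcomp_id_l : forall m, kcomp (kr m) m = m;
  kcomp_id_r : forall m, kcomp m (ks m) = m;
  kcompA : forall m n o, ks m = kr n -> ks n = kr o ->
    kcomp m (kcomp n o) = kcomp (kcomp m n) o;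
  kd_id : forall m, kd (kr m) = 0;
  kd_comp : forall m n, ks m = kr n -> kd (kcomp m n) = kd m + kd n;
  kd_factor : forall m p q, kd m = p + q ->
    exists! ab : kmor * kmor,
      [/\ kd ab.1 = p, kd ab.2 = q, ks ab.1 = kr ab.2 & m = kcomp ab.1 ab.2]
}.

Section KGraphTheory.
Context {k : nat} (L : kgraph k).

Definition vertices : set L := [set v | kd v = 0].

Definition row_finite :=
  forall v p, vertices v -> finite_set [set l : L | kr l = v /\ kd l = p].

Definition source_free :=
  forall v p, vertices v -> exists l : L, kr l = v /\ kd l = p.

Definition maximal_tail (T : set L) :=
  [/\ T !=set0 /\ T `<=` vertices,
      forall v w, T v -> vertices w ->
        (exists l : L, kr l = w /\ ks l = v) -> T w,
      forall v p, T v -> exists l : L, [/\ kr l = v, kd l = p & T (ks l)] &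
      forall v1 v2, T v1 -> T v2 -> exists w, [/\ T w,
        exists l : L, kr l = v1 /\ ks l = w &
        exists l : L, kr l = v2 /\ ks l = w]].

(* Sub-k-graphs such as Lambda T are given by their sets of paths. *)
Definition graphT (T : set L) : set L := [set l | T (ks l)].

Definition strongly_connected (Gam : set L) :=
  forall v w, Gam v -> vertices v -> Gam w -> vertices w ->
    exists l, [/\ Gam l, kr l = v & ks l = w].

(* Omega_k is encoded through the bijection (p, q) |-> (p, q - p): [x p n]
   stands for x(p, p + n). *)
Record infpath := InfPath {
  ipath :> Nk k -> Nk k -> L;
  ipath_d : forall p n, kd (ipath p n) = n;
  ipath_r : forall p n, kr (ipath p n) = ipath p 0;
  ipath_s : forall p n, ks (ipath p n) = ipath (p + n) 0;
  ipath_comp : forall p m n,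
    ipath p (m + n) = kcomp (ipath p m) (ipath (p + m) n)
}.

HB.instance Definition _ := gen_eqMixin infpath.
HB.instance Definition _ := gen_choiceMixin infpath.

Definition paths_in (Gam : set L) : set infpath :=
  [set x | forall p n, Gam (x p n)].

Definition cofinal_in (Gam : set L) (x : infpath) :=
  forall v, Gam v -> vertices v ->
    exists m l, [/\ Gam l, kr l = v & ks l = x m 0].

Section Shift.
Variables (m : Nk k) (x : infpath).
Let y p n := x (p + m) n.

Lemma shift_d p n : kd (y p n) = n. Proof. exact: ipath_d. Qed.
Lemma shift_r p n : kr (y p n) = y p 0. Proof. exact: ipath_r. Qed.
Lemma shift_s p n : ks (y p n) = y (p + n) 0.
Proof. by rewrite /y ipath_s addrAC. Qed.
Lemma shift_comp p a b : y p (a + b) = kcomp (y p a) (y (p + a) b).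
Proof. by rewrite /y ipath_comp addrAC. Qed.

Definition shift := InfPath shift_d shift_r shift_s shift_comp.
End Shift.

(* The unique infinite path determined by its initial segments; only
   meaningful when [ks m = x 0 0]. *)
Definition prepend (m : L) (x : infpath) : infpath :=
  xget x [set y | forall n, y 0 (kd m + n) = kcomp m (x 0 n)].

End KGraphTheory.

(* In [ss_act_comp] the first conjunct is the composability that is implicit
   in the equation g(mn) = (gm)(g|_m n). *)
Record selfsim (k : nat) (L : kgraph k) (G : groupType) := SelfSim {
  ss_act : G -> L -> L;
  ss_res : G -> L -> G;
  ss_act1 : forall m, ss_act 1%g m = m;
  ss_actM : forall g h m, ss_act (g * h)%g m = ss_act g (ss_act h m);
  ss_act_d : forall g m, kd (ss_act g m) = kd m;
  ss_act_s : forall g m, ks (ss_act g m) = ss_act g (ks m);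
  ss_act_r : forall g m, kr (ss_act g m) = ss_act g (kr m);
  ss_act_comp : forall g m n, ks m = kr n ->
    ks (ss_act g m) = kr (ss_act (ss_res g m) n) /\
    ss_act g (kcomp m n) = kcomp (ss_act g m) (ss_act (ss_res g m) n);
  ss_res_vertex : forall g v, vertices v -> ss_res g v = g;
  ss_res_comp : forall g m n, ks m = kr n ->
    ss_res g (kcomp m n) = ss_res (ss_res g m) n;
  ss_res1 : forall m, ss_res 1%g m = 1%g;
  ss_resM : forall g h m,
    ss_res (g * h)%g m = (ss_res g (ss_act h m) * ss_res h m)%g
}.

Section SelfSimTheory.
Context {k : nat} {L : kgraph k} {G : groupType} (S : selfsim L G).

Definition pseudo_free :=
  forall g (m : L), ss_act S g m = m -> ss_res S g m = 1%g -> g = 1%g.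

Section ActPath.
Variables (g : G) (x : infpath L).
Let y p n := ss_act S (ss_res S g (x 0 p)) (x p n).

Lemma act_path_res p n :
  ss_res S g (x 0 (p + n)) = ss_res S (ss_res S g (x 0 p)) (x p n).
Proof.
rewrite ipath_comp ss_res_comp ?add0r//.
by rewrite ipath_s add0r ipath_r.
Qed.

Lemma act_path_d p n : kd (y p n) = n.
Proof. by rewrite /y ss_act_d ipath_d. Qed.
Lemma act_path_r p n : kr (y p n) = y p 0.
Proof. by rewrite /y ss_act_r ipath_r. Qed.
Lemma act_path_s p n : ks (y p n) = y (p + n) 0.
Proof.
rewrite /y act_path_res.
have h : ks (x p n) = kr (x (p + n) 0) by rewrite ipath_s ipath_r.
have [-> _] := ss_act_comp S (ss_res S g (x 0 p)) h.
by rewrite ss_act_r ipath_r.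
Qed.
Lemma act_path_comp p a b : y p (a + b) = kcomp (y p a) (y (p + a) b).
Proof.
rewrite /y act_path_res ipath_comp.
have h : ks (x p a) = kr (x (p + a) b) by rewrite ipath_s ipath_r.
by have [_ ->] := ss_act_comp S (ss_res S g (x 0 p)) h.
Qed.

Definition act_path := InfPath act_path_d act_path_r act_path_s act_path_comp.
End ActPath.

Definition cycline (Gam : set L) (m : L) (g : G) (n : L) :=
  [/\ Gam m, Gam n, ks m = ss_act S g (ks n) &
      forall x, paths_in Gam x -> x 0 0 = ks n ->
        prepend m (act_path g x) = prepend n x].

Definition PerG (Gam : set L) : set (Zk k) :=
  [set a | exists m g n, cycline Gam m g n /\ a = degdiff (kd m) (kd n)].

Definition Per (Gam : set L) : set (Zk k) :=
  [set a | exists m n, cycline Gam m 1%g n /\ a = degdiff (kd m) (kd n)].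

Definition Mgamma : set (set L) :=
  [set T | maximal_tail T /\ Per (graphT T) = [set 0]].

Definition Mtau : set (set L) :=
  [set T | maximal_tail T /\ Per (graphT T) <> [set 0]].

Definition HT (T : set L) : set L :=
  [set v | T v /\
    forall p q, Per (graphT T) (degdiff p q) ->
    forall m : L, kr m = v -> kd m = p -> T (ks m) ->
    exists! n : L,
      [/\ kr n = v, kd n = q, T (ks n) & cycline (graphT T) m 1%g n]].

Definition graphHT (T : set L) : set L := [set l | HT T (kr l) /\ T (ks l)].

Definition orbit_class (T : set L) (x : infpath L) : set (infpath L) :=
  [set y | paths_in (graphT T) y /\
    exists p q g, shift p x = act_path g (shift q y)].

End SelfSimTheory.

(* The cast selects the norm topology of R[i] as a numeric field. *)
Notation Zfun R k := {ptws Zk k -> (complex R : numFieldType)}.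

(* A character of the subgroup P is represented by its extension by zero to
   Z^k.  As P is discrete, the topology of the dual group is that of pointwise
   convergence, i.e. the one induced by [Zfun R k]. *)
Definition dual (R : realType) (k : nat) (P : set (Zk k)) :
    set (Zfun R k) :=
  [set f | [/\ forall a b, P a -> P b -> f (a + b) = f a * f b,
               forall a, P a -> `|f a| = 1 &
               forall a, ~ P a -> f a = 0]].

Definition trivial_char (R : realType) (k : nat) (P : set (Zk k)) :
    Zfun R k :=
  fun a => if a \in P then 1 else 0.

(* The norm is part of the structure because the algebra and the normed-module
   hierarchies of the libraries cannot be joined. *)
HB.mixin Record isCstar (R : realType) A of GRing.Algebra R[i] A := {
  star : A -> A;
  cnorm : A -> R;
  starK : forall a, star (star a) = a;
  starD : forall a b, star (a + b) = star a + star b;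
  starZ : forall (c : R[i]) a, star (c *: a) = (c^*)%C *: star a;
  starM : forall a b, star (a * b) = star b * star a;
  cnorm_eq0 : forall a, cnorm a = 0 -> a = 0;
  cnormD : forall a b, cnorm (a + b) <= cnorm a + cnorm b;
  cnormZ : forall (c : R[i]) a, (cnorm (c *: a))%:C = `|c| * (cnorm a)%:C;
  cnormM : forall a b, cnorm (a * b) <= cnorm a * cnorm b;
  cnorm_star : forall a, cnorm (star a * a) = cnorm a ^+ 2;
  cnorm_complete : forall v : nat -> A,
    (forall e : R, 0 < e -> exists N : nat,
       forall i j, (N <= i)%N -> (N <= j)%N -> cnorm (v i - v j) < e) ->
    exists a : A, forall e : R, 0 < e -> exists N : nat,
       forall i, (N <= i)%N -> cnorm (v i - a) < e
}.
#[short(type="cstarAlgType")]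
HB.structure Definition Cstar (R : realType) :=
  {A of isCstar R A & GRing.Algebra R[i] A}.

HB.mixin Record isHilbert (R : realType) H of CompleteNormedModule R[i] H := {
  inner : H -> H -> R[i];
  innerDl : forall x y z : H, inner (x + y) z = inner x z + inner y z;
  innerZl : forall (c : R[i]) (x y : H), inner (c *: x) y = c * inner x y;
  innerC : forall x y : H, inner y x = ((inner x y)^*)%C;
  innerxx : forall x : H, inner x x = `|x| ^+ 2
}.
#[short(type="hilbertType")]
HB.structure Definition Hilbert (R : realType) :=
  {H of isHilbert R H & CompleteNormedModule R[i] H}.

Section CstarTheory.
Context {R : realType} {A : cstarAlgType R}.

Definition norm_closure (X : set A) : set A :=
  [set a | forall e : R, 0 < e -> exists2 b, X b & cnorm (a - b) < e].

Definition subspace_set (V : lmodType R[i]) (X : set V) :=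
  X 0 /\ forall (c : R[i]) a b, X a -> X b -> X (c *: a + b).

Definition span_set (V : lmodType R[i]) (X : set V) : set V :=
  smallest (@subspace_set V) X.

Definition cstar_subalgebra (B : set A) :=
  [/\ subspace_set B, norm_closure B `<=` B, B 1,
      forall a b, B a -> B b -> B (a * b) &
      forall a, B a -> B (star a)].

(* As [B] need not be unital, being a linear subspace is a separate clause. *)
Definition closed_ideal (B J : set A) :=
  [/\ J `<=` B, subspace_set J, norm_closure J `<=` J &
      forall a j, B a -> J j -> J (a * j) /\ J (j * a)].

Definition ideal_gen (B X : set A) : set A := smallest (closed_ideal B) X.

Definition is_rep (B : set A) (H : hilbertType R) (pi : A -> H -> H) :=
  [/\ forall a, B a -> linear (pi a) /\ continuous (pi a),
      forall (c : R[i]) a b x, B a -> B b ->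
        pi (c *: a + b) x = c *: pi a x + pi b x,
      forall a b x, B a -> B b -> pi (a * b) x = pi a (pi b x) &
      forall a x y, B a -> inner (pi (star a) x) y = inner x (pi a y)].

Definition rep_ker (B : set A) (H : hilbertType R) (pi : A -> H -> H) : set A :=
  [set a | B a /\ forall x, pi a x = 0].

Definition irreducible_rep (B : set A) (H : hilbertType R)
    (pi : A -> H -> H) :=
  [/\ is_rep B pi,
      exists a x, B a /\ pi a x <> 0 &
      forall V : set H, subspace_set V -> closed V ->
        (forall a x, B a -> V x -> V (pi a x)) ->
        V = [set 0] \/ V = setT].

Definition Prim (B : set A) : set (set A) :=
  [set J | exists (H : hilbertType R) (pi : A -> H -> H),
     irreducible_rep B pi /\ J = rep_ker B pi].

(* Hull of the kernel: for [X `<=` Prim B] this is the closure of [X] in the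
   hull-kernel topology of [Prim B]. *)
Definition jacobson_closure (B : set A) (X : set (set A)) : set (set A) :=
  [set P | Prim B P /\ \bigcap_(J in X) J `<=` P].

End CstarTheory.

Section Algebras.
Context {R : realType} {k : nat} {L : kgraph k} {G : groupType}.
Variable S : selfsim L G.

Definition ck_family (A : cstarAlgType R) (s : L -> A) :=
  [/\ forall m, s m * star (s m) * s m = s m,
      (forall v, vertices v -> star (s v) = s v /\ s v * s v = s v) /\
      (forall v w, vertices v -> vertices w -> v <> w -> s v * s w = 0),
      forall m n, ks m = kr n -> s (kcomp m n) = s m * s n,
      forall m, star (s m) * s m = s (ks m) &
      forall v p, vertices v ->
        s v = \sum_(m \in [set m : L | kr m = v /\ kd m = p])
                s m * star (s m)].

Definition ssgraph_family (A : cstarAlgType R) (s : L -> A) (u : G -> A) :=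
  [/\ ck_family s,
      forall g, star (u g) * u g = 1 /\ u g * star (u g) = 1,
      forall g h, u (g * h)%g = u g * u h &
      forall g m, u g * s m = s (ss_act S g m) * u (ss_res S g m)].

(* (A, s, u) is the universal unital C*-algebra O^dagger_{G,Lambda} *)
Definition universal_family (A : cstarAlgType R) (s : L -> A) (u : G -> A) :=
  [/\ ssgraph_family s u,
      forall B : set A, cstar_subalgebra B ->
        (forall m, B (s m)) -> (forall g, B (u g)) -> B = setT &
      forall (A' : cstarAlgType R) (s' : L -> A') (u' : G -> A'),
        ssgraph_family s' u' ->
        exists phi : {lrmorphism A -> A'},
          [/\ forall a, phi (star a) = star (phi a),
              forall m, phi (s m) = s' m &
              forall g, phi (u g) = u' g]].

Section InAlgebra.
Context {A : cstarAlgType R} (s : L -> A) (u : G -> A).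

Definition OGL : set A :=
  norm_closure (span_set
    [set a | exists m g n, ks m = ss_act S g (ks n) /\
                           a = s m * u g * star (s n)]).

(* [e] is an orthonormal basis of [H] indexed by [X], so that [H] is
   l^2(X) and [e y] is the point mass at y *)
Definition orthonormal_basis (I : Type) (X : set I) (H : hilbertType R)
    (e : I -> H) :=
  [/\ forall y, X y -> inner (e y) (e y) = 1,
      forall y z, X y -> X z -> y <> z -> inner (e y) (e z) = 0 &
      closure (span_set [set e y | y in X]) = setT].

(* The representation pi_{ft,x} on l^2([x]), on all of O^dagger_{G,Lambda}
   since the u_g need not belong to O_{G,Lambda}; see [is_ITf] for its
   restriction. *)
Definition path_rep (T : set L) (x : infpath L) (ft : Zfun R k)
    (H : hilbertType R) (e : infpath L -> H) (pi : A -> H -> H) :=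
  [/\ orthonormal_basis (orbit_class S T x) e,
      is_rep setT pi,
      forall m y, orbit_class S T x y -> ks m = y 0 0 ->
        pi (s m) (e y) = ft (degdiff (kd m) 0) *: e (prepend m y),
      forall m y, orbit_class S T x y -> ks m <> y 0 0 ->
        pi (s m) (e y) = 0 &
      forall g y, orbit_class S T x y ->
        pi (u g) (e y) = e (act_path S g y)].

(* I_{T,f}, as the relation satisfied by ker pi_{ft,x} for every admissible
   choice of x and ft. *)
Definition is_ITf (T : set L) (f : Zfun R k) (J : set A) :=
  exists x ft,
    [/\ paths_in (graphT T) x, cofinal_in (graphT T) x,
        dual setT ft, forall a, Per S (graphT T) a -> ft a = f a &
        exists (H : hilbertType R) (e : infpath L -> H) (pi : A -> H -> H),
          path_rep T x ft e pi /\ J = rep_ker OGL pi].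

Definition ITf_generators (T : set L) (f : Zfun R k) : set A :=
  [set s v | v in @vertices k L `\` T] `|`
  [set a | exists m n, cycline S (graphHT S T) m 1%g n /\
     a = s m - f (degdiff (kd m) (kd n)) *: s n].

End InAlgebra.
End Algebras.

(* Main.v *)
Require Import Defs.
From HB Require Import structures.
From mathcomp Require Import all_boot all_order all_algebra.
From mathcomp Require Import all_classical reals topology normedtype.
From mathcomp Require Import complex.
From mathcomp Require Import sequences.
From mathcomp Require Import ring lra.

Set Implicit Arguments.
Unset Strict Implicit.
Unset Printing Implicit Defensive.

Import Order.TTheory GRing.Theory Num.Theory.
Import numFieldNormedType.Exports.

Local Open Scope classical_set_scope.
Local Open Scope ring_scope.
Local Open Scope complex_scope.

(* By (A4), I_{T,f} is the kernel of pi_{ft,x} for every cofinal path x of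
   Lambda T, and x can be chosen generic.  If two of the partial maps
   n w |-> m (g w) coincide at a generic x, they coincide near x on Lambda T, and
   (A2) shows that the difference of their degrees lies in Per and that, when
   the degrees agree, the maps coincide on all paths near x.  Consequently the
   norms of pi(b) e_x, for b a finite sum of generators, are reproduced at
   nearby paths of other tails when Per = 0, and depend continuously on the
   character in general; this gives the inclusions "if" in (1), (3) and (4b).

   The set H_T is hereditary, and nonempty by Dickson's lemma, so (A3) implies
   that a tail which meets H_{T0} contains T0.  Hence one vertex of H_{T0} decides
   whether T0 lies in a union of tails, and the generators in (A4) give the
   inclusions "if" in (2) and (4a).  Inclusions of ideals give inclusions of tails
   because s_v lies in I_{T,f} exactly when v is not in T.

   For "only if" in (4), fix v in H_{T0}.  For a in Per a partial isometry V_a of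
   the corner at v acts in every pi_{ft,x} attached to T0, on the paths with
   range v, as the scalar ft(a).  A product of positive parts of the real parts
   of conj (f0 (2^j a)) V_{2^j a} is not in I_{T0,f0}, but lies in I_{T0,f} when
   f is away from f0, and in I_{T,f} when v is not in T. *)

(* MathComp-Analysis shadows the name [shift]. *)
Notation pshift := Defs.shift.

(** The hypotheses supply, for each [T] and [f], one representation at one cofinal path. To use (A4)
    at a generic path a representation must first exist there. It comes from the universal property,
    applied to operators on the Hilbert space already at hand: two orbits of cofinal paths of one
    tail are in bijection, so the given basis can be relabelled.

    The vector e_x is cyclic, so an intersection of ideals lies in I_{T,f} as soon as its elements
    kill e_x. For a finite sum b of generators, the squared norm of pi(b) e_x is a combination of
    Gram coefficients, which see x only through coincidences among finitely many partial maps, and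
    the character only at finitely many degree differences. This is why genericity is a condition on
    pairs of partial maps.

    Functional calculus is replaced by explicit iterations: positive parts come from a square root
    iteration with a rate uniform in the character, and contractivity of representations from a
    Neumann series. The doublings 2^j a occur because Re z > 0 alone confines z to a half circle,
    while each further squaring halves the resulting bound on 1 - Re z. *)

Lemma natDE (a b : nat) : (a + b)%R = (a + b)%N. Proof. by []. Qed.

(** * Paths *)

Section Degrees.
Context {k : nat}.
Implicit Types p q m n : Nk k.

Definition leN p q := forall i, (p i <= q i)%N.
Definition subN q p : Nk k := [ffun i => (q i - p i)%N].
Definition maxN p q : Nk k := [ffun i => maxn (p i) (q i)].
Definition constN (j : nat) : Nk k := [ffun=> j].

Lemma addNE p q i : (p + q) i = (p i + q i)%N.
Proof. by rewrite ffunE. Qed.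
Lemma zeroNE i : (0 : Nk k) i = 0%N.
Proof. by rewrite ffunE. Qed.

Lemma leNn p : leN p p. Proof. by move=> i. Qed.
Lemma leN_trans q p m : leN p q -> leN q m -> leN p m.
Proof. by move=> h1 h2 i; apply: leq_trans (h1 i) (h2 i). Qed.
Lemma leN_addr p q : leN p (p + q). Proof. by move=> i; rewrite addNE leq_addr. Qed.
Lemma leN_addl p q : leN q (p + q). Proof. by move=> i; rewrite addNE leq_addl. Qed.
Lemma leN_add p q p' q' : leN p p' -> leN q q' -> leN (p + q) (p' + q').
Proof. by move=> h1 h2 i; rewrite !addNE leq_add. Qed.
Lemma subNK p q : leN p q -> p + subN q p = q.
Proof. by move=> h; apply/ffunP => i; rewrite addNE ffunE subnKC. Qed.
Lemma leN_maxl p q : leN p (maxN p q). Proof. by move=> i; rewrite ffunE leq_maxl. Qed.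
Lemma leN_maxr p q : leN q (maxN p q). Proof. by move=> i; rewrite ffunE leq_maxr. Qed.
Lemma addNI p : injective (fun q => p + q).
Proof.
move=> q q' /ffunP h; apply/ffunP => i; have := h i.
by rewrite !addNE => /addnI.
Qed.
Lemma degdiff_eq0 p q : degdiff p q = 0 -> p = q.
Proof.
move=> /ffunP h; apply/ffunP => i; have := h i; rewrite !ffunE => /eqP.
by rewrite subr_eq0 => /eqP [].
Qed.
Lemma degdiffD p q p' q' :
  degdiff (p + p') (q + q') = degdiff p q + degdiff p' q'.
Proof. by apply/ffunP => i; rewrite !ffunE ?natDE ?PoszD; ring. Qed.
Lemma degdiffDr p q m : degdiff (p + m) (q + m) = degdiff p q.
Proof. by apply/ffunP => i; rewrite !ffunE ?natDE ?PoszD; ring. Qed.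
Lemma degdiffC p q : degdiff q p = - degdiff p q.
Proof. by apply/ffunP => i; rewrite !ffunE ?natDE ?PoszD; ring. Qed.
Lemma degdiffnn p : degdiff p p = 0.
Proof. by apply/ffunP => i; rewrite !ffunE ?natDE ?PoszD; ring. Qed.

End Degrees.

Section Paths.
Context {k : nat} {L : kgraph k}.
Implicit Types (m l : L) (p q : Nk k) (x y w : infpath L).

Lemma kfactor_uniq m (n : L) m' n' : ks m = kr n -> ks m' = kr n' ->
  kcomp m n = kcomp m' n' -> kd m = kd m' -> m = m' /\ n = n'.
Proof.
move=> h h' e ed.
have dn : kd n = kd n'.
  by apply: (@addNI _ (kd m)); rewrite -kd_comp// e kd_comp// ed.
have [ab [_ uni]] := kd_factor (kd_comp h).
have e1 := uni (m, n) (And4 (erefl _) (erefl _) h (erefl _)).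
have e2 : ab = (m', n') by apply: uni; split=> //=.
by case: (etrans (esym e1) e2) => -> ->.
Qed.

Lemma kd_r m : kd (kr m) = 0. Proof. exact: kd_id. Qed.
Lemma kd_s m : kd (ks m) = 0. Proof. by rewrite -(kr_ks m) kd_id. Qed.
Lemma vertex_r m : vertices (kr m). Proof. exact: kd_id. Qed.
Lemma vertex_s m : vertices (ks m). Proof. exact: kd_s. Qed.

(** The factorizations r(m) m and m s(m) of a morphism of degree 0 have factors of equal degrees, so
    unique factorization identifies them. *)
Lemma vertexE m : vertices m -> kr m = m /\ ks m = m.
Proof.
move=> dm; have e : kcomp (kr m) m = kcomp m (ks m).
  by rewrite kcomp_id_l kcomp_id_r.
have [e1 e2] : kr m = m /\ m = ks m.
  by apply: kfactor_uniq e _; rewrite ?ks_kr ?kr_ks ?kd_r.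
by rewrite -e2.
Qed.

Lemma vertex_rE m : vertices m -> kr m = m. Proof. by case/vertexE. Qed.
Lemma vertex_sE m : vertices m -> ks m = m. Proof. by case/vertexE. Qed.

(** The prefix order. By unique factorization [l] has exactly one prefix of each degree below
    [kd l], and prefixes of [l] are ordered as their degrees are. *)
Definition kext m l := exists2 n, ks m = kr n & l = kcomp m n.

Lemma kext_refl m : kext m m.
Proof. by exists (ks m); rewrite ?kr_ks// kcomp_id_r. Qed.

Lemma kext_trans l m n : kext m l -> kext l n -> kext m n.
Proof.
move=> [a ha ->] [b hb ->]; rewrite ks_comp// in hb.
by exists (kcomp a b); rewrite ?kr_comp// kcompA.
Qed.

Lemma kext_d m l : kext m l -> leN (kd m) (kd l).
Proof. by move=> [a h ->]; rewrite kd_comp//; exact: leN_addr. Qed.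

Lemma kext_r m l : kext m l -> kr l = kr m.
Proof. by move=> [a h ->]; rewrite kr_comp. Qed.

Lemma ex_prefix l p : leN p (kd l) -> exists2 m, kd m = p & kext m l.
Proof.
move=> /subNK h; have [[a b] [[/= ha hb hab e] _]] := kd_factor (esym h).
by exists a => //; exists b.
Qed.

Lemma kext_uniq m m' l : kext m l -> kext m' l -> kd m = kd m' -> m = m'.
Proof. by move=> [a h ->] [a' h' e] ed; case: (kfactor_uniq h h' e ed). Qed.

Lemma kext_cmp m m' l : kext m l -> kext m' l -> leN (kd m) (kd m') ->
  kext m m'.
Proof.
move=> h h' le; have [m1 d1 e1] := ex_prefix le.
by rewrite -(kext_uniq (kext_trans e1 h') h d1).
Qed.

(** The default [l] occurs only when [p] is not below [kd l], and then no prefix of degree [p]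
    exists. *)
Definition kpre l p : L := xget l [set m | kd m = p /\ kext m l].

Lemma kpreP l p : leN p (kd l) -> kd (kpre l p) = p /\ kext (kpre l p) l.
Proof.
move=> /ex_prefix[m dm em]; rewrite /kpre; case: xgetP => [y _ //|/(_ m)].
by case.
Qed.

Definition ksuf m l : L := xget l [set n | ks m = kr n /\ l = kcomp m n].

Lemma ksufP m l : kext m l -> ks m = kr (ksuf m l) /\ l = kcomp m (ksuf m l).
Proof.
move=> [n h e]; rewrite /ksuf; case: xgetP => [y _ //|/(_ n)].
by case.
Qed.

Lemma kcompI m (n n' : L) : ks m = kr n -> ks m = kr n' ->
  kcomp m n = kcomp m n' -> n = n'.
Proof. by move=> h h' e; case: (kfactor_uniq h h' e). Qed.

Lemma tail_vertex (T : set L) m : maximal_tail T -> T m -> vertices m.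
Proof. by case=> -[_ h] _ _ _; exact: h. Qed.

Section Limit.
Variable mu : Nk k -> L.
Hypothesis mu_d : forall p, leN p (kd (mu p)).
Hypothesis mu_ext : forall p q, leN p q -> kext (mu p) (mu q).
Let lam p := kpre (mu p) p.
Let lam_d p : kd (lam p) = p. Proof. by case: (kpreP (@mu_d p)). Qed.
Let lam_mu p : kext (lam p) (mu p). Proof. by case: (kpreP (@mu_d p)). Qed.
Let lam_ext p q : leN p q -> kext (lam p) (lam q).
Proof.
move=> h; apply: (@kext_cmp _ _ (mu q)) => //.
  exact: kext_trans (lam_mu p) (mu_ext h).
by rewrite !lam_d.
Qed.
Let lx p n := ksuf (lam p) (lam (p + n)).
Let lxP p n : ks (lam p) = kr (lx p n) /\ lam (p + n) = kcomp (lam p) (lx p n).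
Proof. by apply: ksufP; apply: lam_ext; exact: leN_addr. Qed.

Let lx_d p n : kd (lx p n) = n.
Proof.
have [h e] := lxP p n; apply: (@addNI _ p).
by rewrite -{1}(lam_d p) -kd_comp// -e lam_d.
Qed.
Let lx0 p : lx p 0 = ks (lam p).
Proof.
have [h e] := lxP p 0; apply: (@kcompI (lam p)) => //; first by rewrite kr_ks.
by rewrite -e addr0 kcomp_id_r.
Qed.
Let lx_r p n : kr (lx p n) = lx p 0.
Proof. by have [h e] := lxP p n; rewrite lx0. Qed.
Let lx_s p n : ks (lx p n) = lx (p + n) 0.
Proof. by have [h e] := lxP p n; rewrite lx0 e ks_comp. Qed.
Let lx_comp p a b : lx p (a + b) = kcomp (lx p a) (lx (p + a) b).
Proof.
have [h e] := lxP p (a + b); have [h1 e1] := lxP p a.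
have [h2 e2] := lxP (p + a) b.
have h3 : ks (lx p a) = kr (lx (p + a) b) by rewrite lx_s lx_r.
apply: (@kcompI (lam p)) => //; first by rewrite kr_comp.
by rewrite kcompA// -e1 -e2 -e addrA.
Qed.

(** Cutting [mu p] down to [lam p] of degree exactly [p] gives a coherent family, and the piece of
    [lam (p + n)] beyond [lam p] serves as x(p, p + n). Asking only for degree at least [p] covers
    both concatenations and inductive constructions of paths. *)
Lemma ex_limit_path : exists x : infpath L, forall p, kext (x 0 p) (mu p).
Proof.
exists (InfPath lx_d lx_r lx_s lx_comp) => p /=.
have [h e] := lxP 0 p; rewrite add0r in e.
have -> : lx 0 p = lam p; last exact: lam_mu.
rewrite e; have -> : lam 0 = kr (lx 0 p); last by rewrite kcomp_id_l.
by rewrite -h vertex_sE// /vertices/= lam_d.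
Qed.
End Limit.

(** Initial segments determine x(p, p + n) by left cancellation; the remaining fields of the record
    are propositions. *)
Lemma ipath_eq x y : (forall n, x 0 n = y 0 n) -> x = y.
Proof.
move=> h; have : (x : Nk k -> Nk k -> L) = y.
  apply/funext => p; apply/funext => n.
  have := h (p + n); rewrite !ipath_comp !add0r h.
  apply: kcompI; last by rewrite ipath_s ipath_r add0r.
  by rewrite -h ipath_s ipath_r add0r.
case: x {h} => X a b c d; case: y => Y a' b' c' d' /= e.
by subst Y; congr InfPath; exact: Prop_irrelevance.
Qed.

Lemma ipath_kext x p q : leN p q -> kext (x 0 p) (x 0 q).
Proof.
move=> /subNK <-; exists (x p (subN q p)); rewrite ?ipath_comp ?add0r//.
by rewrite ipath_s ipath_r add0r.
Qed.

Lemma ipath_eq_le x y p q : leN p q -> x 0 q = y 0 q -> x 0 p = y 0 p.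
Proof.
move=> le e; apply: (@kext_uniq _ _ (x 0 q)); first exact: ipath_kext.
  by rewrite e; exact: ipath_kext.
by rewrite !ipath_d.
Qed.

Lemma ipath_eq_cofinal x y p : (forall n, x 0 (p + n) = y 0 (p + n)) -> x = y.
Proof.
by move=> h; apply: ipath_eq => n; apply: ipath_eq_le (h n); exact: leN_addl.
Qed.

Lemma ipath_neq x y : x <> y -> exists p, x 0 p <> y 0 p.
Proof.
move=> ne; apply: contrapT => h; apply: ne; apply: ipath_eq => p.
by apply: contrapT => np; apply: h; exists p.
Qed.

Lemma ipath_vertex x p : vertices (x p 0). Proof. exact: ipath_d. Qed.

Lemma ipath_0s x p : ks (x 0 p) = x p 0. Proof. by rewrite ipath_s add0r. Qed.

Lemma ipath_shift x p n : x 0 (p + n) = kcomp (x 0 p) (x p n).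
Proof. by rewrite ipath_comp add0r. Qed.

Lemma ipath_compat x p n : ks (x 0 p) = kr (x p n).
Proof. by rewrite ipath_0s ipath_r. Qed.

(** [prepend] is a choice with default [x], so the point is existence: the paths m x(0, n) increase
    with [n] and have degree at least [n], hence they have a limit. *)
Lemma prependP m x : ks m = x 0 0 ->
  forall n, prepend m x 0 (kd m + n) = kcomp m (x 0 n).
Proof.
move=> h; have hc n : ks m = kr (x 0 n) by rewrite ipath_r.
have [||y Hy] := @ex_limit_path (fun n => kcomp m (x 0 n)).
- by move=> p; rewrite kd_comp// ipath_d; exact: leN_addl.
- move=> p q /(ipath_kext x)[b hb ->]; exists b; first by rewrite ks_comp.
  by rewrite kcompA.
rewrite /prepend; case: xgetP => [z _ //|/(_ y)]; case => n.
apply: (@kext_uniq _ _ (kcomp m (x 0 (kd m + n)))); first exact: Hy.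
  have [b hb ->] := @ipath_kext x n (kd m + n) (leN_addl _ _).
  by rewrite kcompA//; exists b => //; rewrite ks_comp.
by rewrite kd_comp// !ipath_d.
Qed.

Lemma prepend_init m x : ks m = x 0 0 -> prepend m x 0 (kd m) = m.
Proof.
move=> h; have := prependP h (0 : Nk k); rewrite addr0 => ->.
by rewrite -h kcomp_id_r.
Qed.

Lemma prepend_r m x : ks m = x 0 0 -> prepend m x 0 0 = kr m.
Proof. by move=> h; rewrite -[in RHS](prepend_init h) ipath_r. Qed.

Lemma prepend_uniq m x y : ks m = x 0 0 ->
  (forall n, y 0 (kd m + n) = kcomp m (x 0 n)) -> prepend m x = y.
Proof.
by move=> h hy; apply: (@ipath_eq_cofinal _ _ (kd m)) => n; rewrite hy prependP.
Qed.

Lemma shift_prepend m x : ks m = x 0 0 -> pshift (kd m) (prepend m x) = x.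
Proof.
move=> h; apply: ipath_eq => n /=; rewrite add0r.
apply: (@kcompI m); rewrite ?ipath_r//.
  by rewrite -[in LHS](prepend_init h) ipath_0s.
by rewrite -prependP// ipath_shift prepend_init.
Qed.

Lemma prepend_shift x n : prepend (x 0 n) (pshift n x) = x.
Proof.
apply: prepend_uniq => [|p]; rewrite ?ipath_0s /= add0r//.
by rewrite ipath_d ipath_shift.
Qed.

Lemma prependE m x : x 0 (kd m) = m -> exists2 w : infpath L, ks m = w 0 0 & x = prepend m w.
Proof.
move=> h; exists (pshift (kd m) x); first by rewrite -h ipath_0s/= add0r ipath_d.
by have := prepend_shift x (kd m); rewrite h => ->.
Qed.

Lemma prepend_comp m n x : ks m = kr n -> ks n = x 0 0 ->
  prepend (kcomp m n) x = prepend m (prepend n x).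
Proof.
move=> h1 h2; apply: prepend_uniq => [|p]; first by rewrite ks_comp.
rewrite kd_comp// -addrA prependP; last by rewrite prepend_r.
by rewrite prependP// kcompA// h2 ipath_r.
Qed.

Lemma prepend_inj m m' x x' : ks m = x 0 0 -> ks m' = x' 0 0 ->
  kd m = kd m' -> prepend m x = prepend m' x' -> m = m' /\ x = x'.
Proof.
move=> h h' e E; split; first by rewrite -(prepend_init h) E e prepend_init.
by rewrite -(shift_prepend h) -(shift_prepend h') E e.
Qed.

Lemma prepend_vertex x : prepend (x 0 0) x = x.
Proof.
apply: prepend_uniq => [|n]; first by rewrite ipath_0s.
by rewrite ipath_shift ipath_d.
Qed.

Lemma shiftD p q x : pshift p (pshift q x) = pshift (p + q) x.
Proof. by apply: ipath_eq => n /=; rewrite !add0r. Qed.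

Lemma shift_r p x : pshift p x 0 0 = x p 0. Proof. by rewrite /= add0r. Qed.

Lemma shift_prepend_le m x p : ks m = x 0 0 ->
  pshift (p + kd m) (prepend m x) = pshift p x.
Proof. by move=> h; rewrite -shiftD shift_prepend. Qed.

Lemma paths_inP (T : set L) x : paths_in (graphT T) x <-> forall p, T (x p 0).
Proof.
split=> h p; first by have := h p 0; rewrite /graphT/= ipath_s addr0.
by move=> n; rewrite /graphT/= ipath_s.
Qed.

Lemma paths_in_shift (T : set L) x p :
  paths_in (graphT T) x -> paths_in (graphT T) (pshift p x).
Proof. by move=> /paths_inP h; apply/paths_inP => q /=. Qed.

End Paths.

(** * Dickson's lemma *)

Section Dickson.

(** [g n] is the position of a minimum of [u] over the indices from [n] on; minima over shrinking
    sets of indices do not decrease. *)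
Lemma nondecreasing_subseq (u : nat -> nat) :
  exists2 f : nat -> nat, {homo f : i j / (i < j)%N} &
    {homo (u \o f) : i j / (i <= j)%N}.
Proof.
have hmin n : exists j, (n <= j)%N /\ forall i, (n <= i)%N -> (u j <= u i)%N.
  have hex : exists m, `[< exists2 j, (n <= j)%N & u j = m >].
    by exists (u n); apply/asboolP; exists n.
  case: (ex_minnP hex) => m /asboolP[j hj ej] hm; exists j; split=> // i hi.
  by rewrite ej; apply: hm; apply/asboolP; exists i.
have [g hg] := choice hmin.
pose f := fix f n := if n is n'.+1 then g (f n').+1 else g 0%N.
have fS n : (f n < f n.+1)%N by case: (hg (f n).+1).
have uS n : (u (f n) <= u (f n.+1))%N.
  case: n => [|n]; first by case: (hg 0%N) => _; apply.
  case: (hg (f n).+1) => _; apply.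
  by apply: leq_trans (ltnW (fS n.+1)); case: (hg (f n).+1).
exists f; first exact: homo_ltn ltn_trans fS.
by apply: homo_leq => // j i l; exact: leq_trans.
Qed.

Lemma dickson_subseq (X : eqType) (s : seq X) (u : nat -> X -> nat) :
  exists2 f : nat -> nat, {homo f : i j / (i < j)%N} &
    forall x, x \in s -> {homo (fun i => u (f i) x) : i j / (i <= j)%N}.
Proof.
elim: s => [|a s [f hf hu]]; first by exists id.
have [g hg hv] := nondecreasing_subseq (fun i => u (f i) a).
exists (f \o g) => [i j ij|x]; first by apply: hf; exact: hg.
rewrite inE => /predU1P[->//|xs] i j ij; apply: hu => //.
by have := ltnW_homo hg; apply.
Qed.

(** Without a finite basis, elements could be chosen one after the other so that none lies above an
    earlier one in all coordinates; a subsequence nondecreasing in every coordinate contradicts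
    this. *)
Lemma dickson_basis (Z : Type) (X : finType) (ev : Z -> X -> nat) (Q : set Z) :
  exists F : seq Z, (forall i z0, (i < size F)%N -> Q (nth z0 F i)) /\
    forall z, Q z -> exists i, (i < size F)%N /\
      forall x, (ev (nth z F i) x <= ev z x)%N.
Proof.
have [[z0 Qz0]|nQ] := pselect (Q !=set0); last first.
  by exists [::]; split => // z Qz; case: nQ; exists z.
apply: contrapT => hF.
have /choice[g hg] (F : seq Z) : exists z,
    (forall i, (i < size F)%N -> Q (nth z0 F i)) ->
    Q z /\ forall i, (i < size F)%N -> ~ forall x, (ev (nth z0 F i) x <= ev z x)%N.
  have [FQ|nFQ] := pselect (forall i, (i < size F)%N -> Q (nth z0 F i)); last by exists z0.
  apply: contrapT => hz; apply: hF; exists F; split=> [i z1 hi|z Qz].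
    by rewrite (set_nth_default z0)//; exact: FQ.
  apply: contrapT => hi; apply: hz; exists z => _; split=> // i hs hx.
  by apply: hi; exists i; split=> // x; rewrite (set_nth_default z0).
pose F := fix F n := if n is n'.+1 then rcons (F n') (g (F n')) else [::].
have sF n : size (F n) = n by elim: n => //= n IH; rewrite size_rcons IH.
have FQ n : forall i, (i < size (F n))%N -> Q (nth z0 (F n) i).
  elim: n => //= n IH i; rewrite size_rcons nth_rcons ltnS leq_eqVlt.
  case: ltngtP => //= ij _; first exact: IH.
  by case: (hg (F n) IH).
have nthF n i : (i < n)%N -> nth z0 (F n) i = g (F i).
  elim: n => //= n IH; rewrite ltnS leq_eqVlt nth_rcons sF => /predU1P[->|h].
    by rewrite ltnn eqxx.
  by rewrite h IH.
have [f hf hu] := dickson_subseq (enum X) (fun n => ev (g (F n))).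
have lt01 := hf 0%N 1%N isT.
have [_ /(_ (f 0%N))] := hg (F (f 1%N)) (@FQ _).
rewrite sF => /(_ lt01); apply => x; rewrite nthF//.
by apply: (hu x _ 0%N 1%N) => //; rewrite mem_enum.
Qed.

End Dickson.

(** * The action on infinite paths and its partial maps *)

Section Action.
Context {k : nat} {L : kgraph k} {G : groupType} (S : selfsim L G).
Implicit Types (m n l : L) (x y w : infpath L).

Lemma act_path_init g x (n : Nk k) : act_path S g x 0 n = ss_act S g (x 0 n).
Proof. by rewrite /= ss_res_vertex//; exact: ipath_vertex. Qed.

Lemma act_path_mul g h x : act_path S g (act_path S h x) = act_path S (g * h)%g x.
Proof. by apply: ipath_eq => n; rewrite !act_path_init ss_actM. Qed.

Lemma act_path1 x : act_path S 1%g x = x.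
Proof. by apply: ipath_eq => n; rewrite act_path_init ss_act1. Qed.

Lemma act_pathK g x : act_path S g^-1%g (act_path S g x) = x.
Proof. by rewrite act_path_mul mulVg act_path1. Qed.

Lemma act_pathVK g x : act_path S g (act_path S g^-1%g x) = x.
Proof. by rewrite act_path_mul mulgV act_path1. Qed.

Lemma act_path_shift g x (p : Nk k) :
  pshift p (act_path S g x) = act_path S (ss_res S g (x 0 p)) (pshift p x).
Proof. by apply: ipath_eq => n; rewrite act_path_init /= !add0r. Qed.

Lemma act_path_prepend g m x : ks m = x 0 0 ->
  act_path S g (prepend m x) = prepend (ss_act S g m) (act_path S (ss_res S g m) x).
Proof.
move=> h; have hr (n : Nk k) : ks m = kr (x 0 n) by rewrite ipath_r.
apply/esym/prepend_uniq => [|n].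
  have [-> _] := ss_act_comp S g (hr 0).
  by rewrite act_path_init vertex_rE// /vertices/= ss_act_d ipath_d.
rewrite act_path_init ss_act_d prependP//.
by have [_ ->] := ss_act_comp S g (hr n); rewrite act_path_init.
Qed.

(* The partial map n w |-> m (g w) on infinite paths, with domain [tdom n]. *)
Definition tact m g n x := prepend m (act_path S g (pshift (kd n) x)).
Definition tdom n x := x 0 (kd n) = n.

Lemma tdom_kext n x l : tdom n x -> x 0 (kd l) = l -> leN (kd n) (kd l) -> kext n l.
Proof.
by move=> hn hl le; rewrite -[in kext n _]hn -[in kext _ l]hl; exact: ipath_kext.
Qed.

Lemma kext_tdom n x l : x 0 (kd l) = l -> kext n l -> tdom n x.
Proof.
move=> hl he; apply: (@kext_uniq _ _ _ _ l) => //; last by rewrite ipath_d.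
by rewrite -[in kext _ l]hl; apply: ipath_kext; exact: kext_d.
Qed.

Hypothesis A1 : forall g (v : L), vertices v -> ss_act S g v = v.

Lemma act_s g m : ks (ss_act S g m) = ks m.
Proof. by rewrite ss_act_s A1//; exact: vertex_s. Qed.
Lemma act_r g m : kr (ss_act S g m) = kr m.
Proof. by rewrite ss_act_r A1//; exact: vertex_r. Qed.
Lemma act_path_v g x p : act_path S g x p 0 = x p 0.
Proof. by rewrite /= A1//; exact: ipath_vertex. Qed.
Lemma paths_in_act (T : set L) g x :
  paths_in (graphT T) x -> paths_in (graphT T) (act_path S g x).
Proof. by move=> /paths_inP h; apply/paths_inP => p; rewrite act_path_v. Qed.

Lemma tact_compat m g n x : tdom n x -> ks m = ks n ->
  ks m = act_path S g (pshift (kd n) x) 0 0.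
Proof. by move=> h ->; rewrite act_path_v/= add0r -{1}h ipath_0s. Qed.

(** Continuity of the partial maps, with the change of depth made explicit: [kd n] is traded for
    [kd m]. It makes non-coincidence at a path an open condition. *)
Lemma tact_local m g n x y (p q : Nk k) : ks m = ks n -> tdom n x ->
  leN (kd n + p) q -> x 0 q = y 0 q ->
  tact m g n x 0 (kd m + p) = tact m g n y 0 (kd m + p).
Proof.
move=> hs hx le e.
have e1 : x 0 (kd n + p) = y 0 (kd n + p) by exact: ipath_eq_le e.
have e2 : x 0 (kd n) = y 0 (kd n) by apply: ipath_eq_le e1; exact: leN_addr.
have hy : tdom n y by rewrite /tdom -e2.
rewrite !prependP; [|exact: tact_compat..].
rewrite !act_path_init/= !add0r; congr (kcomp m (ss_act S g _)).
apply: (@kcompI _ _ (x 0 (kd n))); first exact: ipath_compat.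
  by rewrite e2; exact: ipath_compat.
by rewrite -ipath_shift e2 -ipath_shift.
Qed.

(** On the cylinder of an extension [l] of [n] the partial map again has the form w |-> a (h w),
    with fixed [a] and [h]. This normal form allows two partial maps to be compared on a common
    cylinder. *)
Lemma tact_prepend m g n l w : ks m = ks n -> kext n l -> ks l = w 0 0 ->
  tact m g n (prepend l w) =
    prepend (kcomp m (ss_act S g (ksuf n l)))
            (act_path S (ss_res S g (ksuf n l)) w).
Proof.
move=> hs /ksufP[hc e] hw.
have hb : ks (ksuf n l) = w 0 0 by rewrite -hw [in RHS]e ks_comp.
rewrite /tact {1}e prepend_comp// shift_prepend; last by rewrite prepend_r.
rewrite act_path_prepend// prepend_comp//; first by rewrite act_r hs.
by rewrite act_path_v act_s.
Qed.

(** Each vertex of the new path is connected to a vertex of [w], so condition (i) of a maximal tail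
    applies. *)
Lemma paths_in_prepend (T : set L) l w : maximal_tail T -> ks l = w 0 0 ->
  paths_in (graphT T) w -> paths_in (graphT T) (prepend l w).
Proof.
move=> [_ hT _ _] h /paths_inP hw; apply/paths_inP => p.
have e := shift_prepend h; apply: (hT (w p 0)) => //; first exact: ipath_vertex.
exists (prepend l w p (kd l)); rewrite ipath_r ipath_s; split => //.
by rewrite -[in RHS]e.
Qed.

End Action.

(** * Generic paths and periodicity *)

Section Generic.
Context {k : nat} {L : kgraph k} {G : groupType} (S : selfsim L G).
Implicit Types (l : L) (x y w : infpath L) (T : set L).
Hypothesis A1 : forall g (v : L), vertices v -> ss_act S g v = v.

Local Notation tac t := (tact S t.1.1 t.1.2 t.2).
Implicit Type t : L * G * L.

Definition valid t := ks t.1.1 = ks t.2.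

(** Used with [T] and with [setT]; in the second case the maps coincide on the whole cylinder,
    whatever tail its paths belong to. *)
Definition agree T t t' l := forall w,
  paths_in (graphT T) w -> w 0 0 = ks l ->
  tac t (prepend l w) = tac t' (prepend l w).

(* Such paths exist by a Baire argument: two partial maps that differ at a path
   differ on a neighbourhood of it. *)
Definition generic T x :=
  [/\ paths_in (graphT T) x, cofinal_in (graphT T) x &
      forall t t' : L * G * L, valid t -> valid t' ->
        tdom t.2 x -> tdom t'.2 x ->
        tac t x = tac t' x ->
        exists l, [/\ x 0 (kd l) = l, kext t.2 l, kext t'.2 l & agree T t t' l]].

Let good T t t' l := valid t -> valid t' ->
  (forall y, paths_in (graphT T) y -> y 0 (kd l) = l ->
    tdom t.2 y -> tdom t'.2 y ->
    tac t y <> tac t' y) \/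
  (forall y, paths_in (graphT T) y -> y 0 (kd l) = l ->
    tdom t.2 y -> tdom t'.2 y ->
    tac t y = tac t' y).

(** The path is first extended by degree (1, ..., 1) and, when [v] is in the tail, to a common
    descendant of [v]. Then either the two maps agree on the whole cylinder or some [y] separates
    them, and a long initial segment of [y] has a cylinder on which they differ everywhere. *)
Let generic_step T t t' v l : maximal_tail T -> T (ks l) ->
  exists l', [/\ T (ks l'), kext l l', leN (kd l + constN 1) (kd l'),
    T v -> exists l0, kr l0 = v /\ ks l0 = ks l' & good T t t' l'].
Proof.
move=> [[_ Tv] T1 T2 T3] Tl.
have [b [rb db Tb]] := T2 (ks l) (constN 1) Tl.
pose l1 := kcomp l b.
have sl1 : ks l1 = ks b by rewrite ks_comp.
have e1 : kext l l1 by exists b.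
have d1 : kd l1 = kd l + constN 1 by rewrite kd_comp// db.
have [l2 [Tl2 e2 r2]] : exists l2, [/\ T (ks l2), kext l1 l2 &
    T v -> exists l0, kr l0 = v /\ ks l0 = ks l2].
  have [Tv0|nTv] := pselect (T v); last by exists l1; split; rewrite ?sl1//; exact: kext_refl.
  have [w [Tw [c [rc sc]] [c' [rc' sc']]]] := T3 _ _ Tb Tv0.
  have hc : ks l1 = kr c by rewrite sl1 rc.
  exists (kcomp l1 c); rewrite ks_comp// sc; split=> //; first by exists c.
  by move=> _; exists c'.
have d2 : leN (kd l + constN 1) (kd l2) by rewrite -d1; exact: kext_d.
have el2 : kext l l2 by exact: kext_trans e2.
have [h|h] := pselect (good T t t' l2); first by exists l2.
have {h}[hs hs' [y [Ty yl2 dy dy' ne]]] : [/\ valid t, valid t' &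
  exists y, [/\ paths_in (graphT T) y, y 0 (kd l2) = l2, tdom t.2 y, tdom t'.2 y &
   tac t y <> tac t' y]].
  apply: contrapT => hn; apply: h => hs hs'; right => y Ty yl dy dy'.
  by apply: contrapT => ne; apply: hn; split=> //; exists y.
have [p np] := ipath_neq ne.
(* At degree [p] the two images of [y] differ; the initial segment of degree [M] decides both images
   up to [p]. *)
pose M := kd l2 + (kd t.2 + p) + (kd t'.2 + p).
have le2 : leN (kd l2) M by rewrite /M -addrA; exact: leN_addr.
have e3 : kext l2 (y 0 M) by rewrite -[in kext l2 _]yl2; exact: ipath_kext.
exists (y 0 M); split.
- by rewrite ipath_0s; have /paths_inP := Ty; apply.
- exact: kext_trans e3.
- by apply: leN_trans d2 _; exact: kext_d.
- move=> /r2[l0 [r0 s0]]; case: e3 => c hc ->; exists (kcomp l0 c).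
  by rewrite kr_comp ?ks_comp ?s0.
move=> _ _; left => z Tz; rewrite ipath_d => zM dz dz' ez; apply: np.
have le4 : leN (kd t.2 + p) M.
  by apply: leN_trans (leN_addr _ _); exact: leN_addl.
have le5 : leN (kd t'.2 + p) M by exact: leN_addl.
have := tact_local A1 t.1.2 hs dy le4 (esym zM).
move=> /(ipath_eq_le (@leN_addl _ _ _)) ->.
rewrite ez; apply/esym.
have := tact_local A1 t'.1.2 hs' dy' le5 (esym zM).
by move=> /(ipath_eq_le (@leN_addl _ _ _)).
Qed.

Hypothesis G_countable : countable [set: G].

Let task := ((L * G * L) * (L * G * L) * L)%type.

Let ex_enum (t0 : task) : exists en : nat -> task, forall z, exists i, en i = z.
Proof.
have /countable_injP[f hf] := G_countable.
have fI g h : f g = f h -> g = h by move=> e; apply: hf; rewrite ?inE.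
pose code (z : task) := pickle (z.1.1.1.1, f z.1.1.1.2, z.1.1.2,
  (z.1.2.1.1, f z.1.2.1.2, z.1.2.2), z.2).
have codeI (z z' : task) : code z = code z' -> z = z'.
  move=> /(pcan_inj pickleK); case: z => [[[[a b] c] [[a' b'] c']] v].
  by case: z' => [[[[? ?] ?] [[? ?] ?]] ?] /= [-> /fI -> -> -> /fI -> -> ->].
exists (fun i => xget t0 [set z | code z = i]) => z; exists (code z).
by case: xgetP => [z' _ /= /codeI //|/(_ z)[]].
Qed.

(** A task is a pair of triples together with a vertex to be reached. Countably many tasks exist
    because [G] is countable, and each extension [lam n.+1] settles one of them. *)
Lemma ex_generic T v : maximal_tail T -> T v ->
  exists x, generic T x /\ x 0 0 = v.
Proof.
move=> hT Tv; have [[_ Tvert] T1 T2 T3] := hT.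
have vv := Tvert _ Tv; have [rv sv] := vertexE vv.
have [en hen] := ex_enum ((v, 1%g, v), (v, 1%g, v), v).
have hst (a : nat * L) : exists l', T (ks a.2) -> [/\ T (ks l'), kext a.2 l',
    leN (kd a.2 + constN 1) (kd l'),
    T (en a.1).2 -> exists l0, kr l0 = (en a.1).2 /\ ks l0 = ks l' &
    good T (en a.1).1.1 (en a.1).1.2 l'].
  have [h|h] := pselect (T (ks a.2)); last by exists v.
  by have [l' hl'] := generic_step (en a.1).1.1 (en a.1).1.2 (en a.1).2 hT h; exists l'.
have [F hF] := choice hst.
pose lam := fix lam n := if n is n'.+1 then F (n', lam n') else v.
have Tlam n : T (ks (lam n)).
  by elim: n => [|n /(hF (n, lam n))[]//]; rewrite /= sv.
have lamE n := hF (n, lam n) (Tlam n).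
have lam_ext i j : (i <= j)%N -> kext (lam i) (lam j).
  apply: (@homo_leq _ lam kext) => [a|b a c|n]; first exact: kext_refl.
    exact: kext_trans.
  by have [] := lamE n.
have lam_d n : leN (constN n) (kd (lam n)).
  elim: n => [|n IH]; first by move=> i; rewrite ffunE.
  have [_ _ h _ _] := lamE n; apply: leN_trans h.
  have -> : @constN k n.+1 = constN n + constN 1.
    by apply/ffunP => i; rewrite !ffunE natDE addn1.
  by apply: leN_add => //; exact: leNn.
(* [lam n] has degree at least (n, ..., n), and the sum of the coordinates of [p] bounds each of
   them. *)
pose mu (p : Nk k) := lam (\sum_i p i)%N.
have [||x hx] := @ex_limit_path _ _ mu.
- move=> p; apply: leN_trans (lam_d _) => i; rewrite ffunE (bigD1 i)//=.
  exact: leq_addr.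
- by move=> p q h; apply: lam_ext; apply: leq_sum => i _; exact: h.
have xlam i : x 0 (kd (lam i)) = lam i.
  set j := (\sum_a kd (lam i) a)%N.
  apply: (@kext_uniq _ _ _ _ (lam (maxn i j))); last by rewrite ipath_d.
    apply: kext_trans (hx _) _; apply: lam_ext; exact: leq_maxr.
  by apply: lam_ext; exact: leq_maxl.
have Tx : paths_in (graphT T) x.
  apply/paths_inP => p; have [b hb e] := hx p.
  apply: (T1 (ks (mu p))); [exact: Tlam|exact: ipath_vertex|].
  exists b; rewrite -hb ipath_0s; split=> //.
  by rewrite e ks_comp.
exists x; split; last first.
  by have := xlam 0%N; rewrite /= vv.
split=> //.
  move=> u; rewrite /graphT/= => Tu uv.
  have [i hi] := hen ((v, 1%g, v), (v, 1%g, v), u).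
  have [_ _ _ + _] := lamE i; rewrite hi /= (vertex_sE uv) in Tu *.
  move=> /(_ Tu)[l0 [r0 s0]]; exists (kd (lam i.+1)), l0.
  rewrite /graphT/= s0; split=> //; first exact: (Tlam i.+1).
  by rewrite -ipath_0s (xlam i.+1).
move=> t t' hs hs' dx dx' ex.
have [i hi] := hen (t, t', v).
have [_ _ _ _] := lamE i; rewrite hi /= => /(_ hs hs')[h|h].
  by exfalso; apply: (h x) => //; exact: (xlam i.+1).
pose M := kd (lam i.+1) + kd t.2 + kd t'.2.
have leM : leN (kd (lam i.+1)) M by rewrite /M -addrA; exact: leN_addr.
have leM1 : leN (kd t.2) M.
  by apply: leN_trans (leN_addr _ _); exact: leN_addl.
have leM2 : leN (kd t'.2) M by exact: leN_addl.
have xM : x 0 (kd (x 0 M)) = x 0 M by rewrite ipath_d.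
have k1 : kext t.2 (x 0 M) by apply: tdom_kext dx xM _; rewrite ipath_d.
have k2 : kext t'.2 (x 0 M) by apply: tdom_kext dx' xM _; rewrite ipath_d.
exists (x 0 M); split=> // w Tw w0.
have eM : prepend (x 0 M) w 0 (kd (x 0 M)) = x 0 M by exact: prepend_init.
apply: h.
- by apply: paths_in_prepend.
- apply: (@kext_tdom _ _ _ _ (x 0 M)) => //.
  by have := ipath_kext x leM; rewrite (xlam i.+1).
- exact: kext_tdom eM _.
- exact: kext_tdom eM _.
Qed.

Lemma ex_path T v : maximal_tail T -> T v ->
  exists2 x, paths_in (graphT T) x & x 0 0 = v.
Proof. by move=> hT /(ex_generic hT)[x [[]]]; exists x. Qed.

Lemma ksuf_d (m l : L) : kext m l -> kd l = kd m + kd (ksuf m l).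
Proof. by move=> /ksufP[h e]; rewrite {1}e kd_comp. Qed.

(** On the cylinder of [l] the maps are w |-> a (h w) and w |-> a' (h' w). Replacing w by h'^-1 w
    turns their agreement on the tail into a cycline triple (a, h h'^-1, a'), so (A2) forces h = h'
    and the degree difference lies in Per. If the degrees agree, then a = a', and this equality no
    longer refers to the tail. *)
Lemma agree_local T t t' l :
  maximal_tail T ->
  (forall m g n, cycline S (graphT T) m g n -> g = 1%g) ->
  T (ks l) -> valid t -> valid t' ->
  kext t.2 l -> kext t'.2 l -> agree T t t' l ->
  Per S (graphT T) (degdiff (kd t.1.1) (kd t.2) - degdiff (kd t'.1.1) (kd t'.2)) /\
  (degdiff (kd t.1.1) (kd t.2) = degdiff (kd t'.1.1) (kd t'.2) ->
   agree setT t t' l).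
Proof.
case: t => [[m g] n]; case: t' => [[m' g'] n'] /= hT A2 Tl hs hs' e e' ag.
set a := kcomp m (ss_act S g (ksuf n l)).
set h := ss_res S g (ksuf n l).
set a' := kcomp m' (ss_act S g' (ksuf n' l)).
set h' := ss_res S g' (ksuf n' l).
have aE w : ks l = w 0 0 -> tact S m g n (prepend l w) = prepend a (act_path S h w).
  by move=> ?; rewrite tact_prepend.
have aE' w : ks l = w 0 0 -> tact S m' g' n' (prepend l w) = prepend a' (act_path S h' w).
  by move=> ?; rewrite tact_prepend.
have [c1 c2] := ksufP e; have [c1' c2'] := ksufP e'.
have ka : ks m = kr (ss_act S g (ksuf n l)) by rewrite (act_r A1) hs.
have ka' : ks m' = kr (ss_act S g' (ksuf n' l)) by rewrite (act_r A1) hs'.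
have sa : ks a = ks l by rewrite ks_comp// (act_s A1) [in RHS]c2 ks_comp.
have sa' : ks a' = ks l by rewrite ks_comp// (act_s A1) [in RHS]c2' ks_comp.
have da : kd a = kd m + kd (ksuf n l) by rewrite kd_comp// ss_act_d.
have da' : kd a' = kd m' + kd (ksuf n' l) by rewrite kd_comp// ss_act_d.
have dl := ksuf_d e; have dl' := ksuf_d e'.
have key w : paths_in (graphT T) w -> w 0 0 = ks l ->
    prepend a (act_path S h w) = prepend a' (act_path S h' w).
  by move=> Tw w0; rewrite -aE// -aE'//; exact: ag.
have cyc : cycline S (graphT T) a (h * h'^-1)%g a'.
  split; rewrite /graphT/= ?sa ?sa' ?A1//; first exact: vertex_s.
  move=> w Tw w0; rewrite -act_path_mul key ?act_pathVK//.
    exact: paths_in_act.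
  by rewrite act_path_v.
have hh : h = h' by rewrite -[LHS]mulg1 -(mulVg h') mulgA (A2 _ _ _ cyc) mul1g.
have dd : degdiff (kd a) (kd a') = degdiff (kd m) (kd n) - degdiff (kd m') (kd n').
  apply/ffunP => i; rewrite da da' !ffunE !natDE !PoszD.
  move/ffunP/(_ i): dl'; move/ffunP/(_ i): dl; rewrite !ffunE !natDE => -> /eqP.
  rewrite -eqz_nat !PoszD => /eqP e0.
  lra.
split.
  exists a, a'; split; last by rewrite dd.
  by rewrite hh mulgV in cyc.
move=> ed w _ w0; rewrite /= aE// aE'// hh.
have ea : kd a = kd a' by apply: degdiff_eq0; rewrite dd ed subrr.
have [x Tx x0] := ex_path hT Tl.
have := key x Tx x0; rewrite hh => /prepend_inj[]//.
- by rewrite act_path_v// sa.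
- by rewrite act_path_v// sa'.
by move=> ->.
Qed.

Definition tdeg t : Zk k := degdiff (kd t.1.1) (kd t.2).

Definition coincide t t' y := [/\ tdom t.2 y, tdom t'.2 y &
  tac t y = tac t' y].

Lemma coincide_deg T x t t' : maximal_tail T ->
  (forall m g n, cycline S (graphT T) m g n -> g = 1%g) ->
  generic T x -> valid t -> valid t' -> coincide t t' x ->
  Per S (graphT T) (tdeg t - tdeg t').
Proof.
move=> Tmax A2 [Tx _ gx] ht ht' [d d' e].
have [l [hl k1 k2 ag]] := gx t t' ht ht' d d' e.
have Tl : T (ks l) by rewrite -hl ipath_0s; move/paths_inP: Tx; apply.
by have [] := agree_local Tmax A2 Tl ht ht' k1 k2 ag.
Qed.

(** The path [y] may lie in any tail. Failure of coincidence is open because the partial maps are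
    continuous and their domains are decided by initial segments; coincidence is open because, with
    equal degrees, [agree_local] passes from [T] to all paths. *)
Lemma coincide_local T x t t' : maximal_tail T ->
  (forall m g n, cycline S (graphT T) m g n -> g = 1%g) ->
  generic T x -> valid t -> valid t' ->
  (coincide t t' x -> tdeg t = tdeg t') ->
  exists N, forall y, y 0 N = x 0 N -> (coincide t t' x <-> coincide t t' y).
Proof.
move=> Tmax A2 [Tx _ gx] ht ht' hdeg.
have tdomE n (M : Nk k) y : leN (kd n) M -> y 0 M = x 0 M -> (tdom n y <-> tdom n x).
  by move=> le e; rewrite /tdom (ipath_eq_le le e).
have [[d d']|nd] := pselect (tdom t.2 x /\ tdom t'.2 x); last first.
  exists (maxN (kd t.2) (kd t'.2)) => y e.
  have h1 := tdomE _ _ _ (leN_maxl _ _) e; have h2 := tdomE _ _ _ (leN_maxr _ _) e.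
  split=> [[a b _]|[/h1 a /h2 b _]]; by case: nd.
have [e|ne] := pselect (tac t x = tac t' x).
  have [l [hl k1 k2 ag]] := gx t t' ht ht' d d' e.
  have Tl : T (ks l) by rewrite -hl ipath_0s; move/paths_inP: Tx; apply.
  have [_ /(_ (hdeg (And3 d d' e)))] := agree_local Tmax A2 Tl ht ht' k1 k2 ag.
  move=> agT; exists (kd l) => y; rewrite hl => hy; split=> // _.
  have [w hw ey] := prependE hy.
  split; [exact: kext_tdom hy k1|exact: kext_tdom hy k2|].
  rewrite ey; apply: agT => //; apply/paths_inP => p //.
have [p np] := ipath_neq ne.
exists ((kd t.2 + p) + (kd t'.2 + p)) => y ey; split=> [[_ _ //]|[_ _ e]].
exfalso; apply: np.
have l1 := tact_local A1 t.1.2 ht d (leN_addr _ (kd t'.2 + p)) (esym ey).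
have l2 := tact_local A1 t'.1.2 ht' d' (leN_addl (kd t.2 + p) _) (esym ey).
by rewrite (ipath_eq_le (leN_addl _ _) l1) (ipath_eq_le (leN_addl _ _) l2) e.
Qed.

Lemma coincide_seq T x (r : seq (L * G * L)) : maximal_tail T ->
  (forall m g n, cycline S (graphT T) m g n -> g = 1%g) ->
  generic T x -> (forall t, t \in r -> valid t) ->
  (forall t t', t \in r -> t' \in r -> coincide t t' x -> tdeg t = tdeg t') ->
  exists N, forall y, y 0 N = x 0 N ->
    forall t t', t \in r -> t' \in r -> (coincide t t' x <-> coincide t t' y).
Proof.
move=> Tmax A2 gx hr hd.
have pairs (q : seq ((L * G * L) * (L * G * L))) :
   (forall z, z \in q -> z.1 \in r /\ z.2 \in r) ->
   exists N, forall y, y 0 N = x 0 N -> forall z, z \in q ->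
     (coincide z.1 z.2 x <-> coincide z.1 z.2 y).
  elim: q => [|z q IH] hq; first by exists 0.
  have [|N hN] := IH; first by move=> w wq; apply: hq; rewrite inE wq orbT.
  have [z1 z2] := hq z (mem_head _ _).
  have [M hM] := coincide_local Tmax A2 gx (hr _ z1) (hr _ z2) (hd _ _ z1 z2).
  exists (maxN M N) => y ey w; rewrite inE => /predU1P[->|wq].
    by apply: hM; apply: ipath_eq_le ey; exact: leN_maxl.
  by apply: hN => //; apply: ipath_eq_le ey; exact: leN_maxr.
have [|N hN] := pairs [seq (t, t') | t <- r, t' <- r].
  by move=> z /allpairsP[[t t'] [/= h1 h2 ->]].
exists N => y ey t t' tr tr'.
by have := hN y ey (t, t') (allpairs_f pair tr tr').
Qed.

End Generic.

(** * Cycline pairs of a maximal tail, Per and H_T *)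

Section Periodicity.
Context {k : nat} {L : kgraph k} {G : groupType} (S : selfsim L G).
Implicit Types (l m n : L) (v : L) (x : infpath L) (p q : Nk k).
Hypothesis A1 : forall g (v : L), vertices v -> ss_act S g v = v.
Hypothesis G_countable : countable [set: G].
Variable T : set L.
Hypothesis Tmax : maximal_tail T.

Definition cyc m n := cycline S (graphT T) m 1%g n.

Let T1 : forall v w, T v -> vertices w ->
  (exists l : L, kr l = w /\ ks l = v) -> T w.
Proof. by case: Tmax. Qed.
Let T2 : forall v p, T v -> exists l : L, [/\ kr l = v, kd l = p & T (ks l)].
Proof. by case: Tmax. Qed.
Let T3 : forall v1 v2, T v1 -> T v2 -> exists w, [/\ T w,
        exists l : L, kr l = v1 /\ ks l = w &
        exists l : L, kr l = v2 /\ ks l = w].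
Proof. by case: Tmax. Qed.
Let Tv v : T v -> vertices v.
Proof. exact: tail_vertex. Qed.
Let Tr l : T (ks l) -> T (kr l).
Proof. by move=> h; apply: (T1 h); [exact: vertex_r|exists l]. Qed.

Lemma cycP m n : cyc m n <-> [/\ T (ks m), ks m = ks n &
  forall x, paths_in (graphT T) x -> x 0 0 = ks n -> prepend m x = prepend n x].
Proof.
split=> [[h1 h2 h3 h4]|[h1 h2 h3]].
  rewrite ss_act1 in h3; split=> // x Tx x0.
  by rewrite -h4// act_path1.
split; rewrite /graphT/= ?ss_act1 -?h2// => x Tx x0.
by rewrite act_path1 h3// -h2.
Qed.

Lemma cyc_sym m n : cyc m n -> cyc n m.
Proof.
move=> /cycP[h1 h2 h3]; apply/cycP; split=> [||x Tx x0]; rewrite -?h2//.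
by rewrite h3// x0.
Qed.

Lemma cyc_refl m : T (ks m) -> cyc m m.
Proof. by move=> h; apply/cycP. Qed.

Lemma cyc_trans n m m' : cyc m n -> cyc n m' -> cyc m m'.
Proof.
move=> /cycP[h1 h2 h3] /cycP[h1' h2' h3']; apply/cycP; split=> //.
  by rewrite h2.
by move=> x Tx x0; rewrite h3 ?h2'// h3'.
Qed.

Lemma cyc_r m n : cyc m n -> kr m = kr n.
Proof.
move=> /cycP[h1 h2 h3]; have [x Tx x0] := ex_path A1 G_countable Tmax h1.
by rewrite -(@prepend_r _ _ m x) -?(@prepend_r _ _ n x) ?h3 ?x0 -?h2.
Qed.

Lemma cyc_eq m n : cyc m n -> kd m = kd n -> m = n.
Proof.
move=> /cycP[h1 h2 h3] e; have [x Tx x0] := ex_path A1 G_countable Tmax h1.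
by have [] := @prepend_inj _ _ m n x x _ _ e; rewrite ?x0 ?h3 -?h2.
Qed.

Lemma cyc_compr m n l : cyc m n -> ks m = kr l -> T (ks l) ->
  cyc (kcomp m l) (kcomp n l).
Proof.
move=> /cycP[h1 h2 h3] hl Tl; have hl' : ks n = kr l by rewrite -h2.
apply/cycP; rewrite !ks_comp//; split=> // x Tx x0.
rewrite !prepend_comp//; apply: h3; first exact: paths_in_prepend.
by rewrite prepend_r.
Qed.

(** The paths l m x and n x are equal, so [l] is the initial segment of [n] of its degree; removing
    it from both leaves a cycline pair. *)
Lemma cyc_cancel l m n q : ks l = kr m -> cyc (kcomp l m) n ->
  kd n = kd l + q -> exists2 n', kd n' = q & cyc m n' /\ n = kcomp l n'.
Proof.
move=> hc cn dn; have [h1 h2 h3] := (cycP _ _).1 cn.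
rewrite ks_comp// in h1 h2.
have [x Tx x0] := ex_path A1 G_countable Tmax h1.
have e := h3 x Tx; rewrite x0 -h2 prepend_comp// in e.
have [l' dl' el'] : exists2 l', kd l' = kd l & kext l' n.
  by apply: ex_prefix; rewrite dn; exact: leN_addr.
have ll' : l = l'.
  have hn : ks n = x 0 0 by rewrite x0 h2.
  have hm : ks l = prepend m x 0 0 by rewrite prepend_r// x0.
  have := prepend_init hm; rewrite (e erefl) => <-.
  apply: (@kext_uniq _ _ _ _ n) => //; last by rewrite ipath_d.
  by have := ipath_kext (prepend n x) (leN_addr (kd l) q); rewrite -dn prepend_init.
case: el' => n' hn' en; rewrite -ll' in hn' en.
have dn' : kd n' = q by apply: (@addNI _ (kd l)); rewrite -kd_comp// -en.
exists n' => //; split=> //; apply/cycP.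
have hs : ks m = ks n' by rewrite h2 en ks_comp.
split=> // y Ty y0; have := h3 y Ty; rewrite en ks_comp// => /(_ y0).
rewrite !prepend_comp ?hs// => /prepend_inj[]//; by rewrite prepend_r// hs.
Qed.

(* The existence half of the condition defining H_T; uniqueness is [cyc_eq]. *)
Definition persist p q v := T v /\ forall m, kr m = v -> kd m = p -> T (ks m) ->
  exists2 n, kd n = q & cyc m n.

(** Write l m = a b with d(a) = p. At the range of [l], [a] is exchanged for some [a'] of degree
    [q]; as a' b has degree d(l) + q, [cyc_cancel] removes [l] from it. *)
Lemma persist_her p q l : persist p q (kr l) -> T (ks l) -> persist p q (ks l).
Proof.
move=> [Tl h] Tsl; split=> // m rm dm Tm.
have hc : ks l = kr m by [].
have [a da ea] : exists2 a, kd a = p & kext a (kcomp l m).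
  by apply: ex_prefix; rewrite kd_comp// dm; exact: leN_addl.
have ra : kr a = kr l by rewrite -(kext_r ea) kr_comp.
case: ea => b hb eb.
have sb : ks b = ks m by rewrite -(ks_comp hb) -eb ks_comp.
have Ta : T (ks a) by rewrite hb; apply: Tr; rewrite sb.
have [a' da' ca] := h a ra da Ta.
have := cyc_compr ca hb; rewrite sb -eb => /(_ Tm) cm.
have ha' : ks a' = kr b by have /cycP[_ <-] := ca.
have db : kd b = kd l.
  by apply: (@addNI _ p); rewrite -{1}da -kd_comp// -eb kd_comp// dm addrC.
have [|n' dn' [cn' _]] := cyc_cancel (q := q) hc cm; last by exists n'.
by rewrite kd_comp// da' db addrC.
Qed.

Lemma persist_red p q l : persist (kd l + p) (kd l + q) (kr l) -> T (ks l) ->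
  persist p q (ks l).
Proof.
move=> [Tl h] Tsl; split=> // m rm dm Tm.
have hc : ks l = kr m by [].
have [|||n dn cn] := h (kcomp l m).
- by rewrite kr_comp.
- by rewrite kd_comp// dm.
- by rewrite ks_comp.
by have [n' dn' [cn' _]] := cyc_cancel hc cn dn; exists n'.
Qed.

Lemma persist_diag p v : T v -> persist p p v.
Proof. by move=> h; split=> // m _ dm Tm; exists m => //; exact: cyc_refl. Qed.

(** Write m = a b with degrees [p'] and [p]. First [a] is exchanged at [v], then [b] at its range,
    where persistence of (p, q) is inherited. *)
Lemma persistD p q p' q' v : persist p q v -> persist p' q' v ->
  persist (p + p') (q + q') v.
Proof.
move=> W [_ h']; have [Tl h] := W; split=> // m rm dm Tm.
have [a da [b hb eb]] : exists2 a, kd a = p' & kext a m.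
  by apply: ex_prefix; rewrite dm; exact: leN_addl.
have sb : ks b = ks m by rewrite eb ks_comp.
have db : kd b = p by apply: (@addNI _ p'); rewrite -{1}da -kd_comp// -eb dm addrC.
have ra : kr a = v by rewrite -rm eb kr_comp.
have Ta : T (ks a) by rewrite hb; apply: Tr; rewrite sb.
have [a' da' ca] := h' a ra da Ta.
have [_ hb'] : persist p q (ks a) by apply: persist_her; rewrite ?ra.
have [|b' db' cb] := hb' b (esym hb) db; first by rewrite sb.
have /cycP[_ sa' _] := ca.
have hab' : ks a' = kr b by rewrite -sa'.
have c1 := cyc_compr ca hb; rewrite sb in c1.
have rb' : ks a' = kr b' by rewrite -(cyc_r cb).
exists (kcomp a' b'); first by rewrite kd_comp// da' db' addrC.
rewrite eb; apply: cyc_trans (c1 Tm) _; apply/cycP.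
have /cycP[_ sb' hx] := cb.
rewrite !ks_comp// sb; split=> //; first by rewrite -sb' sb.
move=> x Tx x0; rewrite !prepend_comp ?hx//.
by rewrite x0 sb'.
Qed.

(** For [l] of degree d(m) with range s(m), the pair (m l, n l) is cycline and n l has degree d(m) +
    d(n); cancelling [m] leaves a partner of [l] of degree d(n). *)
Lemma cyc_persist m n : cyc m n -> persist (kd m) (kd n) (ks m).
Proof.
move=> c; have /cycP[Tm sm _] := c; split=> // l rl dl Tl.
have := cyc_compr c (esym rl) Tl => c'.
have [||n' dn' [cn' _]] := cyc_cancel (q := kd n) _ c' => //; last by exists n'.
by rewrite kd_comp -?sm// dl addrC.
Qed.

Lemma persist_Per p q v : persist p q v -> Per S (graphT T) (degdiff p q).
Proof.
move=> [Tl h]; have [m [rm dm Tm]] := T2 p Tl.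
have [n dn cn] := h m rm dm Tm; exists m, n; split=> //.
by rewrite dm dn.
Qed.

Lemma Per_persist p q : Per S (graphT T) (degdiff p q) -> exists v, persist p q v.
Proof.
move=> [m [n [c e]]]; have W := cyc_persist c; have [Tm _] := W.
have [l [rl dl Tl]] := T2 (kd m) Tm; exists (ks l).
apply: persist_red => //; rewrite rl dl addrC.
(* Thus adding the trivial pair (p, p) to (d(m), d(n)) gives (d(m) + p, d(m) + q), from which
   [persist_red] has removed d(m). *)
have -> : kd m + q = kd n + p.
  apply/ffunP => i; move/ffunP/(_ i): e; rewrite !ffunE !natDE => e.
  by apply/eqP; rewrite -eqz_nat !PoszD; apply/eqP; lra.
by rewrite addrC; apply: persistD => //; exact: persist_diag.
Qed.

Lemma persist_common p q p' q' v v' : persist p q v -> persist p' q' v' ->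
  exists u, persist p q u /\ persist p' q' u.
Proof.
move=> W W'; have [Tl _] := W; have [Tl' _] := W'.
have [u [Tu [l [rl sl]] [l' [rl' sl']]]] := T3 Tl Tl'.
exists u; split.
  by rewrite -sl; apply: persist_her; rewrite ?rl ?sl.
by rewrite -sl'; apply: persist_her; rewrite ?rl' ?sl'.
Qed.

Lemma Per0 : Per S (graphT T) 0.
Proof.
have [v Tl] : T !=set0 by case: Tmax => -[].
by rewrite -(degdiffnn (0 : Nk k)); apply: persist_Per (persist_diag _ Tl).
Qed.

Lemma PerD a b : Per S (graphT T) a -> Per S (graphT T) b ->
  Per S (graphT T) (a + b).
Proof.
move=> [m [n [c ->]]] [m' [n' [c' ->]]].
have [u [W W']] := persist_common (cyc_persist c) (cyc_persist c').
by rewrite -degdiffD; exact: persist_Per (persistD W W').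
Qed.

Lemma PerN a : Per S (graphT T) a -> Per S (graphT T) (- a).
Proof.
by move=> [m [n [/cyc_sym c ->]]]; exists n, m; rewrite -degdiffC.
Qed.

(** By Dickson's lemma finitely many of the relevant pairs lie below all the others in N^k x N^k.
    Condition (iii) gives a vertex where these finitely many persist, and every pair is a sum of
    them: subtracting one leaves a smaller pair whose difference is still in the group Per. *)
Lemma persist_all : exists v, forall p q,
  Per S (graphT T) (degdiff p q) -> persist p q v.
Proof.
(* Zero is left out so that subtracting a basis element lowers the total degree. *)
pose Q := [set z : Nk k * Nk k | Per S (graphT T) (degdiff z.1 z.2) /\ z <> 0].
pose ev (z : Nk k * Nk k) (i : 'I_k + 'I_k) :=
  match i with inl i => z.1 i | inr i => z.2 i end.
have [F [FQ FB]] := dickson_basis ev Q.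
have [u [Tu hu]] : exists u, T u /\
    forall i, (i < size F)%N -> persist (nth 0 F i).1 (nth 0 F i).2 u.
  have FP : forall i, (i < size F)%N ->
      Per S (graphT T) (degdiff (nth 0 F i).1 (nth 0 F i).2).
    by move=> i /(FQ _ 0)[].
  elim: F FP {FQ FB} => [|z F IH] FP.
    have [v Tl] : T !=set0 by case: Tmax => -[].
    by exists v.
  have [|u [Tu hu]] := IH; first by move=> i /(FP i.+1).
  have [v [Tl Wv]] := Per_persist (FP 0%N isT).
  have [w [Tw [l [rl sl]] [l' [rl' sl']]]] := T3 Tu Tl.
  exists w; split=> // -[_|i /hu]; rewrite /=.
    rewrite -sl'; apply: persist_her; rewrite ?rl' ?sl'//.
  by move=> Wu; rewrite -sl; apply: persist_her; rewrite ?rl ?sl.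
exists u => p q; have [N le] := ubnP (\sum_i p i + \sum_i q i)%N.
elim: N p q le => // N IH p q le Ppq.
have [/= e0|ne0] := pselect ((p, q) = 0).
  by case: e0 => -> ->; exact: persist_diag.
have [i [hi hle]] := FB (p, q) (conj Ppq ne0).
have [Pz nz] := FQ i (p, q) hi; have := hu i hi.
rewrite (set_nth_default (p, q))//.
case: (nth (p, q) F i) Pz nz hle => p' q' /= Pz nz hle Wz.
have le1 : leN p' p by move=> j; by have := hle (inl j).
have le2 : leN q' q by move=> j; by have := hle (inr j).
have e1 := subNK le1; have e2 := subNK le2.
rewrite -e1 -e2; apply: persistD => //; apply: IH.
  have sD (r r' : Nk k) : (\sum_j (r + r')%R j = \sum_j r j + \sum_j r' j)%N.
    by rewrite -big_split; apply: eq_bigr => j _; rewrite addNE.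
  rewrite ltnS in le; apply: leq_trans le; rewrite -{2}e1 -{2}e2 !sD addnACA.
  rewrite -[X in (X < _)%N]add0n ltn_add2r lt0n.
  apply/eqP => /eqP; rewrite addn_eq0 => /andP[/eqP s1 /eqP s2]; apply: nz.
  have z (r : Nk k) : (\sum_i r i = 0)%N -> r = 0.
    move=> /eqP; rewrite sum_nat_eq0 => /forallP h; apply/ffunP => j.
    by rewrite zeroNE; apply/eqP; exact: h.
  by rewrite (z _ s1) (z _ s2).
have -> : degdiff (subN p p') (subN q q') = degdiff p q + - degdiff p' q'.
  rewrite -{2}e1 -{2}e2 degdiffD addrAC subrr add0r//.
by apply: PerD => //; exact: PerN.
Qed.

Lemma HT_nonempty : HT S T !=set0.
Proof.
have [v hv] := persist_all; exists v; split.
  by have [] := hv 0 0; rewrite ?degdiffnn//; exact: Per0.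
move=> p q /hv[_ h] m rm dm Tm; have [n dn cn] := h m rm dm Tm.
have /cycP[_ sn _] := cn; exists n; split.
  by split=> //; rewrite -?sn// -(cyc_r cn).
move=> n' [rn' dn' Tn' cn']; apply: cyc_eq; last by rewrite dn dn'.
exact: cyc_trans (cyc_sym cn) cn'.
Qed.

(** The condition at the range of [l] is applied to degrees raised by d(l), which have the same
    difference; [cyc_cancel] then removes [l]. *)
Lemma HT_her l : HT S T (kr l) -> T (ks l) -> HT S T (ks l).
Proof.
move=> [Tl h] Tsl; split=> // p q P m rm dm Tm.
have hc : ks l = kr m by [].
have [|||| n [[rn dn Tn cn] _]] := h (kd l + p) (kd l + q) _ (kcomp l m).
- by rewrite addrC [_ + q]addrC degdiffDr.
- by rewrite kr_comp.
- by rewrite kd_comp// dm.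
- by rewrite ks_comp.
have [n' dn' [cn' _]] := cyc_cancel hc cn dn.
have /cycP[_ sn' _] := cn'; exists n'; split.
  by split=> //; rewrite -?sn'// -(cyc_r cn').
move=> n2 [_ dn2 _ cn2]; apply: cyc_eq; last by rewrite dn' dn2.
exact: cyc_trans (cyc_sym cn') cn2.
Qed.

(** Any [w] in [T] has a common descendant [u] with [v], and [u] is in H_T by heredity. Strong
    connectivity leads from [u] back to [v], so [w] is connected to [v], a vertex of [T']. *)
Lemma HT_sub_tail v (T' : set L) : strongly_connected (graphHT S T) ->
  maximal_tail T' -> HT S T v -> T' v -> T `<=` T'.
Proof.
move=> sc [_ h1 _ _] Hv T'v w Tw; have [Tl _] := Hv.
have [u [Tu [l [rl sl]] [l' [rl' sl']]]] := T3 Tw Tl.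
have Hu : HT S T u by rewrite -sl'; apply: HT_her; rewrite ?rl' ?sl'.
have uv := Tv Tu; have vv := Tv Tl.
have [a [_ ra sa]] : exists a, [/\ graphHT S T a, kr a = u & ks a = v].
  by apply: sc => //; split; rewrite ?vertex_rE ?vertex_sE.
have hc : ks l = kr a by rewrite sl ra.
apply: (h1 v) => //; first exact: Tv.
by exists (kcomp l a); rewrite kr_comp// ks_comp// sa.
Qed.

End Periodicity.

(** * Hilbert spaces *)

Section ComplexNorm.
Context {R : realType}.
Implicit Types c d : R[i].

(** The norms of [R[i]] and of its modules take values in [R[i]]; [cn] and [hn] are real-valued
    versions, so that estimates are made in the ordered field [R]. *)
Definition cn c : R := complex.Re `|c|.

Lemma cnE c : `|c| = (cn c)%:C.
Proof. by rewrite /cn normc_def. Qed.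
Lemma cn_ge0 c : 0 <= cn c.
Proof. by rewrite -ler0c -cnE. Qed.
Lemma cnM c d : cn (c * d) = cn c * cn d.
Proof. by apply: complexI; rewrite rmorphM/= -!cnE normrM. Qed.
Lemma cnD c d : cn (c + d) <= cn c + cn d.
Proof. by rewrite -lecR rmorphD/= -!cnE ler_normD. Qed.
Lemma cnN c : cn (- c) = cn c.
Proof. by apply: complexI; rewrite -!cnE normrN. Qed.
Lemma cn0 : cn 0 = 0.
Proof. by apply: complexI; rewrite -!cnE normr0. Qed.
Lemma cn1 : cn 1 = 1.
Proof. by apply: complexI; rewrite -!cnE normr1. Qed.
Lemma cn_eq0 c : cn c = 0 -> c = 0.
Proof. by move=> h; apply/eqP; rewrite -normr_eq0 cnE h. Qed.
Lemma cn_le0 c : (forall e : R, 0 < e -> cn c <= e) -> c = 0.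
Proof.
move=> h; apply: cn_eq0; apply/eqP; rewrite eq_le cn_ge0 andbT.
by apply/ler_addgt0Pr => e e0; rewrite add0r; exact: h.
Qed.
Lemma gt0_real c : 0 < c -> c = (complex.Re c)%:C.
Proof. by rewrite ltcE /= => /andP[/eqP]; case: c => a b /= ->. Qed.
Lemma cn_real (r : R) : cn r%:C = `|r|.
Proof. by rewrite /cn normc_def /= expr0n addr0 sqrtr_sqr. Qed.
Lemma cn_conj c : cn (c^*)%C = cn c.
Proof. by case: c => a b; rewrite /cn !normc_def /= sqrrN. Qed.
Lemma mulcJ c : c * (c^*)%C = (cn c ^+ 2)%:C.
Proof.
case: c => a b; rewrite rmorphXn/= -cnE -add_Re2_Im2 /=; simpc.
by congr (_ +i* _); ring.
Qed.
Lemma conjcMr c (r : R) : ((c * r%:C)^*)%C = (c^*)%C * r%:C.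
Proof. by case: c => a b; simpc; congr (_ +i* _); ring. Qed.
Lemma cn_Re c : complex.Re c <= cn c.
Proof.
case: c => a b; rewrite /cn normc_def /=; apply: le_trans (ler_norm a) _.
by rewrite -sqrtr_sqr ler_wsqrtr// lerDl sqr_ge0.
Qed.
Lemma cn_sum (I : Type) (s : seq I) (P : pred I) (F : I -> R[i]) :
  cn (\sum_(i <- s | P i) F i) <= \sum_(i <- s | P i) cn (F i).
Proof.
elim/big_rec2: _ => [|i y1 y2 _ h]; first by rewrite cn0.
by apply: le_trans (cnD _ _) _; rewrite lerD2l.
Qed.
Lemma unimodular_conj c : cn c = 1 -> c * (c^*)%C = 1.
Proof. by move=> h; rewrite mulcJ h expr1n. Qed.

End ComplexNorm.

Section Hilbert.
Context {R : realType} {H : hilbertType R}.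
Implicit Types (x y z : H) (c d : R[i]).

Definition hn x : R := complex.Re `|x|.

Lemma hnE x : `|x| = (hn x)%:C.
Proof.
have := normr_ge0 x; rewrite /hn lecE; case: `|x| => a b /= /andP[/eqP ->] _.
by [].
Qed.
Lemma hn_ge0 x : 0 <= hn x.
Proof. by rewrite -ler0c -hnE. Qed.
Lemma hn_eq0 x : hn x = 0 -> x = 0.
Proof. by move=> h; apply/eqP; rewrite -normr_eq0 hnE h. Qed.
Lemma hn0 : hn 0 = 0.
Proof. by apply: complexI; rewrite -hnE normr0. Qed.
Lemma hnD x y : hn (x + y) <= hn x + hn y.
Proof. by rewrite -lecR rmorphD/= -!hnE ler_normD. Qed.
Lemma hnZ c x : hn (c *: x) = cn c * hn x.
Proof. by apply: complexI; rewrite rmorphM/= -!hnE -cnE normrZ. Qed.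
Lemma hnN x : hn (- x) = hn x.
Proof. by apply: complexI; rewrite -!hnE normrN. Qed.
Lemma hn_sub x y : hn (x - y) = hn (y - x).
Proof. by rewrite -hnN opprB. Qed.
Lemma hn_tri z x y : hn (x - y) <= hn (x - z) + hn (z - y).
Proof. by apply: le_trans (hnD _ _); rewrite addrA subrK. Qed.

Lemma hn_le0 x : (forall e : R, 0 < e -> hn x <= e) -> x = 0.
Proof.
move=> h; apply: hn_eq0; apply/eqP; rewrite eq_le hn_ge0 andbT.
by apply/ler_addgt0Pr => e e0; rewrite add0r; exact: h.
Qed.

Lemma innerZr c x y : inner x (c *: y) = (c^*)%C * inner x y.
Proof. by rewrite innerC innerZl rmorphM/= -innerC. Qed.
Lemma innerDr x y z : inner x (y + z) = inner x y + inner x z.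
Proof. by rewrite innerC innerDl rmorphD/= -!innerC. Qed.
Lemma inner0l y : inner 0 y = 0 :> R[i].
Proof. by rewrite -[0](scale0r 0) innerZl mul0r. Qed.
Lemma inner0r y : inner y 0 = 0 :> R[i].
Proof. by rewrite innerC inner0l rmorph0. Qed.
Lemma innerNl x y : inner (- x) y = - inner x y :> R[i].
Proof. by rewrite -scaleN1r innerZl mulN1r. Qed.
Lemma innerNr x y : inner x (- y) = - inner x y :> R[i].
Proof. by rewrite innerC innerNl rmorphN/= -innerC. Qed.
Lemma innerBl x y z : inner (x - y) z = inner x z - inner y z.
Proof. by rewrite innerDl innerNl. Qed.
Lemma innerBr x y z : inner x (y - z) = inner x y - inner x z.
Proof. by rewrite innerDr innerNr. Qed.
Lemma inner_hn x : inner x x = (hn x ^+ 2)%:C.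
Proof. by rewrite innerxx hnE rmorphXn. Qed.
Lemma inner_suml (I : Type) (s : seq I) (P : pred I) (F : I -> H) y :
  inner (\sum_(i <- s | P i) F i) y = \sum_(i <- s | P i) inner (F i) y.
Proof.
by elim/big_rec2: _ => [|i y1 y2 _ <-]; rewrite ?inner0l ?innerDl.
Qed.
Lemma inner_sumr (I : Type) (s : seq I) (P : pred I) (F : I -> H) y :
  inner y (\sum_(i <- s | P i) F i) = \sum_(i <- s | P i) inner y (F i).
Proof.
by elim/big_rec2: _ => [|i y1 y2 _ <-]; rewrite ?inner0r ?innerDr.
Qed.

Lemma inner_ext x y : (forall z, inner x z = inner y z) -> x = y.
Proof.
move=> h; apply/eqP; rewrite -subr_eq0; apply/eqP/hn_eq0.
have : inner (x - y) (x - y) = 0 :> R[i] by rewrite innerBl h subrr.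
by rewrite inner_hn => /(complexI) /eqP; rewrite sqrf_eq0 => /eqP.
Qed.

Lemma hn_expand x y c :
  hn (x - c *: y) ^+ 2 =
    hn x ^+ 2 - 2 * complex.Re ((c^*)%C * inner x y) + cn c ^+ 2 * hn y ^+ 2.
Proof.
apply: complexI; rewrite -inner_hn innerBl !innerBr !innerZl !innerZr !inner_hn.
rewrite [inner y x]innerC; set a := inner x y.
rewrite mulrA mulcJ rmorphD rmorphB !rmorphM/=.
have -> : (2%:C : R[i]) = 2 by rewrite rmorph_nat.
rewrite -addcJ rmorphM/= conjcK; ring.
Qed.

Lemma cauchy_schwarz x y : cn (inner x y) <= hn x * hn y.
Proof.
have [y0|y0] := eqVneq (hn y) 0.
  by rewrite y0 (hn_eq0 y0) inner0r cn0 mulr0.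
have yp : 0 < hn y by rewrite lt_def y0 hn_ge0.
set a := inner x y; pose Y := hn y ^+ 2.
have Yp : 0 < Y by exact: exprn_gt0.
(* With this coefficient the multiple of [y] is the orthogonal projection of [x] onto the line of
   [y]. *)
have := hn_expand x y (a * (Y^-1)%:C); rewrite -/a.
have -> : ((a * Y^-1%:C)^*)%C * a = (cn a ^+ 2 / Y)%:C.
  by rewrite conjcMr mulrAC [_ * a]mulrC mulcJ -rmorphM.
rewrite /= cnM cn_real ger0_norm ?invr_ge0 ?(ltW Yp)// -/Y => e.
have : 0 <= hn x ^+ 2 - cn a ^+ 2 / Y.
  suff <- : hn (x - (a * (Y^-1)%:C) *: y) ^+ 2 = hn x ^+ 2 - cn a ^+ 2 / Y.
    exact: sqr_ge0.
  by rewrite e; field; rewrite gt_eqF.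
rewrite subr_ge0 ler_pdivrMr// -exprMn ler_pXn2r// nnegrE ?cn_ge0//.
by rewrite mulr_ge0// hn_ge0.
Qed.

(* Adjointness of two operators given as pointwise limits. *)
Lemma inner_limit (f g : H) x y :
  (forall e : R, 0 < e -> exists f' g', [/\ inner f' y = inner x g' :> R[i],
     hn (f' - f) <= e & hn (g' - g) <= e]) -> inner f y = inner x g :> R[i].
Proof.
move=> h; apply/eqP; rewrite -subr_eq0; apply/eqP/cn_le0 => e e0.
have x0 := hn_ge0 x; have y0 := hn_ge0 y.
pose D := hn x + hn y + 1; have Dp : 0 < D by rewrite /D; lra.
have [f' [g' [e1 hf hg]]] := h _ (divr_gt0 e0 Dp).
have -> : inner f y - inner x g = inner x (g' - g) - inner (f' - f) y.
  by rewrite innerBl innerBr e1; ring.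
apply: le_trans (cnD _ _) _; rewrite cnN.
apply: le_trans (lerD (cauchy_schwarz _ _) (cauchy_schwarz _ _)) _.
apply: (@le_trans _ _ (hn x * (e / D) + e / D * hn y)).
  by rewrite lerD// ?ler_wpM2l ?ler_wpM2r ?hn_ge0.
have -> : hn x * (e / D) + e / D * hn y = e * ((hn x + hn y) / D).
  by rewrite /D; field; rewrite gt_eqF.
rewrite -[leRHS]mulr1 ler_pM2l// ler_pdivrMr// mul1r /D; lra.
Qed.

Lemma pythagoras x y : inner x y = 0 :> R[i] ->
  hn (x + y) ^+ 2 = hn x ^+ 2 + hn y ^+ 2.
Proof.
move=> h; have := hn_expand x y (-1); rewrite scaleN1r opprK h mulr0 /= => ->.
by rewrite cnN cn1 expr1n mul1r mulr0 subr0.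
Qed.

Lemma nbhs_hnP x (P : set H) :
  nbhs x P <-> exists2 e : R, 0 < e & forall y, hn (x - y) < e -> P y.
Proof.
split=> [/nbhs_normP[e /= e0 h]|[e e0 h]].
  have eE := gt0_real e0.
  exists (complex.Re e) => [|y hy]; first by rewrite -ltcR -eE.
  by apply: h; rewrite /ball_/= eE hnE ltcR.
apply/nbhs_normP; exists e%:C; first by rewrite /= ltcR.
by move=> y /=; rewrite hnE ltcR; exact: h.
Qed.

Lemma closure_hnP (V : set H) x :
  closure V x <-> forall e : R, 0 < e -> exists2 y, V y & hn (x - y) < e.
Proof.
split=> [h e e0|h B /nbhs_hnP[e e0 hB]].
  have [|y [Vy hy]] := h [set y | hn (x - y) < e]; last by exists y.
  by apply/nbhs_hnP; exists e.
by have [y Vy hy] := h e e0; exists y; split => //; exact: hB.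
Qed.

Lemma closed_hnP (V : set H) : closed V <->
  forall x, (forall e : R, 0 < e -> exists2 y, V y & hn (x - y) < e) -> V x.
Proof.
split=> h x; first by move=> /closure_hnP; exact: h.
by move=> /closure_hnP; exact: h.
Qed.

Lemma hilbert_complete (v : nat -> H) :
  (forall e : R, 0 < e -> exists N : nat,
     forall i j, (N <= i)%N -> (N <= j)%N -> hn (v i - v j) < e) ->
  exists x, forall e : R, 0 < e -> exists N : nat,
     forall i, (N <= i)%N -> hn (v i - x) < e.
Proof.
move=> hc; have cv : cvg (v @ \oo).
  apply: cauchy_cvg; apply: cauchy_exP => e e0.
  have eE := gt0_real e0.
  have [|N hN] := hc (complex.Re e); first by rewrite -ltcR -eE.
  exists (v N); exists N => // n /= Nn.
  by rewrite -ball_normE /= eE hnE ltcR; exact: hN.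
exists (lim (v @ \oo)) => e e0.
have /cvgrPdist_lt /(_ e%:C) := cv; rewrite ltcR => /(_ e0)[N _ hN].
by exists N => i /hN /=; rewrite hnE ltcR hn_sub.
Qed.

Lemma lin_bounded (f : H -> H) : linear f -> continuous f ->
  exists2 C : R, 0 < C & forall x, hn (f x) <= C * hn x.
Proof.
move=> lf cf; pose F : {linear H -> H} := HB.pack f (GRing.isLinear.Build _ _ _ _ f lf).
have /linear_boundedP/pinfty_ex_gt0[M M0 hM] : bounded_near F (nbhs (0 : H)).
  exact/linear_bounded_continuous.
exists (complex.Re M) => [|x]; first by rewrite -ltcR -gt0_real.
by rewrite -lecR rmorphM/= -(gt0_real M0) -!hnE; exact: hM.
Qed.

Lemma bounded_continuous (f : H -> H) (C : R) : linear f ->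
  (forall x, hn (f x) <= C * hn x) -> continuous f.
Proof.
move=> lf hC; pose F : {linear H -> H} := HB.pack f (GRing.isLinear.Build _ _ _ _ f lf).
apply: (@bounded_linear_continuous _ _ _ F); apply/linear_boundedP.
exists C%:C; split=> [|M /ltW CM x]; first by apply/complex_realP; exists C.
by apply: le_trans (ler_wpM2r _ CM); rewrite ?normr_ge0// !hnE -rmorphM lecR.
Qed.

End Hilbert.

(** * C*-algebras *)

Section Cstar.
Context {R : realType} {A : cstarAlgType R}.
Implicit Types (a b p h : A) (c : R[i]).
Local Notation nm := (@cnorm R A).

Lemma nmZ c a : nm (c *: a) = cn c * nm a.
Proof. by apply: complexI; rewrite cnormZ cnE -rmorphM. Qed.
Lemma nm0 : nm 0 = 0.
Proof. by rewrite -(scale0r 0) nmZ cn0 mul0r. Qed.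
Lemma nmN a : nm (- a) = nm a.
Proof. by rewrite -scaleN1r nmZ cnN cn1 mul1r. Qed.
Lemma nm_ge0 a : 0 <= nm a.
Proof.
have := cnormD a (- a); rewrite subrr nm0 nmN -mulr2n -mulr_natl.
by rewrite pmulr_rge0// ltr0n.
Qed.
Lemma nm_sub a b : nm (a - b) = nm (b - a).
Proof. by rewrite -nmN opprB. Qed.
Lemma nm_tri b a d : nm (a - d) <= nm (a - b) + nm (b - d).
Proof. by apply: le_trans (cnormD _ _); rewrite addrA subrK. Qed.
Lemma nm_sum (I : Type) (s : seq I) (P : pred I) (F : I -> A) :
  nm (\sum_(i <- s | P i) F i) <= \sum_(i <- s | P i) nm (F i).
Proof.
elim/big_rec2: _ => [|i y1 y2 _ h]; first by rewrite nm0.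
by apply: le_trans (cnormD _ _) _; rewrite lerD2l.
Qed.
Lemma nm_star a : nm (star a) = nm a.
Proof.
have key b : nm b <= nm (star b).
  have [b0|b0] := eqVneq (nm b) 0; first by rewrite b0 nm_ge0.
  have bp : 0 < nm b by rewrite lt_def b0 nm_ge0.
  by have := cnormM (star b) b; rewrite cnorm_star expr2 ler_pM2r.
by apply/eqP; rewrite eq_le -{2}[a]starK !key.
Qed.
Lemma nm_le0 a : (forall e : R, 0 < e -> nm a <= e) -> a = 0.
Proof.
move=> h; apply: cnorm_eq0; apply/eqP; rewrite eq_le nm_ge0 andbT.
by apply/ler_addgt0Pr => e e0; rewrite add0r; exact: h.
Qed.

Lemma star0 : star 0 = 0 :> A.
Proof. by rewrite -(scale0r 0) starZ conjc0 !scale0r. Qed.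
Lemma star1 : star 1 = 1 :> A.
Proof. by have := @starM R A 1 (star 1); rewrite mul1r starK mul1r => <-. Qed.
Lemma starN a : star (- a) = - star a.
Proof. by rewrite -scaleN1r starZ rmorphN rmorph1 scaleN1r. Qed.
Lemma star_sum (I : Type) (s : seq I) (P : pred I) (F : I -> A) :
  star (\sum_(i <- s | P i) F i) = \sum_(i <- s | P i) star (F i).
Proof. by elim/big_rec2: _ => [|i y1 y2 _ <-]; rewrite ?star0 ?starD. Qed.

Definition is_proj p := star p = p /\ p * p = p.

Lemma proj_nm p : is_proj p -> nm p <= 1.
Proof.
move=> [sp pp]; have := cnorm_star p; rewrite sp pp => e.
have := nm_ge0 p; set x := nm p in e *; nra.
Qed.
Lemma is_projC p : is_proj p -> is_proj (1 - p).
Proof.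
move=> [sp pp]; split; first by rewrite starD starN star1 sp.
by rewrite mulrBl mul1r mulrBr mulr1 pp subrr subr0.
Qed.
Lemma pisom_nm a : is_proj (star a * a) -> nm a <= 1.
Proof.
move=> /proj_nm; rewrite cnorm_star; have := nm_ge0 a; set x := nm a; nra.
Qed.

Lemma sum_binS (f : nat -> R) n : \sum_(i < n.+2) 'C(n.+1, i)%:R * f i =
  \sum_(i < n.+1) 'C(n, i)%:R * (f i + f i.+1).
Proof.
rewrite big_ord_recl bin0 mul1r /=.
under eq_bigr do rewrite /bump add1n binS natrD mulrDl.
under [RHS]eq_bigr do rewrite mulrDr.
rewrite !big_split/= addrA; congr (_ + _).
by rewrite big_ord_recr [RHS]big_ord_recl /= bin_small// bin0 mul0r addr0 mul1r.
Qed.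

Lemma sum_bin n : \sum_(i < n.+1) 'C(n, i)%:R = 2 ^+ n :> R.
Proof.
elim: n => [|n IH]; first by rewrite big_ord1.
have := sum_binS (fun=> 1) n; under eq_bigr do rewrite mulr1.
by move=> ->; rewrite -mulr_suml IH exprSr.
Qed.

(** 2^n times the variance n of the symmetric random walk of n steps, whose position n - 2 i has
    weight C(n, i). *)
Lemma sum_bin_sqr n :
  \sum_(i < n.+1) 'C(n, i)%:R * (n%:R - 2 * i%:R) ^+ 2 = n%:R * 2 ^+ n :> R.
Proof.
elim: n => [|n IH]; first by rewrite big_ord1 /= !mulr0 subr0 expr0n mulr0 mul0r.
rewrite (sum_binS (fun i => (n.+1%:R - 2 * i%:R) ^+ 2)).
transitivity (\sum_(i < n.+1) (2 * ('C(n, i)%:R * (n%:R - 2 * i%:R) ^+ 2) + 2 * 'C(n, i)%:R) : R).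
  by apply: eq_bigr => i _; rewrite -(natr1 n) -(natr1 i); ring.
by rewrite big_split/= -!mulr_sumr IH sum_bin exprS -natr1; ring.
Qed.

(* Expanding h = (a - b) / 2 * ((a + b) / 2) ^ n for the contractions a = p + h
   and b = p - h, the norm of h is at most the mean absolute deviation of a
   symmetric random walk divided by its length. *)
Lemma proj_extreme p h : p * p = p -> p * h = h -> h * p = h ->
  nm (p + h) <= 1 -> nm (p - h) <= 1 -> h = 0.
Proof.
move=> pp ph hp; set a := p + h; set b := p - h => na nb.
have ab : GRing.comm a b.
  rewrite /GRing.comm /a /b !(mulrDl, mulrDr, mulrN, mulNr) pp ph hp.
  by rewrite !addrA addrNK addrK.
have nX d n : nm d <= 1 -> nm (d ^+ n) <= 1.
  move=> d1; elim: n => [|n IH].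
    by rewrite expr0; apply: proj_nm; split; rewrite ?star1 ?mul1r.
  by rewrite exprS; apply: le_trans (cnormM _ _) _; rewrite mulr_ile1 ?nm_ge0.
(* With a + b = 2 p, both a (a + b)^n and (a + b)^n b are known; their binomial expansions differ by
   terms with coefficient C(n + 1, i) (n + 1 - 2 i). *)
have E n : h *+ (2 ^ n.+1 * n.+1) = \sum_(i < n.+2) (a ^+ (n.+1 - i) * b ^+ i) *+
    ('C(n.+1, i) * (n.+1 - i)) - \sum_(i < n.+2) (a ^+ (n.+1 - i) * b ^+ i) *+ ('C(n.+1, i) * i).
  have e2 : a + b = p *+ 2 by rewrite /a /b addrACA subrr addr0.
  have ea : a * (a + b) ^+ n = a *+ 2 ^ n.
    elim: n => [|n IH]; first by rewrite expr0 mulr1.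
    by rewrite exprSr mulrA IH e2 mulrnAr mulrnAl mulrDl pp hp -mulrnA expnSr.
  have eb : (a + b) ^+ n * b = b *+ 2 ^ n.
    elim: n {ea} => [|n IH]; first by rewrite expr0 mul1r.
    by rewrite exprS -mulrA IH e2 mulrnAr mulrnAl mulrBr pp ph -mulrnA expnS.
  transitivity ((a * (a + b) ^+ n) *+ n.+1 - ((a + b) ^+ n * b) *+ n.+1).
    rewrite ea eb -mulrnBl -mulrnBl mulrnA expnS mulrnA /a /b opprD opprK addrACA.
    by rewrite subrr add0r.
  rewrite exprDn_comm// mulr_sumr mulr_suml -!sumrMnl; congr (_ - _).
    rewrite [RHS]big_ord_recr /= subnn muln0 mulr0n addr0; apply: eq_bigr => i _.
    rewrite mulrnAr mulrA -exprS -subSn; last by rewrite -ltnS.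
    by rewrite -mulrnA mulnC mul_bin_down mulnC.
  rewrite [RHS]big_ord_recl /= muln0 mulr0n add0r; apply: eq_bigr => i _.
  rewrite mulrnAl -mulrA -exprSr /bump leq0n add1n subSS -mulrnA mulnC.
  by rewrite [in RHS]mulnC (mul_bin_diag n.+1 i).
have bound n : n.+1%:R * 2 ^+ n.+1 * nm h <=
    \sum_(i < n.+2) 'C(n.+1, i)%:R * `|n.+1%:R - 2 * i%:R|.
  have -> : n.+1%:R * 2 ^+ n.+1 * nm h = nm (h *+ (2 ^ n.+1 * n.+1)).
    rewrite -(@scaler_nat R[i] _ _ h) nmZ -(rmorph_nat (real_complex R)) cn_real normr_nat.
    by rewrite mulnC natrM natrX.
  rewrite E -sumrB; apply: le_trans (nm_sum _ _ _) _; apply: ler_sum => i _.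
  rewrite -!(@scaler_nat R[i] _ _ (_ * b ^+ i)) -scalerBl nmZ -!(rmorph_nat (real_complex R)) -rmorphB.
  rewrite cn_real !natrM -mulrBr normrM normr_nat natrB; last by rewrite -ltnS.
  rewrite -addrA -opprD -mulr2n [2 * _]mulr_natl -[leRHS]mulr1 ler_wpM2l ?mulr_ge0//.
  by apply: le_trans (cnormM _ _) _; rewrite mulr_ile1 ?nm_ge0 ?nX.
apply: cnorm_eq0; apply/eqP; set x := nm h in bound *.
rewrite eq_le nm_ge0 andbT leNgt; apply/negP => x0.
have hN n : n.+1%:R * x ^+ 2 <= 1.
  have P0 : 0 < 2 ^+ n.+1 :> R by rewrite exprn_gt0.
  (* The inequality 2 x w <= x^2 w^2 + 1 bounds the first absolute moment by the second without a
     square root. *)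
  have h1 : x * (n.+1%:R * 2 ^+ n.+1 * x) <= (x ^+ 2 * (n.+1%:R * 2 ^+ n.+1) + 2 ^+ n.+1) / 2.
    apply: le_trans (ler_wpM2l (ltW x0) (bound n)) _.
    rewrite -(sum_bin_sqr n.+1) -[X in (_ + X) / _](sum_bin n.+1) !mulr_sumr -big_split/=.
    rewrite mulr_suml; apply: ler_sum => i _; rewrite mulrCA.
    set t := _ - _; rewrite -[t ^+ 2]real_normK ?num_real//; set w := `|t|; set y := _%:R.
    have y0 : 0 <= y :> R by [].
    have : 0 <= y * (x * w - 1) ^+ 2 by rewrite mulr_ge0// sqr_ge0.
    lra.
  by rewrite -(ler_pM2r P0); lra.
have [n hn] : exists n : nat, (x ^+ 2)^-1 < n.+1%:R.
  by exists (Num.truncn (x ^+ 2)^-1); rewrite truncnS_gt.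
have := hN n; rewrite leNgt => /negP; apply.
by rewrite -ltr_pdivrMr ?exprn_gt0// div1r.
Qed.

(* The compressions P i P l P i sum to P i, so that a small multiple h of
   P i P j P i satisfies nm (P i + h) <= 1 and nm (P i - h) <= 1. *)
Lemma proj_orth (I : eqType) (s : seq I) (P : I -> A) (e : A) :
  uniq s -> (forall i, i \in s -> is_proj (P i) /\ e * P i = P i) ->
  e = \sum_(i <- s) P i ->
  forall i j, i \in s -> j \in s -> i != j -> P i * P j = 0.
Proof.
move=> us hP es i j si sj ij.
have [pri epi] := hP i si; have [prj _] := hP j sj.
have [spi ppi] := pri; have [spj ppj] := prj.
pose K l := P i * P l * P i.
have sumK : \sum_(l <- s) K l = P i.
  by rewrite /K -mulr_suml -mulr_sumr -es -mulrA epi.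
have eK l : P i - K l = P i * (1 - P l) * P i.
  by rewrite mulrBr mulr1 mulrBl ppi.
have nK l : l \in s -> nm (P i - K l) <= 1.
  move=> sl; rewrite eK; have [prl _] := hP l sl.
  have np := proj_nm pri; have nc := proj_nm (is_projC prl).
  apply: le_trans (cnormM _ _) _; rewrite mulr_ile1 ?nm_ge0//.
  by apply: le_trans (cnormM _ _) _; rewrite mulr_ile1 ?nm_ge0.
pose s' := rem j (rem i s).
have us1 : uniq (rem i s) by rewrite rem_uniq.
have perm1 : perm_eq s (i :: j :: s').
  apply: perm_trans (perm_to_rem si) _; rewrite perm_cons.
  by apply: perm_to_rem; rewrite mem_rem_uniq// inE eq_sym ij.
have Kh : \sum_(l <- s') K l = - K j.
  move: sumK; rewrite (perm_big _ perm1)/= !big_cons /K ppi ppi => /eqP.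
  rewrite -subr_eq0 addrAC subrr add0r addrC addr_eq0 => /eqP.
  by [].
pose h := K j; pose n := size s'.
have hn1 : nm (n.+1%:R *: P i + h) <= n.+1%:R.
  (* The compressions over [s'] sum to [- h], so this exhibits a sum of n + 1 contractions. *)
  have -> : n.+1%:R *: P i + h = P i + \sum_(l <- s') (P i - K l).
    rewrite big_split/= sumrN Kh opprK addrA; congr (_ + _).
    by rewrite big_const_seq count_predT iter_addr_0 -/n scaler_nat mulrS.
  apply: le_trans (cnormD _ _) _.
  rewrite -addn1 natrD addrC lerD//; last exact: proj_nm.
  apply: le_trans (nm_sum _ _ _) _.
  have -> : n%:R = \sum_(l <- s') (1 : R).
    by rewrite big_const_seq count_predT iter_addr_0.
  rewrite big_seq [leRHS]big_seq; apply: ler_sum => l /mem_rem /mem_rem.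
  exact: nK.
pose t : R := n.+1%:R^-1.
have t0 : 0 <= t by rewrite invr_ge0.
have t1 : t <= 1 by rewrite invf_le1// ler1n.
have nt : n.+1%:R * t = 1 by rewrite mulfV// pnatr_eq0.
have th : t%:C *: h = 0.
  have ph : P i * h = h by rewrite /h /K !mulrA ppi.
  have hp : h * P i = h by rewrite /h /K -!mulrA ppi.
  apply: (proj_extreme ppi).
  - by rewrite -scalerAr ph.
  - by rewrite -scalerAl hp.
  - have -> : P i + t%:C *: h = t%:C *: (n.+1%:R *: P i + h).
      rewrite scalerDr scalerA -[n.+1%:R](rmorph_nat (real_complex R)) -rmorphM mulrC nt.
      by rewrite rmorph1 scale1r.
    by rewrite nmZ cn_real ger0_norm// -nt mulrC ler_wpM2r.
  - have -> : P i - t%:C *: h = (1 - t)%:C *: P i + t%:C *: (P i - K j).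
      rewrite rmorphB rmorph1 scalerBl scale1r scalerBr addrA subrK//.
    apply: le_trans (cnormD _ _) _; rewrite !nmZ !cn_real !ger0_norm ?subr_ge0//.
    have h1 := proj_nm pri; have h2 := nK j sj.
    apply: (@le_trans _ _ ((1 - t) * 1 + t * 1)); last lra.
    by rewrite lerD// ler_wpM2l// subr_ge0.
have h0 : h = 0.
  by rewrite -[h]scale1r -(rmorph1 (real_complex R)) -nt rmorphM -scalerA th scaler0.
have : P j * P i = 0.
  apply: cnorm_eq0; apply/eqP; rewrite -sqrf_eq0 -cnorm_star starM spi spj.
  by rewrite mulrA -[P i * P j * P j]mulrA ppj -/(K j) -/h h0 nm0.
by move=> e0; rewrite -[P i]spi -[P j]spj -starM e0 star0.
Qed.

Lemma expr_lt_eps (q e : R) : 0 <= q -> q < 1 -> 0 < e ->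
  exists N : nat, forall n, (N <= n)%N -> q ^+ n < e.
Proof.
move=> q0 q1 e0; have /cvg_expr : `|q| < 1 by rewrite ger0_norm.
move=> /cvgrPdist_lt /(_ e e0)[N _ hN]; exists N => n /hN /=.
by rewrite sub0r normrN ger0_norm// exprn_ge0.
Qed.

Lemma nm_exp a n : nm (a ^+ n.+1) <= nm a ^+ n.+1.
Proof.
elim: n => [|n IH]; first by rewrite !expr1.
rewrite exprS [leRHS]exprS; apply: le_trans (cnormM _ _) _.
by rewrite ler_wpM2l// nm_ge0.
Qed.

Lemma neumann a : nm a < 1 -> exists r, r * (1 - a) = 1.
Proof.
move=> a1; have a0 := nm_ge0 a; set q := nm a in a0 a1.
have nX n : nm (a ^+ n.+1) <= q ^+ n.+1 by exact: nm_exp.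
pose S n := \sum_(i < n) a ^+ i.
have dS n m : nm (S (n.+1 + m)%N - S n.+1) <= q ^+ n.+1 / (1 - q).
  have -> : S (n.+1 + m)%N - S n.+1 = \sum_(i < m) a ^+ (n.+1 + i).
    rewrite /S -!(big_mkord xpredT (fun i => a ^+ i)).
    rewrite (big_cat_nat (n := n.+1))//= ?leq_addr//.
    rewrite addrAC subrr add0r -{1}[n.+1]add0n big_addn addKn.
    by rewrite big_mkord; apply: eq_bigr => i _; rewrite addnC.
  apply: le_trans (nm_sum _ _ _) _.
  apply: (@le_trans _ _ (\sum_(i < m) q ^+ n.+1 * q ^+ i)).
    by apply: ler_sum => i _; rewrite -exprD addSn; exact: nX.
  rewrite -mulr_sumr ler_wpM2l ?exprn_ge0// -(@ler_pM2l _ (1 - q)) ?subr_gt0//.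
  rewrite mulfV; last by rewrite subr_eq0 gt_eqF.
  have -> : (1 - q) * \sum_(i < m) q ^+ i = 1 - q ^+ m.
    by rewrite -opprB mulNr -subrX1 opprB.
  by rewrite gerBl exprn_ge0.
have tail e : 0 < e -> exists N : nat, forall n, (N <= n)%N -> q ^+ n / (1 - q) < e.
  move=> e0; have [|N hN] := @expr_lt_eps q (e * (1 - q)) a0 a1.
    by rewrite mulr_gt0// subr_gt0.
  by exists N => n /hN h; rewrite ltr_pdivrMr// subr_gt0.
have [|r hr] := @cnorm_complete R A (fun n => S n.+1).
  move=> e e0; have [N hN] := tail (e / 2) (divr_gt0 e0 (ltr0Sn R 1)).
  exists N => i j Ni Nj; apply: le_lt_trans (nm_tri (S N.+1) _ _) _.
  have b m : (N <= m)%N -> nm (S m.+1 - S N.+1) < e / 2.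
    move=> Nm; have -> : m.+1 = (N.+1 + (m - N))%N by rewrite addSn subnKC.
    by apply: le_lt_trans (dS _ _) _; exact: hN.
  by rewrite [e]splitr ltrD ?b// nm_sub b.
exists r; apply/eqP; rewrite -subr_eq0; apply/eqP; apply: nm_le0 => e e0.
have SE n : S n.+1 * (1 - a) = 1 - a ^+ n.+1.
  rewrite mulrBr mulr1 /S mulr_suml.
  rewrite big_ord_recl expr0 [X in _ - X]big_ord_recr/= opprD addrA.
  rewrite -exprSr; congr (_ - _).
  under eq_bigr do rewrite /bump leq0n exprSr.
  by rewrite addrK.
have C0 : 0 < nm (1 - a) + 1 by rewrite ltr_wpDl// nm_ge0.
have [N1 hN1] := hr _ (divr_gt0 (divr_gt0 e0 (ltr0Sn R 1)) C0).
have [N2 hN2] := expr_lt_eps a0 a1 (divr_gt0 e0 (ltr0Sn R 1)).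
pose n := maxn N1 N2.
have -> : r * (1 - a) - 1 = - ((S n.+1 - r) * (1 - a)) - a ^+ n.+1.
  by rewrite mulrBl SE opprB -[RHS]addrA -opprD subrK.
apply: ltW; apply: le_lt_trans (cnormD _ _) _; rewrite !nmN [e]splitr ltrD//.
  apply: le_lt_trans (cnormM _ _) _.
  have := hN1 n (leq_maxl _ _); rewrite ltr_pdivlMr//; apply: le_lt_trans.
  by rewrite ler_wpM2l ?nm_ge0// lerDl.
apply: le_lt_trans (nX _) _; apply: hN2.
by apply: leq_trans (leq_maxr N1 N2) _.
Qed.

End Cstar.

(** * Bounded operators with adjoint *)

Section Operators.
Context {R : realType} {H : hilbertType R}.
Implicit Types (x y : H) (c : R[i]).

(** Carrying the adjoint as data takes the place of the Riesz representation theorem. Linearity of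
    [bfun] follows from [bopP], and [badj] is determined by [bfun]. *)
Record bop := Bop {
  bfun :> H -> H;
  badj : H -> H;
  bopP : forall x y, inner (bfun x) y = inner x (badj y);
  bopB : exists C : R, forall x, hn (bfun x) <= C * hn x
}.
Implicit Types f g : bop.

HB.instance Definition _ := gen_eqMixin bop.
HB.instance Definition _ := gen_choiceMixin bop.

Lemma bop_adjP f x y : inner (badj f x) y = inner x (f y).
Proof. by rewrite innerC -bopP -innerC. Qed.

Lemma bop_eq f g : (forall x, f x = g x) -> f = g.
Proof.
move=> h; have ef : bfun f = bfun g by apply/funext.
have ea : badj f = badj g.
  by apply/funext => y; apply: inner_ext => z; rewrite !bop_adjP h.
case: f g ef ea {h} => [f f' fP fB] [g g' gP gB] /= ef ea.
by subst g g'; congr Bop; exact: Prop_irrelevance.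
Qed.

Lemma bop_lin f c x y : f (c *: x + y) = c *: f x + f y.
Proof.
by apply: inner_ext => z; rewrite bopP !innerDl !innerZl !bopP.
Qed.

Lemma bopZ f c x : f (c *: x) = c *: f x.
Proof. by apply: inner_ext => z; rewrite bopP !innerZl bopP. Qed.

Lemma bop_sub f x y : f (x - y) = f x - f y.
Proof. by apply: inner_ext => z; rewrite bopP !innerBl !bopP. Qed.

Definition is_bound (f : H -> H) (C : R) := 0 <= C /\ forall x, hn (f x) <= C * hn x.

Lemma bop_bound f : exists C, is_bound f C.
Proof.
have [C hC] := bopB f; exists `|C|; split=> // x.
by apply: le_trans (hC x) _; rewrite ler_wpM2r ?hn_ge0// ler_norm.
Qed.

(** The square of ||f* x|| is <x, f f* x>, at most ||x|| C ||f* x||. *)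
Lemma adj_bound f C : is_bound f C -> is_bound (badj f) C.
Proof.
move=> [C0 hC]; split=> // x; set u := hn (badj f x).
have h : u ^+ 2 <= hn x * (C * u).
  have -> : u ^+ 2 = complex.Re (inner x (f (badj f x))).
    by rewrite -bop_adjP inner_hn.
  apply: le_trans (cn_Re _) _; apply: le_trans (cauchy_schwarz _ _) _.
  by rewrite ler_wpM2l ?hn_ge0.
have [->|u0] := eqVneq u 0; first by rewrite mulr_ge0// hn_ge0.
have up : 0 < u by rewrite lt_def u0 hn_ge0.
by rewrite -(ler_pM2r up) -expr2; apply: le_trans h _; rewrite mulrA [hn x * C]mulrC.
Qed.

Definition bnorm f : R := inf [set C | is_bound f C].

Let has_inf_bound f : has_inf [set C | is_bound f C].
Proof. by split; [exact: bop_bound|exists 0 => C []]. Qed.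

Lemma bnorm_ge0 f : 0 <= bnorm f.
Proof. by apply: lb_le_inf; [exact: bop_bound|move=> C []]. Qed.

Lemma bnormP f x : hn (f x) <= bnorm f * hn x.
Proof.
have [x0|x0] := eqVneq (hn x) 0.
  have [C [_ /(_ x)]] := bop_bound f.
  by rewrite x0 !mulr0.
have xp : 0 < hn x by rewrite lt_def x0 hn_ge0.
rewrite -ler_pdivrMr//; apply: lb_le_inf; first exact: bop_bound.
by move=> N [_ hN]; rewrite ler_pdivrMr.
Qed.

Lemma bnorm_min f C : is_bound f C -> bnorm f <= C.
Proof. by move=> h; apply: ge_inf => //; case: (has_inf_bound f). Qed.

Lemma bnorm_bound f : is_bound f (bnorm f).
Proof. by split; [exact: bnorm_ge0|exact: bnormP]. Qed.

Program Definition bzero := @Bop (fun=> 0) (fun=> 0) _ _.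
Next Obligation. by move=> * /=; rewrite inner0l inner0r. Qed.
Next Obligation. by exists 0 => x; rewrite hn0 mul0r. Qed.

Program Definition bone := @Bop id id _ _.
Next Obligation. by []. Qed.
Next Obligation. by move=> * /=; exists 1 => x; rewrite mul1r. Qed.

Program Definition badd f g :=
  @Bop (fun x => f x + g x) (fun x => badj f x + badj g x) _ _.
Next Obligation. by move=> * /=; rewrite innerDl innerDr !bopP. Qed.
Next Obligation.
move=> f g; exists (bnorm f + bnorm g) => x; rewrite mulrDl; apply: le_trans (hnD _ _) _.
by rewrite lerD// bnormP.
Qed.

Program Definition bscale c f :=
  @Bop (fun x => c *: f x) (fun x => (c^*)%C *: badj f x) _ _.
Next Obligation. by move=> * /=; rewrite innerZl innerZr conjcK bopP. Qed.
Next Obligation.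
by move=> c f; exists (cn c * bnorm f) => x; rewrite hnZ -mulrA ler_wpM2l ?cn_ge0// bnormP.
Qed.

Program Definition bopp f := @Bop (fun x => - f x) (fun x => - badj f x) _ _.
Next Obligation. by move=> * /=; rewrite innerNl innerNr bopP. Qed.
Next Obligation. by move=> f; exists (bnorm f) => x; rewrite hnN bnormP. Qed.

Program Definition bmul f g :=
  @Bop (fun x => f (g x)) (fun x => badj g (badj f x)) _ _.
Next Obligation. by move=> * /=; rewrite !bopP. Qed.
Next Obligation.
move=> f g; exists (bnorm f * bnorm g) => x; apply: le_trans (bnormP _ _) _.
by rewrite -mulrA ler_wpM2l ?bnorm_ge0// bnormP.
Qed.

Program Definition bstar f := @Bop (badj f) f _ _.
Next Obligation. exact: bop_adjP. Qed.
Next Obligation.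
by move=> f; have [_ h] := adj_bound (bnorm_bound f); exists (bnorm f).
Qed.

(** The operators and their adjoints are both Cauchy in norm, hence converge pointwise, and
    [inner_limit] carries the adjoint relation to the limits. *)
Lemma bnorm_complete (v : nat -> bop) :
  (forall e : R, 0 < e -> exists N : nat,
    forall i j, (N <= i)%N -> (N <= j)%N -> bnorm (badd (v i) (bopp (v j))) < e) ->
  exists f, forall e : R, 0 < e -> exists N : nat,
    forall i, (N <= i)%N -> bnorm (badd (v i) (bopp f)) < e.
Proof.
move=> hv.
have pw (w : nat -> H -> H) : (forall e : R, 0 < e -> exists N : nat,
    forall i j, (N <= i)%N -> (N <= j)%N -> forall x, hn (w i x - w j x) <= e * hn x) ->
    exists f : H -> H, forall e : R, 0 < e -> exists N : nat,
    forall i, (N <= i)%N -> forall x, hn (w i x - f x) <= e * hn x.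
  move=> hw.
  have lim x : exists z, forall e : R, 0 < e -> exists N : nat,
      forall i, (N <= i)%N -> hn (w i x - z) < e.
    apply: hilbert_complete => e e0.
    have xp : 0 < hn x + 1 by rewrite ltr_wpDl// hn_ge0.
    have [N hN] := hw _ (divr_gt0 e0 xp); exists N => i j Ni Nj.
    apply: le_lt_trans (hN i j Ni Nj x) _.
    by rewrite mulrAC ltr_pdivrMr// ltr_pM2l// ltrDl.
  have [f hf] := choice lim; exists f => e e0.
  have [N hN] := hw e e0; exists N => i Ni x.
  apply/ler_addgt0Pr => d d0; have [M hM] := hf x d d0.
  apply: le_trans (hn_tri (w (maxn N M) x) _ _) _; apply: lerD.
    by apply: hN => //; exact: leq_maxl.
  by apply: ltW; apply: hM; exact: leq_maxr.
have [|f hf] := pw (fun i => v i).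
  move=> e e0; have [N hN] := hv e e0; exists N => i j Ni Nj x.
  apply: le_trans (bnormP (badd (v i) (bopp (v j))) x) _.
  by rewrite ler_wpM2r ?hn_ge0// ltW// hN.
have [|g hg] := pw (fun i => badj (v i)).
  move=> e e0; have [N hN] := hv e e0; exists N => i j Ni Nj x.
  have [_ h] := adj_bound (bnorm_bound (badd (v i) (bopp (v j)))).
  apply: le_trans (h x) _.
  by rewrite ler_wpM2r ?hn_ge0// ltW// hN.
have fg x y : inner (f x) y = inner x (g y).
  apply: inner_limit => e e0; pose D := hn x + hn y + 1.
  have x0 := hn_ge0 x; have y0 := hn_ge0 y; have Dp : 0 < D by rewrite /D; lra.
  have le (t : R) : t <= D -> e / D * t <= e.
    by move=> tD; rewrite mulrAC ler_pdivrMr// ler_wpM2l// ltW.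
  have [N hN] := hf _ (divr_gt0 e0 Dp); have [M hM] := hg _ (divr_gt0 e0 Dp).
  exists (v (maxn N M) x), (badj (v (maxn N M)) y); split; first exact: bopP.
    by apply: le_trans (hN _ (leq_maxl _ _) x) _; apply: le; rewrite /D; lra.
  by apply: le_trans (hM _ (leq_maxr _ _) y) _; apply: le; rewrite /D; lra.
have fB : exists C : R, forall x, hn (f x) <= C * hn x.
  have [N hN] := hf 1 ltr01; exists (bnorm (v N) + 1) => x.
  rewrite mulrDl; apply: le_trans (_ : hn (v N x) + hn (v N x - f x) <= _); last first.
    by rewrite lerD ?bnormP// hN.
  have -> : f x = v N x - (v N x - f x) by rewrite opprB addrC subrK.
  apply: le_trans (hnD _ _) _; rewrite hnN.
  by rewrite opprB addrCA subrr addr0.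
exists (Bop fg fB) => e e0.
have [N hN] := hf (e / 2) (divr_gt0 e0 (ltr0Sn R 1)); exists N => i Ni.
apply: le_lt_trans (_ : bnorm _ <= e / 2) _; last lra.
apply: bnorm_min; split; first by lra.
by move=> x /=; exact: hN.
Qed.

Lemma bnorm_star f : bnorm (bmul (bstar f) f) = bnorm f ^+ 2.
Proof.
apply/eqP; rewrite eq_le; apply/andP; split.
  apply: bnorm_min; split; first exact: sqr_ge0.
  move=> x /=; have [_ h] := adj_bound (bnorm_bound f).
  apply: le_trans (h _) _; rewrite expr2 -mulrA ler_wpM2l ?bnorm_ge0//.
  exact: bnormP.
set N := bnorm (bmul _ _); have N0 : 0 <= N by exact: bnorm_ge0.
have h : bnorm f <= Num.sqrt N.
  apply: bnorm_min; split; first exact: sqrtr_ge0.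
  move=> x; rewrite -ler_sqr ?nnegrE ?mulr_ge0 ?hn_ge0 ?sqrtr_ge0//.
  rewrite exprMn sqr_sqrtr//.
  have -> : hn (f x) ^+ 2 = complex.Re (inner x (bmul (bstar f) f x)).
    by rewrite /= -bopP inner_hn.
  apply: le_trans (cn_Re _) _; apply: le_trans (cauchy_schwarz _ _) _.
  by rewrite expr2 mulrCA ler_wpM2l ?hn_ge0// bnormP.
by rewrite -(sqr_sqrtr N0) ler_sqr ?nnegrE ?sqrtr_ge0 ?bnorm_ge0.
Qed.

Lemma bnormZ c f : bnorm (bscale c f) = cn c * bnorm f.
Proof.
apply/eqP; rewrite eq_le; apply/andP; split.
  apply: bnorm_min; split; first by rewrite mulr_ge0 ?cn_ge0 ?bnorm_ge0.
  by move=> x /=; rewrite hnZ -mulrA ler_wpM2l ?cn_ge0 ?bnormP.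
have [c0|c0] := eqVneq (cn c) 0; first by rewrite c0 mul0r bnorm_ge0.
have cp : 0 < cn c by rewrite lt_def c0 cn_ge0.
rewrite -ler_pdivlMl//; apply: bnorm_min; split.
  by rewrite mulr_ge0 ?invr_ge0 ?cn_ge0 ?bnorm_ge0.
move=> x; rewrite -mulrA ler_pdivlMl// -hnZ.
exact: (bnormP (bscale c f) x).
Qed.

End Operators.
Arguments bop {R} H.

(** * Contractivity of representations *)

Section Representations.
Context {R : realType} {A : cstarAlgType R}.
Implicit Types (a b : A) (c : R[i]).
Local Notation nm := (@cnorm R A).
Context {H : hilbertType R} (pi : A -> H -> H).
Hypothesis pi_rep : is_rep setT pi.
Hypothesis pi1 : forall x, pi 1 x = x.

Lemma rep_lin a c x y : pi a (c *: x + y) = c *: pi a x + pi a y.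
Proof. by case: pi_rep => /(_ a I)[l _] _ _ _; exact: l. Qed.
Lemma repM a b x : pi (a * b) x = pi a (pi b x).
Proof. by case: pi_rep => _ _ h _; exact: h. Qed.
Lemma rep_adj a x y : inner (pi (star a) x) y = inner x (pi a y).
Proof. by case: pi_rep => _ _ _; exact. Qed.
Lemma rep_lin2 a b c x : pi (c *: a + b) x = c *: pi a x + pi b x.
Proof. by case: pi_rep => _ h _ _; exact: h. Qed.
Lemma repx0 a : pi a 0 = 0.
Proof.
have := rep_lin a 1 0 0; rewrite scaler0 addr0 scale1r => e.
by apply: (addrI (pi a 0)); rewrite addr0 -e.
Qed.
Lemma rep0 x : pi 0 x = 0.
Proof.
have := rep_lin2 0 0 1 x; rewrite scaler0 addr0 scale1r => e.
by apply: (addrI (pi 0 x)); rewrite addr0 -e.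
Qed.
Lemma repZ a c x : pi (c *: a) x = c *: pi a x.
Proof. by rewrite -[c *: a]addr0 rep_lin2 rep0 addr0. Qed.
Lemma repD a b x : pi (a + b) x = pi a x + pi b x.
Proof. by rewrite -[a]scale1r rep_lin2 !scale1r. Qed.
Lemma repN a x : pi (- a) x = - pi a x.
Proof. by rewrite -scaleN1r repZ scaleN1r. Qed.
Lemma repxZ a c x : pi a (c *: x) = c *: pi a x.
Proof. by rewrite -[c *: x]addr0 rep_lin repx0 addr0. Qed.
Lemma repxD a x y : pi a (x + y) = pi a x + pi a y.
Proof. by rewrite -[x]scale1r rep_lin !scale1r. Qed.
Lemma rep_sum (I : Type) (s : seq I) (P : pred I) (F : I -> A) x :
  pi (\sum_(i <- s | P i) F i) x = \sum_(i <- s | P i) pi (F i) x.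
Proof. by elim/big_rec2: _ => [|i y1 y2 _ <-]; rewrite ?rep0 ?repD. Qed.

(* If nm a < N = ||pi a||, then 1 - a^* a / N^2 is left invertible by the Neumann
   series, so 1 - pi(a)^* pi(a) / N^2 is bounded below: N is not minimal. *)
Lemma rep_contract a x : hn (pi a x) <= nm a * hn x.
Proof.
have bounded b : exists2 C : R, 0 < C & forall x, hn (pi b x) <= C * hn x.
  by case: pi_rep => /(_ b I)[l c] _ _ _; exact: lin_bounded.
have adj y z : inner (pi a y) z = inner y (pi (star a) z).
  by rewrite -rep_adj starK.
have [C0 _ hC0] := bounded a; pose f := Bop adj (ex_intro _ C0 hC0).
have [N0 hN] := bnorm_bound f; have [_ hNs] := adj_bound (bnorm_bound f).
set N := bnorm f in N0 hN hNs.
suff Nle : N <= nm a by apply: le_trans (hN x) _; rewrite ler_wpM2r ?hn_ge0.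
rewrite leNgt; apply/negP => Ngt.
have Np : 0 < N by apply: le_lt_trans Ngt; exact: nm_ge0.
pose M := N ^+ 2; have Mp : 0 < M by exact: exprn_gt0.
have [|r hr] := @neumann _ _ ((M^-1)%:C *: (star a * a)).
  rewrite nmZ cn_real ger0_norm ?invr_ge0 ?ltW// cnorm_star.
  by rewrite mulrC ltr_pdivrMr// mul1r ltr_sqr ?nnegrE ?nm_ge0.
have [C Cp hC] := bounded r; have C2 : 0 < C ^+ 2 by exact: exprn_gt0.
(* The left inverse, bounded by [C], gives ||y|| <= C ||y - pi(a)^* pi(a) y / M||; the square is
   expanded with ||pi(a)^* z|| <= N ||z||. *)
have key y : hn y ^+ 2 <= C ^+ 2 * (hn y ^+ 2 - hn (pi a y) ^+ 2 / M).
  have e1 : y = pi r (y - (M^-1)%:C *: pi (star a) (pi a y)).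
    rewrite -{1}[y]pi1 -hr repM; congr (pi r _).
    by rewrite repD repN pi1 repZ repM.
  have h1 : hn y ^+ 2 <= C ^+ 2 * hn (y - (M^-1)%:C *: pi (star a) (pi a y)) ^+ 2.
    rewrite -exprMn ler_pXn2r ?nnegrE ?mulr_ge0 ?hn_ge0 ?(ltW Cp)//.
    by rewrite {1}e1; exact: hC.
  apply: le_trans h1 _; rewrite ler_pM2l//.
  rewrite hn_expand conjc_real cn_real ger0_norm ?invr_ge0 ?(ltW Mp)//.
  have -> : inner y (pi (star a) (pi a y)) = (hn (pi a y) ^+ 2)%:C.
    by rewrite -rep_adj starK inner_hn.
  rewrite -rmorphM/=.
  have : hn (pi (star a) (pi a y)) ^+ 2 <= M * hn (pi a y) ^+ 2.
    by rewrite -exprMn ler_pXn2r ?nnegrE ?mulr_ge0 ?hn_ge0//; exact: hNs.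
  set v := hn (pi a y) ^+ 2; set w := hn (pi (star a) _) ^+ 2 => huv.
  have : M^-1 ^+ 2 * w <= M^-1 ^+ 2 * (M * v) by rewrite ler_wpM2l// sqr_ge0.
  have -> : M^-1 ^+ 2 * (M * v) = v / M by field; rewrite gt_eqF.
  by rewrite [M^-1 * v]mulrC; lra.
(* By [key], M (1 - C^-2) bounds ||pi(a) y||^2 / ||y||^2, and it is smaller than M = N^2. The
   maximum with 0 keeps the argument of the square root nonnegative. *)
pose M' := Num.max 0 (M * (1 - (C ^+ 2)^-1)).
have : N <= Num.sqrt M'.
  apply: bnorm_min; split=> [|y]; first exact: sqrtr_ge0.
  rewrite -ler_sqr ?nnegrE ?mulr_ge0 ?hn_ge0 ?sqrtr_ge0//.
  rewrite exprMn sqr_sqrtr; last by rewrite le_max lexx.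
  apply: (@le_trans _ _ (M * (1 - (C ^+ 2)^-1) * hn y ^+ 2)).
    have := key y; rewrite /=; set w := hn y ^+ 2; set v := hn (pi a y) ^+ 2.
    rewrite -ler_pdivrMl// => h; rewrite mulrAC -mulrA mulrC -ler_pdivrMr// mulrBr mulr1.
    by rewrite [w / _]mulrC; lra.
  by rewrite ler_wpM2r ?sqr_ge0// le_max lexx orbT.
rewrite leNgt => /negP; apply; rewrite -ltr_sqr ?nnegrE ?sqrtr_ge0//.
rewrite sqr_sqrtr; last by rewrite le_max lexx.
by rewrite gt_max Mp gtr_pMr// ltrBlDr ltrDl invr_gt0.
Qed.

Lemma rep_approx a b x (e : R) : nm (a - b) < e -> hn (pi a x - pi b x) <= e * hn x.
Proof.
move=> h; rewrite -repN -repD; apply: le_trans (rep_contract _ _) _.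
by rewrite ler_wpM2r ?hn_ge0// ltW.
Qed.

End Representations.

(* The ring structure needs 1 != 0, hence the proof of H != 0 in the type. *)
Definition bopn (R : realType) (H : hilbertType R)
  (nz : exists h : H, h <> 0) : Type := bop H.

(** * The C*-algebra of bounded operators *)

Section BopAlgebra.
Context {R : realType} {H : hilbertType R} (nz : exists h : H, h <> 0).
Local Notation B := (bopn nz).

HB.instance Definition _ := Choice.on B.

Let addA : associative (@badd R H).
Proof. by move=> f g h; apply: bop_eq => x /=; rewrite addrA. Qed.
Let addC : commutative (@badd R H).
Proof. by move=> f g; apply: bop_eq => x /=; rewrite addrC. Qed.
Let add0 : left_id (@bzero R H) (@badd R H).
Proof. by move=> f; apply: bop_eq => x /=; rewrite add0r. Qed.
Let addN : left_inverse (@bzero R H) (@bopp R H) (@badd R H).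
Proof. by move=> f; apply: bop_eq => x /=; rewrite addNr. Qed.
HB.instance Definition _ := GRing.isZmodule.Build B addA addC add0 addN.

Let mulA : associative (@bmul R H).
Proof. by move=> f g h; apply: bop_eq. Qed.
Let mul1 : left_id (@bone R H) (@bmul R H).
Proof. by move=> f; apply: bop_eq. Qed.
Let mulr1' : right_id (@bone R H) (@bmul R H).
Proof. by move=> f; apply: bop_eq. Qed.
Let mulDl : left_distributive (@bmul R H) (@badd R H).
Proof. by move=> f g h; apply: bop_eq. Qed.
Let mulDr : right_distributive (@bmul R H) (@badd R H).
Proof.
move=> f g h; apply: bop_eq => x /=.
by have := bop_lin f 1 (g x) (h x); rewrite !scale1r.
Qed.
Let one_neq0 : (@bone R H : B) != (@bzero R H : B).
Proof.
apply/eqP => e; have [h h0] := nz; apply: h0.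
by have := congr1 (fun f : bop H => f h) e.
Qed.
HB.instance Definition _ :=
  GRing.Zmodule_isNzRing.Build B mulA mul1 mulr1' mulDl mulDr one_neq0.

Let scaleA c d (f : B) : bscale c (bscale d f) = bscale (c * d) f.
Proof. by apply: bop_eq => x /=; rewrite scalerA. Qed.
Let scale1 : left_id 1 (@bscale R H).
Proof. by move=> f; apply: bop_eq => x /=; rewrite scale1r. Qed.
Let scaleDr : right_distributive (@bscale R H) (@badd R H).
Proof. by move=> c f g; apply: bop_eq => x /=; rewrite scalerDr. Qed.
Let scaleDl (f : B) : {morph (@bscale R H)^~ f : a b / a + b >-> badd a b}.
Proof. by move=> a b; apply: bop_eq => x /=; rewrite scalerDl. Qed.
HB.instance Definition _ :=
  GRing.Zmodule_isLmodule.Build R[i] B scaleA scale1 scaleDr scaleDl.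

Let scaleAl (c : R[i]) (f g : B) : c *: (f * g) = (c *: f) * g.
Proof. by apply: bop_eq. Qed.
HB.instance Definition _ := GRing.Lmodule_isLalgebra.Build R[i] B scaleAl.
Let scaleAr (c : R[i]) (f g : B) : c *: (f * g) = f * (c *: g).
Proof. by apply: bop_eq => x /=; rewrite bopZ. Qed.
HB.instance Definition _ := GRing.Lalgebra_isAlgebra.Build R[i] B scaleAr.

Let bstarK (f : B) : bstar (bstar f) = f. Proof. exact: bop_eq. Qed.
Let bstarD (f g : B) : (bstar (f + g) : B) = (bstar f : B) + bstar g.
Proof. exact: bop_eq. Qed.
Let bstarZ (c : R[i]) (f : B) : (bstar (c *: f) : B) = (c^*)%C *: (bstar f : B).
Proof. exact: bop_eq. Qed.
Let bstarM (f g : B) : (bstar (f * g) : B) = (bstar g : B) * bstar f.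
Proof. exact: bop_eq. Qed.
Let bnorm_eq0 (f : B) : bnorm f = 0 -> f = 0.
Proof.
move=> h; apply: bop_eq => x; apply: hn_eq0; apply/eqP.
by rewrite eq_le hn_ge0 andbT; have := bnormP f x; rewrite h mul0r.
Qed.
Let bnormD (f g : B) : bnorm (f + g) <= bnorm f + bnorm g.
Proof.
apply: bnorm_min; split; first by rewrite addr_ge0 ?bnorm_ge0.
move=> x; rewrite mulrDl; apply: le_trans (hnD _ _) _.
by rewrite lerD// bnormP.
Qed.
Let bnormZC (c : R[i]) (f : B) : (bnorm (c *: f))%:C = `|c| * (bnorm f)%:C.
Proof. by rewrite cnE -rmorphM bnormZ. Qed.
Let bnormM (f g : B) : bnorm (f * g) <= bnorm f * bnorm g.
Proof.
apply: bnorm_min; split; first by rewrite mulr_ge0 ?bnorm_ge0.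
move=> x; apply: le_trans (bnormP f _) _.
by rewrite -mulrA ler_wpM2l ?bnorm_ge0// bnormP.
Qed.
HB.instance Definition _ := isCstar.Build R B bstarK bstarD bstarZ bstarM
  bnorm_eq0 bnormD bnormZC bnormM (@bnorm_star R H) (@bnorm_complete R H).

Lemma bop_sum (I : Type) (s : seq I) (P : pred I) (F : I -> B) x :
  (\sum_(i <- s | P i) F i : B) x = \sum_(i <- s | P i) (F i : bop H) x.
Proof. by elim/big_rec2: _ => [|i y1 y2 _ <-]. Qed.

Lemma bop_rep (A : cstarAlgType R) (phi : {lrmorphism A -> B}) :
  (forall a, phi (star a) = star (phi a)) ->
  is_rep setT (fun a x => (phi a : bop H) x).
Proof.
move=> hs; split.
- move=> a _; have lf : linear ((phi a : bop H) : H -> H).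
    by move=> c x y; rewrite bop_lin.
  by split => //; apply: (@bounded_continuous _ _ _ (bnorm (phi a))) => // x; exact: bnormP.
- by move=> c a b x _ _; rewrite linearP.
- by move=> a b x _ _; rewrite rmorphM.
- by move=> a x y _; rewrite hs /= bop_adjP.
Qed.

End BopAlgebra.

(** * Operators between orthogonal systems *)

Section OrthoSystems.
Context {R : realType} {H : hilbertType R}.
Implicit Types (x y : H) (E F : nat -> H).

Definition orthosys E := (forall i j, i <> j -> inner (E i) (E j) = 0 :> R[i]) /\
  forall i, hn (E i) <= 1.

Lemma orthosys_sum E (c : nat -> R[i]) (m n : nat) : orthosys E ->
  hn (\sum_(m <= i < n) c i *: E i) ^+ 2 <= \sum_(m <= i < n) cn (c i) ^+ 2.
Proof.
move=> [ho h1]; have [le|/ltnW le] := leqP m n; last first.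
  by rewrite !big_geq// hn0 expr0n.
rewrite -(subnKC le); elim: (n - m)%N => [|l IH].
  by rewrite addn0 !big_geq// hn0 expr0n.
rewrite addnS !big_nat_recr ?leq_addr//= pythagoras.
  rewrite lerD// hnZ exprMn -[leRHS]mulr1 ler_wpM2l ?sqr_ge0//.
  by rewrite expr_le1 ?hn_ge0.
rewrite inner_suml big_nat_cond big1// => i /andP[/andP[_ il] _].
rewrite innerZl innerZr ho ?mulr0// => e; move: il; rewrite e.
by rewrite ltnn.
Qed.

Lemma bessel E x (n : nat) : orthosys E ->
  \sum_(0 <= i < n) cn (inner x (E i)) ^+ 2 <= hn x ^+ 2.
Proof.
move=> hE; set S := \sum_(0 <= i < n) _.
pose s := \sum_(0 <= i < n) inner x (E i) *: E i.
have hs : hn s ^+ 2 <= S by exact: orthosys_sum.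
have xs : inner x s = S%:C.
  rewrite /s inner_sumr rmorph_sum/=; apply: eq_bigr => i _.
  by rewrite innerZr mulrC mulcJ.
have := sqr_ge0 (hn (x - 1 *: s)); rewrite hn_expand xs cn1 rmorph1 mul1r expr1n mul1r /=.
lra.
Qed.

Lemma nonneg_series_cauchy (t : nat -> R) (C : R) : (forall i, 0 <= t i) ->
  (forall n, \sum_(0 <= i < n) t i <= C) ->
  forall e, 0 < e -> exists N, forall m n, (N <= m)%N -> (m <= n)%N ->
    \sum_(m <= i < n) t i < e.
Proof.
move=> t0 tC e e0; pose V := [set \sum_(0 <= i < n) t i | n in setT].
have hV : has_sup V.
  by split; [exists 0, 0%N => //; rewrite big_geq|exists C => _ [n _ <-]].
have [_ [N _ <-] hN] := sup_adherent e0 hV.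
exists N => m n Nm mn.
have le a b : (a <= b)%N -> \sum_(0 <= i < a) t i <= \sum_(0 <= i < b) t i.
  by move=> ab; rewrite (big_cat_nat (n := a) (p := b))//= lerDl sumr_ge0.
have : \sum_(0 <= i < n) t i <= sup V.
  by apply: sup_upper_bound => //; exists n.
rewrite (big_cat_nat (n := m))//=; have := le _ _ Nm; lra.
Qed.

(** The operator is x |-> sum <x, E_i> F_i, convergent by Bessel's inequality, and exchanging [E]
    and [F] gives its adjoint. The factor <E_j, E_j> stays because the system need not be
    normalized. *)
Lemma ex_orthosys_bop E F : orthosys E -> orthosys F ->
  exists b : bop H, forall j, b (E j) = inner (E j) (E j) *: F j.
Proof.
move=> hE hF.
have conv E' F' x : orthosys E' -> orthosys F' -> exists z, forall e : R, 0 < e ->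
    exists N : nat, forall n, (N <= n)%N ->
      hn (\sum_(0 <= i < n) inner x (E' i) *: F' i - z) < e.
  move=> hE' hF'; apply: hilbert_complete => e e0.
  have [|N hN] := @nonneg_series_cauchy (fun i => cn (inner x (E' i)) ^+ 2)
    (hn x ^+ 2) (fun=> sqr_ge0 _) _ (e ^+ 2) (exprn_gt0 2 e0).
    by move=> n; exact: bessel.
  have key i j : (N <= i)%N -> (i <= j)%N ->
    hn (\sum_(0 <= l < i) inner x (E' l) *: F' l -
        \sum_(0 <= l < j) inner x (E' l) *: F' l) < e.
    move=> Ni ij; rewrite hn_sub (big_cat_nat (n := i) (p := j))//= addrAC subrr add0r.
    rewrite -ltr_sqr ?nnegrE ?hn_ge0 ?(ltW e0)//.
    apply: le_lt_trans (hN i j Ni ij); exact: orthosys_sum.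
  exists N => i j Ni Nj; have [ij|/ltnW ji] := leqP i j; first exact: key.
  by rewrite hn_sub; exact: key.
have [f hf] := choice (fun x => conv E F x hE hF).
have [g hg] := choice (fun x => conv F E x hF hE).
have bound x : hn (f x) <= 1 * hn x.
  rewrite mul1r; apply/ler_addgt0Pr => e e0; have [N hN] := hf x e e0.
  have -> : f x = \sum_(0 <= i < N) inner x (E i) *: F i
       - (\sum_(0 <= i < N) inner x (E i) *: F i - f x).
    by rewrite opprB addrC subrK.
  apply: le_trans (hnD _ _) _; rewrite hnN lerD ?(ltW (hN _ _))//.
  rewrite -ler_sqr ?nnegrE ?hn_ge0//.
  by apply: le_trans (orthosys_sum _ _ _ hF) _; exact: bessel.
have adj x y : inner (f x) y = inner x (g y).
  apply: inner_limit => e e0.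
  have [N hN] := hf x e e0; have [M hM] := hg y e e0; set n := maxn N M.
  exists (\sum_(0 <= i < n) inner x (E i) *: F i), (\sum_(0 <= i < n) inner y (F i) *: E i).
  split; [|exact/ltW/hN/leq_maxl|exact/ltW/hM/leq_maxr].
  rewrite inner_suml inner_sumr; apply: eq_bigr => i _.
  by rewrite innerZl innerZr mulrC -innerC.
exists (Bop adj (ex_intro _ 1 bound)) => j /=.
apply/eqP; rewrite -subr_eq0; apply/eqP; apply: hn_le0 => e e0.
have [N hN] := hf (E j) e e0; have := hN _ (leq_maxl N j.+1).
have [ho _] := hE.
rewrite (big_cat_nat (n := j.+1)) ?leq_maxr//= big_nat_recr//=.
rewrite big_nat_cond big1 ?add0r => [|i /andP[/andP[_ ij] _]]; last first.
  by rewrite ho ?scale0r// => e1; move: ij; rewrite e1 ltnn.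
rewrite big_nat_cond big1 ?addr0 => [|i /andP[/andP[ij _] _]]; last first.
  by rewrite ho ?scale0r// => e1; move: ij; rewrite e1 ltnn.
by rewrite hn_sub => /ltW.
Qed.

End OrthoSystems.

(** * Weighted partial injections of an orthonormal basis *)

Section BasisOperators.
Context {R : realType} {H : hilbertType R} {I : Type} (X : set I) (e : I -> H).
Hypothesis onb : orthonormal_basis X e.

Lemma basis_one y : X y -> hn (e y) = 1.
Proof.
case: onb => h _ _ /h; rewrite inner_hn => /complexI /eqP.
by rewrite sqrp_eq1 ?hn_ge0// => /eqP.
Qed.

Lemma basis_nz y : X y -> e y <> 0.
Proof. by move=> /basis_one h e0; move: h; rewrite e0 hn0 => /eqP; rewrite eq_sym oner_eq0. Qed.

Lemma dense_approx (V : set H) : subspace_set V -> (forall y, X y -> V (e y)) ->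
  forall w (d : R), 0 < d -> exists2 w', V w' & hn (w - w') < d.
Proof.
move=> sV hV w; case: onb => _ _ h.
have : closure (span_set [set e y | y in X]) w by rewrite h.
move=> hw; apply/closure_hnP; move: w hw; apply: closureS.
by apply: smallest_sub => // _ [y Xy <-]; exact: hV.
Qed.

Lemma dense_ind (V : set H) : subspace_set V -> closed V ->
  (forall y, X y -> V (e y)) -> V = setT.
Proof.
move=> sV cV hV; apply/seteqP; split=> // w _.
by apply/(closed_hnP V).1 => // d; exact: dense_approx.
Qed.

Lemma basis_inner_ext (v w : H) :
  (forall y, X y -> inner v (e y) = inner w (e y) :> R[i]) -> v = w.
Proof.
move=> h; apply/eqP; rewrite -subr_eq0; apply/eqP; set d := v - w.
apply: hn_le0 => r r0.
have [||z hz dz] := @dense_approx [set z | inner d z = 0 :> R[i]] _ _ d r r0.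
- split=> [|c a b /= ha hb]; first by rewrite /= inner0r.
  by rewrite innerDr innerZr ha hb mulr0 addr0.
- by move=> y Xy /=; rewrite innerBl h// subrr.
have := cauchy_schwarz d (d - z); rewrite innerBr hz subr0 inner_hn cn_real.
by rewrite ger0_norm ?sqr_ge0//; have := hn_ge0 d; nra.
Qed.

Lemma basis_bop_ext (f g : bop H) : (forall y, X y -> f (e y) = g (e y)) -> f = g.
Proof.
move=> h; apply: bop_eq => z; apply: inner_ext => w; rewrite !bopP.
congr inner; apply: basis_inner_ext => y Xy.
by rewrite !bop_adjP h.
Qed.

Variables (b : bop H) (P : set I) (tau : I -> I) (c : I -> R[i]).
Hypothesis b_spec : forall y, X y ->
  (P y -> b (e y) = c y *: e (tau y)) /\ (~ P y -> b (e y) = 0).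
Hypothesis tauX : forall y, X y -> P y -> X (tau y).
Hypothesis tauI : forall y z, X y -> X z -> P y -> P z -> tau y = tau z -> y = z.

Lemma basis_adj y : X y -> P y -> badj b (e (tau y)) = ((c y)^*)%C *: e y.
Proof.
move=> Xy Py; apply: basis_inner_ext => z Xz; rewrite bop_adjP innerZl.
case: onb => e1 eo _; have [hP hN] := b_spec Xz.
have [Pz|nPz] := pselect (P z).
  rewrite hP// innerZr; have [tyz|tyz] := pselect (tau y = tau z).
    by rewrite (tauI Xy Xz Py Pz tyz) !e1//; exact: tauX.
  rewrite !eo ?mulr0//; try exact: tauX.
  by move=> yz; apply: tyz; rewrite yz.
rewrite hN// inner0r eo ?mulr0// => yz; apply: nPz; by rewrite -yz.
Qed.

Lemma basis_adj0 z : X z -> (forall y, X y -> P y -> tau y <> z) ->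
  badj b (e z) = 0.
Proof.
move=> Xz hz; apply: basis_inner_ext => y Xy; rewrite bop_adjP inner0l.
case: onb => _ eo _; have [hP hN] := b_spec Xy.
have [Py|nPy] := pselect (P y); last by rewrite hN ?inner0r.
by rewrite hP// innerZr eo ?mulr0//; [exact: tauX|move=> e'; exact: (hz y)].
Qed.

End BasisOperators.

(** An injection of [X] into the integers turns the basis and its image into sequences, with the
    zero vector at every index outside the range of the injection. *)
Lemma ex_basis_bop (R : realType) (H : hilbertType R) (I : Type) (X : set I)
    (e : I -> H) (P : set I) (tau : I -> I) (c : I -> R[i]) : countable X -> orthonormal_basis X e ->
  (forall y, X y -> P y -> X (tau y)) ->
  (forall y z, X y -> X z -> P y -> P z -> tau y = tau z -> y = z) ->
  (forall y, cn (c y) <= 1) ->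
  exists b : bop H, forall y, X y ->
    (P y -> b (e y) = c y *: e (tau y)) /\ (~ P y -> b (e y) = 0).
Proof.
move=> /countable_injP[f fI] onb Xtau tauI c1; have [e1 eo _] := onb.
have one := basis_one onb.
pose g y : H := if pselect (P y) then c y *: e (tau y) else 0.
have /choice[EF hEF] n : exists EF : H * H,
    (exists y, [/\ X y, f y = n & EF = (e y, g y)]) \/
    ((forall y, X y -> f y <> n) /\ EF = (0, 0)).
  have [[y [Xy yn]]|hn'] := pselect (exists y, X y /\ f y = n).
    by exists (e y, g y); left; exists y.
  by exists (0, 0); right; split=> // y Xy yn; apply: hn'; exists y.
have go y z : X y -> X z -> y <> z -> inner (g y) (g z) = 0 :> R[i].
  move=> Xy Xz yz; rewrite /g; case: pselect => [Py|_] /=; last by rewrite inner0l.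
  case: pselect => [Pz|_] /=; last by rewrite inner0r.
  rewrite innerZl innerZr eo ?mulr0//; try exact: Xtau.
  by move=> h; apply: yz; exact: tauI.
have g1 y : X y -> hn (g y) <= 1.
  move=> Xy; rewrite /g; case: pselect => [Py|_] /=; last by rewrite hn0.
  by rewrite hnZ one ?mulr1//; exact: Xtau.
have oE : orthosys (fun n => (EF n).1).
  split=> [i j ij|i].
    have [[y [Xy yi ->]]|[_ ->]] := hEF i; last by rewrite inner0l.
    have [[z [Xz zj ->]]|[_ ->]] := hEF j; last by rewrite inner0r.
    by apply: eo => // yz; apply: ij; rewrite -yi -zj yz.
  by have [[y [Xy yi ->]]|[_ ->]] := hEF i; rewrite /= ?one// hn0.
have oF : orthosys (fun n => (EF n).2).
  split=> [i j ij|i].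
    have [[y [Xy yi ->]]|[_ ->]] := hEF i; last by rewrite inner0l.
    have [[z [Xz zj ->]]|[_ ->]] := hEF j; last by rewrite inner0r.
    by apply: go => // yz; apply: ij; rewrite -yi -zj yz.
  by have [[y [Xy yi ->]]|[_ ->]] := hEF i; rewrite /= ?g1// hn0.
have [b hb] := ex_orthosys_bop oE oF.
exists b => y Xy; have [[z [Xz zy ez]]|[/(_ y Xy)//]] := hEF (f y).
have := hb (f y); rewrite ez /= (fI z y) ?inE// e1// scale1r => ->; rewrite /g.
by split=> h; case: pselect.
Qed.

(** * The representations on orbits *)

Section CuntzKrieger.
Context {R : realType} {k : nat} {L : kgraph k} {G : groupType}.
Variables (S : selfsim L G) (A : cstarAlgType R) (s : L -> A) (u : G -> A).
Hypothesis L_row_finite : row_finite L.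
Hypothesis fam : ssgraph_family S s u.
Hypothesis A1 : forall g (v : L), vertices v -> ss_act S g v = v.
Local Notation nm := (@cnorm R A).
Implicit Types (m n l : L) (g : G).

Let ck : ck_family s. Proof. by case: fam. Qed.

Lemma ck_comp m n : ks m = kr n -> s (kcomp m n) = s m * s n.
Proof. by case: ck => _ _ h _ _; exact: h. Qed.
Lemma ck_starl m : star (s m) * s m = s (ks m).
Proof. by case: ck. Qed.
Lemma ck_proj v : vertices v -> is_proj (s v).
Proof. by case: ck => _ [h _] _ _ _ /h. Qed.
Lemma ck_vorth v w : vertices v -> vertices w -> v <> w -> s v * s w = 0.
Proof. by case: ck => _ [_ h] _ _ _; exact: h. Qed.
Lemma ck_pisom m : s m * star (s m) * s m = s m.
Proof. by case: ck. Qed.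
Lemma ck_l m : s (kr m) * s m = s m.
Proof. by rewrite -ck_comp ?ks_kr// kcomp_id_l. Qed.
Lemma ck_r m : s m * s (ks m) = s m.
Proof. by rewrite -ck_comp ?kr_ks// kcomp_id_r. Qed.
Definition vpaths (v : L) (p : Nk k) : seq L :=
  finmap.enum_fset (fset_set [set l : L | kr l = v /\ kd l = p]).

Lemma vpaths_uniq v p : uniq (vpaths v p).
Proof. exact: finmap.fset_uniq. Qed.

Lemma mem_vpaths v p l : vertices v -> (l \in vpaths v p) <-> kr l = v /\ kd l = p.
Proof.
move=> vv; rewrite /vpaths.
have -> : (l \in finmap.enum_fset (fset_set [set l : L | kr l = v /\ kd l = p])) =
  (l \in [set l : L | kr l = v /\ kd l = p]).
  by rewrite -(in_fset_set (L_row_finite p vv)).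
by rewrite inE.
Qed.

Lemma ck_sum v p : vertices v -> s v = \sum_(l <- vpaths v p) s l * star (s l).
Proof.
move=> vv; case: ck => _ _ _ _ /(_ v p vv) ->.
rewrite fsbig_finite//=; exact: L_row_finite.
Qed.

Lemma ck_range_proj m : is_proj (s m * star (s m)).
Proof. by split; rewrite ?starM ?starK// mulrA ck_pisom. Qed.

(** The relations only say that the range projections of one degree at a vertex sum to the vertex
    projection; their orthogonality is extracted by [proj_orth]. *)
Lemma ck_orth m n : kd m = kd n -> m <> n -> star (s m) * s n = 0.
Proof.
move=> e ne; have [er|ner] := pselect (kr m = kr n); last first.
  rewrite -[s m]ck_l -[s n]ck_l starM.
  have [-> _] := ck_proj (vertex_r m).
  rewrite mulrA -[_ * s (kr m) * s (kr n)]mulrA ck_vorth ?mulr0 ?mul0r//; exact: vertex_r.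
have h := @proj_orth R A L (vpaths (kr m) (kd m)) (fun l => s l * star (s l))
  (s (kr m)) (vpaths_uniq _ _).
have : s m * star (s m) * (s n * star (s n)) = 0.
  apply: h; rewrite ?(ck_sum (kd m))//; try exact: vertex_r.
  - move=> l /mem_vpaths -/(_ (vertex_r m))[rl _]; split; first exact: ck_range_proj.
    by rewrite -ck_sum ?mulrA -?rl ?ck_l//; exact: vertex_r.
  - by apply/mem_vpaths => //; exact: vertex_r.
  - by apply/mem_vpaths => //; exact: vertex_r.
  - exact/eqP.
move=> h0; rewrite -[s m]ck_pisom -[s n]ck_pisom starM starM starK.
have -> : star (s m) * (s m * star (s m)) * (s n * star (s n) * s n) =
  star (s m) * (s m * star (s m) * (s n * star (s n))) * s n by rewrite !mulrA.
by rewrite h0 mulr0 mul0r.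
Qed.

Lemma u1 : u 1%g = 1.
Proof.
case: fam => _ hu hM _; have [h _] := hu 1%g.
have e : u 1%g * u 1%g = u 1%g by rewrite -hM mulg1.
by rewrite -[LHS]mul1r -h -mulrA e h.
Qed.
Lemma uM g h : u (g * h)%g = u g * u h.
Proof. by case: fam. Qed.
Lemma u_star g : star (u g) = u g^-1%g.
Proof.
case: fam => _ hu hM _; have [h1 h2] := hu g.
by rewrite -[LHS]mulr1 -u1 -(mulgV g) uM mulrA h1 mul1r.
Qed.
Lemma us g m : u g * s m = s (ss_act S g m) * u (ss_res S g m).
Proof. by case: fam. Qed.

Definition gen (t : L * G * L) : A := s t.1.1 * u t.1.2 * star (s t.2).

Let X := [set a | exists m g n, ks m = ss_act S g (ks n) /\ a = s m * u g * star (s n)].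

Lemma span_subspace (V : lmodType R[i]) (Z : set V) : subspace_set (span_set Z).
Proof.
split; first by move=> W [[W0 _] _].
by move=> c a b ha hb W hW; case: (hW) => -[_ h] _; apply: h; [exact: ha|exact: hb].
Qed.

Lemma span_sub (V : lmodType R[i]) (Z : set V) : Z `<=` span_set Z.
Proof. by move=> a Za W [_]; apply. Qed.

Lemma subspace_sum (V : lmodType R[i]) (Z : set V) (I : eqType) (r : seq I) (F : I -> V) :
  subspace_set Z -> (forall i, i \in r -> Z (F i)) -> Z (\sum_(i <- r) F i).
Proof.
move=> [Z0 hZ] h; rewrite big_seq.
apply: big_ind => [//|a b Za Zb|i ir]; last exact: h.
by rewrite -[a]scale1r; exact: hZ.
Qed.

Lemma subspaceZ (V : lmodType R[i]) (Z : set V) c a : subspace_set Z -> Z a -> Z (c *: a).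
Proof. by move=> [Z0 hZ] Za; rewrite -[c *: a]addr0; exact: hZ. Qed.

Lemma spanX (t : L * G * L) : valid t -> span_set X (gen t).
Proof.
move=> ht; apply: span_sub; exists t.1.1, t.1.2, t.2; split=> //.
by rewrite A1//; exact: vertex_s.
Qed.

Lemma span_sumP a : span_set X a -> exists r : seq (R[i] * (L * G * L)),
  (forall i, i \in r -> valid i.2) /\ a = \sum_(i <- r) i.1 *: gen i.2.
Proof.
pose Y := [set a | exists r : seq (R[i] * (L * G * L)),
  (forall i, i \in r -> valid i.2) /\ a = \sum_(i <- r) i.1 *: gen i.2].
suff : span_set X `<=` Y by apply.
apply: smallest_sub.
  split; first by exists [::]; rewrite big_nil.
  move=> c a' b [r [hr ->]] [r' [hr' ->]].
  exists ([seq (c * i.1, i.2) | i <- r] ++ r'); split.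
    by move=> i; rewrite mem_cat => /orP[/mapP[j /hr ? ->]|/hr'].
  rewrite big_cat big_map scaler_sumr; congr (_ + _).
  by apply: eq_bigr => i _; rewrite scalerA.
move=> _ [m [g [n [e ->]]]]; exists [:: (1, (m, g, n))]; split.
  by move=> i; rewrite inE => /eqP ->; rewrite /valid /= e A1//; exact: vertex_s.
by rewrite big_seq1 scale1r.
Qed.

(** The inner factors are expanded at the common degree [M], where [ck_orth] leaves only the terms
    with n l = m' l'. The group elements are then moved past [l] and [l'] to the middle, which
    yields generators again. *)
Lemma gen_mul t t' : valid t -> valid t' -> span_set X (gen t * gen t').
Proof.
case: t => [[m g] n]; case: t' => [[m' g'] n']; rewrite /valid /gen /= => ht ht'.
pose M := maxN (kd n) (kd m').
have e1 := subNK (leN_maxl (kd n) (kd m')); have e2 := subNK (leN_maxr (kd n) (kd m')).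
set p := subN _ (kd n) in e1; set q := subN _ (kd m') in e2.
have E1 : star (s n) = \sum_(l <- vpaths (ks n) p) s l * star (s (kcomp n l)).
  rewrite -[in LHS](ck_r n) starM; have [-> _] := ck_proj (vertex_s n).
  rewrite {1}(ck_sum p (vertex_s n)) mulr_suml [LHS]big_seq [RHS]big_seq.
  apply: eq_bigr => l /mem_vpaths -/(_ (vertex_s n))[rl _].
  by rewrite ck_comp// starM mulrA.
have E2 : s m' = \sum_(l <- vpaths (ks m') q) s (kcomp m' l) * star (s l).
  rewrite -[in LHS](ck_r m') {1}(ck_sum q (vertex_s m')) mulr_sumr [LHS]big_seq [RHS]big_seq.
  apply: eq_bigr => l /mem_vpaths -/(_ (vertex_s m'))[rl _].
  by rewrite ck_comp// mulrA.
have -> : s m * u g * star (s n) * (s m' * u g' * star (s n')) =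
    \sum_(l <- vpaths (ks n) p) \sum_(l' <- vpaths (ks m') q)
      s m * u g * (s l * (star (s (kcomp n l)) * s (kcomp m' l')) * star (s l')) *
       (u g' * star (s n')).
  rewrite -[s m' * u g' * _]mulrA mulrA -[_ * star (s n) * s m']mulrA.
  have -> : star (s n) * s m' =
    \sum_(l <- vpaths (ks n) p) \sum_(l' <- vpaths (ks m') q)
      (s l * (star (s (kcomp n l)) * s (kcomp m' l')) * star (s l')).
    rewrite [in LHS]E1 [in LHS]E2 mulr_suml; apply: eq_bigr => l _.
    by rewrite mulr_sumr; apply: eq_bigr => l' _; rewrite !mulrA.
  rewrite mulr_sumr mulr_suml; apply: eq_bigr => l _.
  by rewrite mulr_sumr mulr_suml.
apply: subspace_sum; first exact: span_subspace.
move=> l /mem_vpaths -/(_ (vertex_s n))[rl dl].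
apply: subspace_sum; first exact: span_subspace.
move=> l' /mem_vpaths -/(_ (vertex_s m'))[rl' dl'].
have [e|ne] := pselect (kcomp n l = kcomp m' l'); last first.
  rewrite ck_orth ?mulr0 ?mul0r ?mulr0 ?mul0r//; last first.
    by rewrite !kd_comp// dl dl' e1 e2.
  by have [] := span_subspace X.
have sl : ks l = ks l' by rewrite -(ks_comp (esym rl)) e ks_comp.
rewrite e ck_starl ks_comp// -sl ck_r.
pose h := g'^-1%g.
have hc : ks m = kr (ss_act S g l) by rewrite act_r// ht rl.
have hc' : ks n' = kr (ss_act S h l') by rewrite act_r// -ht' rl'.
have -> : s m * u g * (s l * star (s l')) * (u g' * star (s n')) =
   gen (kcomp m (ss_act S g l), (ss_res S g l * (ss_res S h l')^-1)%g,
        kcomp n' (ss_act S h l')).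
  rewrite /gen /= ck_comp// uM ck_comp// starM.
  have E3 : star (s l') * u g' = u (ss_res S h l')^-1%g * star (s (ss_act S h l')).
    by rewrite -[u g']starK u_star -starM us starM u_star.
  by rewrite !mulrA -[s m * u g * s l]mulrA us !mulrA -[_ * star (s l') * u g']mulrA E3 !mulrA.
by apply: spanX; rewrite /valid /= !ks_comp// !act_s.
Qed.

Lemma span_mul a b : span_set X a -> span_set X b -> span_set X (a * b).
Proof.
move=> /span_sumP[r [hr ->]] /span_sumP[r' [hr' ->]].
have sp := span_subspace X.
rewrite mulr_suml; apply: subspace_sum => // i /hr ri.
rewrite mulr_sumr; apply: subspace_sum => // j /hr' rj.
rewrite -scalerAl -scalerAr; apply: (subspaceZ _ sp); apply: (subspaceZ _ sp).
exact: gen_mul.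
Qed.

Lemma closure_norm_sub (Z : set A) : Z `<=` norm_closure Z.
Proof. by move=> a Za e e0; exists a => //; rewrite subrr nm0. Qed.

Lemma closure_norm_closed (Z : set A) : norm_closure (norm_closure Z) `<=` norm_closure Z.
Proof.
move=> a ha e e0; have e2 : 0 < e / 2 by rewrite divr_gt0.
have [b hb ab] := ha _ e2; have [c Zc bc] := hb _ e2.
by exists c => //; apply: le_lt_trans (nm_tri b _ _) _; rewrite [e]splitr ltrD.
Qed.

Lemma OGL_span a : span_set X a -> OGL S s u a.
Proof. by move=> h; exact: (@closure_norm_sub (span_set X)). Qed.

Lemma OGL_closed : norm_closure (OGL S s u) `<=` OGL S s u.
Proof. exact: (@closure_norm_closed (span_set X)). Qed.

Lemma OGL_subspace : subspace_set (OGL S s u).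
Proof.
have [X0 hX] := span_subspace X.
split; first exact: OGL_span.
move=> c a b ha hb e e0; have c1 : 0 < cn c + 1 by rewrite ltr_wpDl// cn_ge0.
have e2 : 0 < e / 2 by rewrite divr_gt0.
have [a' Xa aa] := ha _ (divr_gt0 e2 c1); have [b' Xb bb] := hb _ e2.
exists (c *: a' + b'); first exact: hX.
have -> : c *: a + b - (c *: a' + b') = c *: (a - a') + (b - b').
  by rewrite opprD addrACA scalerBr.
apply: le_lt_trans (cnormD _ _) _; rewrite [e]splitr ltrD// nmZ.
move: aa; rewrite ltr_pdivlMr// mulrC; apply: le_lt_trans.
by rewrite ler_wpM2r ?nm_ge0// lerDl.
Qed.

Lemma OGL_mul a b : OGL S s u a -> OGL S s u b -> OGL S s u (a * b).
Proof.
move=> ha hb e e0; have e2 : 0 < e / 2 by rewrite divr_gt0.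
have c1 : 0 < nm b + 1 by rewrite ltr_wpDl// nm_ge0.
have [a' Xa aa] := ha _ (divr_gt0 e2 c1).
have c2 : 0 < nm a' + 1 by rewrite ltr_wpDl// nm_ge0.
have [b' Xb bb] := hb _ (divr_gt0 e2 c2).
exists (a' * b'); first exact: span_mul.
have -> : a * b - a' * b' = (a - a') * b + a' * (b - b').
  by rewrite mulrBl mulrBr addrA subrK.
apply: le_lt_trans (cnormD _ _) _; rewrite [e]splitr ltrD//.
  apply: le_lt_trans (cnormM _ _) _.
  move: aa; rewrite ltr_pdivlMr//; apply: le_lt_trans.
  by rewrite ler_wpM2l ?nm_ge0// lerDl.
apply: le_lt_trans (cnormM _ _) _.
move: bb; rewrite ltr_pdivlMr// mulrC; apply: le_lt_trans.
by rewrite ler_wpM2r ?nm_ge0// lerDl.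
Qed.

Lemma OGL_gen t : valid t -> OGL S s u (gen t).
Proof. by move=> /spanX/OGL_span. Qed.

Lemma OGL_vertex v : vertices v -> OGL S s u (s v).
Proof.
move=> vv; have := @OGL_gen (v, 1%g, v) erefl.
by rewrite /gen /= u1 mulr1; have [-> ->] := ck_proj vv.
Qed.

Lemma OGL_approx a (e : R) : OGL S s u a -> 0 < e ->
  exists r : seq (R[i] * (L * G * L)), (forall i, i \in r -> valid i.2) /\
    nm (a - \sum_(i <- r) i.1 *: gen i.2) < e.
Proof.
by move=> ha e0; have [b /span_sumP[r [hr ->]] h] := ha e e0; exists r.
Qed.

End CuntzKrieger.

Section Characters.
Context {R : realType} {k : nat} (ft : Zfun R k).
Hypothesis ft_dual : dual setT ft.

Lemma charD (a b : Zk k) : ft (a + b) = ft a * ft b.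
Proof. by case: ft_dual => h _ _; exact: h. Qed.
Lemma char_cn (a : Zk k) : cn (ft a) = 1.
Proof. by case: ft_dual => _ h _; apply: complexI; rewrite -cnE h// rmorph1. Qed.
Lemma char0 : ft (0 : Zk k) = 1.
Proof.
have h := charD 0 0; rewrite addr0 in h.
have : ft (0 : Zk k) != 0 by rewrite -normr_eq0 cnE char_cn oner_eq0.
by move=> /mulfI; apply; rewrite -h mulr1.
Qed.
Lemma charN (a : Zk k) : ft (- a) = ((ft a)^*)%C.
Proof.
have a0 : ft a != 0 by rewrite -normr_eq0 cnE char_cn oner_eq0.
apply: (mulfI a0); rewrite -charD subrr char0 unimodular_conj//; exact: char_cn.
Qed.
Lemma char_diff (p q : Nk k) :
  ft (degdiff p q) = ft (degdiff p 0) * ((ft (degdiff q 0))^*)%C.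
Proof.
rewrite -charN -charD -degdiffC -degdiffD; congr (ft _).
by apply/ffunP => i; rewrite !ffunE addr0 add0r.
Qed.
End Characters.

(** * Orbits of infinite paths *)

Section Orbit.
Context {k : nat} {L : kgraph k} {G : groupType} (S : selfsim L G).
Hypothesis A1 : forall g (v : L), vertices v -> ss_act S g v = v.
Variables (T : set L) (x : infpath L).
Hypotheses (Tmax : maximal_tail T) (Tx : paths_in (graphT T) x)
  (xcof : cofinal_in (graphT T) x).
Implicit Types (y z : infpath L).
Local Notation orb := (orbit_class S T x).

Lemma orbit_refl : orb x.
Proof. by split=> //; exists 0, 0, 1%g; rewrite act_path1. Qed.

Lemma orbit_in y : orb y -> paths_in (graphT T) y. Proof. by case. Qed.

Lemma orbit_prepend m y : ks m = y 0 0 -> orb y -> orb (prepend m y).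
Proof.
move=> h [Ty [p [q [g e]]]]; split; first exact: paths_in_prepend.
by exists p, (q + kd m), g; rewrite shift_prepend_le.
Qed.

Lemma orbit_shift n y : orb y -> orb (pshift n y).
Proof.
move=> [Ty [p [q [g e]]]]; split; first exact: paths_in_shift.
exists (p + n), q; eexists; rewrite addrC -shiftD e act_path_shift shiftD addrC -shiftD.
by [].
Qed.

Lemma orbit_act g y : orb y -> orb (act_path S g y).
Proof.
move=> [Ty [p [q [h e]]]]; split; first exact: paths_in_act.
exists p, q; eexists; rewrite e -{1}[y](act_pathK S g) act_path_shift act_path_mul.
by [].
Qed.

Lemma orbit_tact m g n y : ks m = ks n -> tdom n y -> orb y -> orb (tact S m g n y).
Proof.
move=> hs hd hy; apply: orbit_prepend; first exact: tact_compat.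
by apply: orbit_act; exact: orbit_shift.
Qed.

(** Both relations to [x] are shifted to the common tail at p' + p, where [y] and [z] differ by a
    group element [h]; their initial segments then give the triple. *)
Lemma orbit_connect y z : orb y -> orb z -> exists t : L * G * L,
  [/\ ks t.1.1 = ks t.2, tdom t.2 y & tact S t.1.1 t.1.2 t.2 y = z].
Proof.
move=> [Ty [p [q [g e]]]] [Tz [p' [q' [g' e']]]].
have E : exists h, pshift (p + q') z = act_path S h (pshift (p' + q) y).
  have h1 : pshift (p' + p) x =
      act_path S (ss_res S g (pshift q y 0 p')) (pshift (p' + q) y).
    by rewrite -(shiftD p' p) e act_path_shift shiftD.
  have h2 : pshift (p' + p) x =
      act_path S (ss_res S g' (pshift q' z 0 p)) (pshift (p + q') z).
    by rewrite [p' + p]addrC -(shiftD p p') e' act_path_shift shiftD.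
  exists ((ss_res S g' (pshift q' z 0 p))^-1 * ss_res S g (pshift q y 0 p'))%g.
  by rewrite -act_path_mul -h1 h2 act_pathK.
have [h E1] := E; exists (z 0 (p + q'), h, y 0 (p' + q)) => /=; split.
- rewrite !ipath_0s; have := congr1 (fun w : infpath L => w 0 0) E1.
  by rewrite act_path_v// !shift_r.
- by rewrite /tdom ipath_d.
- by rewrite /tact ipath_d -E1 prepend_shift.
Qed.

Lemma ex_orbit_at v : T v -> exists2 y, orb y & y 0 0 = v.
Proof.
move=> Tv; have vv := tail_vertex Tmax Tv.
have [m [l [_ rl sl]]] : exists m l, [/\ graphT T l, kr l = v & ks l = x m 0].
  by apply: xcof => //; rewrite /graphT /= vertex_sE.
exists (prepend l (pshift m x)); last by rewrite prepend_r// shift_r.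
by apply: orbit_prepend; [rewrite shift_r|apply: orbit_shift; exact: orbit_refl].
Qed.

Lemma orbit_dense l : T (ks l) -> exists2 y, orb y & y 0 (kd l) = l.
Proof.
move=> Tl; have [y oy y0] := ex_orbit_at Tl.
exists (prepend l y); first exact: orbit_prepend.
by rewrite prepend_init.
Qed.

Lemma orbit_countable : countable [set: G] -> countable orb.
Proof.
move=> /countable_injP[f hf].
have fI g h : f g = f h -> g = h by move=> e; apply: hf; rewrite ?inE.
have hex y : exists t : L * G * L, orb y -> tact S t.1.1 t.1.2 t.2 x = y.
  have [oy|ny] := pselect (orb y); last by exists (x 0 0, 1%g, x 0 0).
  by have [t [_ _ e]] := orbit_connect orbit_refl oy; exists t.
have [F hF] := choice hex.
apply/countable_injP; exists (fun y => pickle ((F y).1.1, f (F y).1.2, (F y).2)).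
move=> y z; rewrite !inE => oy oz /(pcan_inj pickleK)[e1 /fI e2 e3].
by rewrite -(hF y oy) -(hF z oz) e1 e2 e3.
Qed.

End Orbit.

(** * Matrix coefficients and irreducibility of pi_{ft,x} *)

Section PathRep.
Context {R : realType} {k : nat} {L : kgraph k} {G : groupType}.
Variables (S : selfsim L G) (A : cstarAlgType R) (s : L -> A) (u : G -> A).
Hypothesis L_row_finite : row_finite L.
Hypothesis fam : ssgraph_family S s u.
Hypothesis A1 : forall g (v : L), vertices v -> ss_act S g v = v.
Variables (T : set L) (x : infpath L) (ft : Zfun R k).
Hypotheses (Tmax : maximal_tail T) (Tx : paths_in (graphT T) x)
  (xcof : cofinal_in (graphT T) x) (ft_dual : dual setT ft).
Variables (H : hilbertType R) (e : infpath L -> H) (pi : A -> H -> H).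
Hypothesis prep : path_rep S s u T x ft e pi.
Local Notation orb := (orbit_class S T x).
Local Notation nm := (@cnorm R A).
Implicit Types (y : infpath L).

Lemma path_rep_onb : orthonormal_basis orb e. Proof. by case: prep. Qed.
Let onb := path_rep_onb.
Let rep : is_rep setT pi. Proof. by case: prep. Qed.

Lemma rep_eq0 a : (forall y, orb y -> pi a (e y) = 0) -> forall z, pi a z = 0.
Proof.
move=> h z; apply: inner_ext => w; rewrite inner0l -[a]starK (rep_adj rep).
rewrite (_ : pi (star a) w = 0) ?inner0r//; apply: (basis_inner_ext onb) => y oy.
by rewrite (rep_adj rep) h// inner0l inner0r.
Qed.

Lemma rep_s m y : orb y -> ks m = y 0 0 ->
  pi (s m) (e y) = ft (degdiff (kd m) 0) *: e (prepend m y).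
Proof. by case: prep => _ _ h _ _; exact: h. Qed.
Lemma rep_s0 m y : orb y -> ks m <> y 0 0 -> pi (s m) (e y) = 0.
Proof. by case: prep => _ _ _ h _; exact: h. Qed.
Lemma rep_u g y : orb y -> pi (u g) (e y) = e (act_path S g y).
Proof. by case: prep => _ _ _ _ h; exact: h. Qed.

Lemma rep_v v y : vertices v -> orb y -> y 0 0 = v -> pi (s v) (e y) = e y.
Proof.
move=> vv oy y0; rewrite rep_s//; last by rewrite vertex_sE.
by rewrite -y0 prepend_vertex ipath_d degdiffnn char0// scale1r.
Qed.

Lemma rep_v0 v y : vertices v -> orb y -> y 0 0 <> v -> pi (s v) (e y) = 0.
Proof. by move=> vv oy y0; rewrite rep_s0// vertex_sE// => /esym. Qed.

(** [is_rep] does not include unitality; [1] fixes [e y] because the vertex projection at the range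
    of [y] does. *)
Lemma rep_one z : pi 1 z = z.
Proof.
apply: (basis_inner_ext onb) => y oy; rewrite -[in LHS]star1 (rep_adj rep).
have vv : vertices (y 0 0) by exact: ipath_vertex.
by rewrite -{1}(rep_v vv oy erefl) -(repM rep) mul1r rep_v.
Qed.

Lemma rep_le a z : hn (pi a z) <= nm a * hn z.
Proof. exact: rep_contract rep_one _ _. Qed.

Lemma rep_sstar m y : orb y -> tdom m y ->
  pi (star (s m)) (e y) = ((ft (degdiff (kd m) 0))^*)%C *: e (pshift (kd m) y).
Proof.
move=> oy hd; set w := pshift (kd m) y; have ow : orb w by exact: orbit_shift.
have hw : ks m = w 0 0 by rewrite shift_r -ipath_0s hd.
have ey : y = prepend m w by rewrite -{1}hd prepend_shift.
set c := ft _; have cc : (c^*)%C * c = 1 by rewrite mulrC unimodular_conj//; exact: char_cn.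
have -> : e y = (c^*)%C *: pi (s m) (e w).
  by rewrite rep_s// -/c -ey scalerA cc scale1r.
rewrite (repxZ rep) -(repM rep) (ck_starl fam) rep_v//.
exact: vertex_s.
Qed.

(** The vector [e y] is in the range of the isometry of another path [m'] of the same degree, so
    [ck_orth] applies. *)
Lemma rep_sstar0 m y : orb y -> ~ tdom m y -> pi (star (s m)) (e y) = 0.
Proof.
move=> oy hd; pose m' := y 0 (kd m).
have dm' : kd m' = kd m by rewrite ipath_d.
set w := pshift (kd m) y; have ow : orb w by exact: orbit_shift.
have hw : ks m' = w 0 0 by rewrite shift_r -ipath_0s.
have ey : y = prepend m' w by rewrite prepend_shift.
set c := ft (degdiff (kd m') 0).
have cc : (c^*)%C * c = 1 by rewrite mulrC unimodular_conj//; exact: char_cn.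
have -> : e y = (c^*)%C *: pi (s m') (e w).
  by rewrite rep_s// -/c -ey scalerA cc scale1r.
rewrite (repxZ rep) -(repM rep) (ck_orth L_row_finite fam)//; last exact/nesym.
by rewrite (rep0 rep) scaler0.
Qed.

Lemma rep_gen t y : valid t -> orb y -> tdom t.2 y -> pi (gen s u t) (e y) =
  ft (degdiff (kd t.1.1) (kd t.2)) *: e (tact S t.1.1 t.1.2 t.2 y).
Proof.
case: t => [[m g] n] /= hs oy hd; rewrite /gen /= !(repM rep) rep_sstar//.
have ow : orb (pshift (kd n) y) by exact: orbit_shift.
rewrite !(repxZ rep) rep_u// rep_s; last 2 first.
- exact: orbit_act.
- exact: tact_compat.
by rewrite scalerA mulrC -char_diff.
Qed.

Lemma rep_gen0 t y : orb y -> ~ tdom t.2 y -> pi (gen s u t) (e y) = 0.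
Proof. by move=> oy hd; rewrite /gen !(repM rep) rep_sstar0// !(repx0 rep). Qed.

Lemma rep_ker_vertex v : vertices v ->
  (forall z, pi (s v) z = 0) <-> ~ T v.
Proof.
move=> vv; split=> [h Tv|nTv].
  have [y oy y0] := ex_orbit_at S Tmax Tx xcof Tv.
  by apply: (basis_nz onb oy); rewrite -(rep_v vv oy y0) h.
apply: rep_eq0 => y oy; apply: rep_v0 => // y0; apply: nTv; rewrite -y0.
by have /paths_inP := orbit_in oy; apply.
Qed.

Lemma rep_connect y z : orb y -> orb z -> exists t (c : R[i]),
  valid t /\ pi (c *: gen s u t) (e y) = e z.
Proof.
move=> oy oz; have [t [ht hd ez]] := orbit_connect A1 oy oz.
exists t, ((ft (degdiff (kd t.1.1) (kd t.2)))^*)%C; split=> //.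
rewrite (repZ rep) rep_gen// ez scalerA mulrC unimodular_conj ?scale1r//.
exact: char_cn.
Qed.

(* The range projections of the initial segments of y converge strongly to the
   projection onto the line of e y. *)
Lemma rep_cutdown y w : orb y -> forall d : R, 0 < d -> exists N,
  hn (pi (s (y 0 N) * star (s (y 0 N))) w - inner w (e y) *: e y) <= d.
Proof.
move=> oy d d0; pose P N := s (y 0 N) * star (s (y 0 N)).
pose V := [set w | exists N, forall M, leN N M -> pi (P M) w = inner w (e y) *: e y].
have sV : subspace_set V.
  split=> [|c a b [N hN] [N' hN']].
    by exists 0 => M _; rewrite (repx0 rep) inner0l scale0r.
  exists (maxN N N') => M NM; rewrite (rep_lin rep) innerDl innerZl scalerDl -scalerA.
  by rewrite hN ?hN'//; apply: leN_trans NM; [exact: leN_maxr|exact: leN_maxl].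
have eV z : orb z -> V (e z).
  move=> oz; have [->|zy] := pselect (z = y).
    exists 0 => M _; rewrite /P (repM rep) rep_sstar//; last by rewrite /tdom ipath_d.
    rewrite (repxZ rep) rep_s ?ipath_d; last 2 first.
    - exact: orbit_shift.
    - by rewrite shift_r ipath_0s.
    rewrite scalerA mulrC unimodular_conj; last exact: char_cn.
    by rewrite prepend_shift; case: onb => ->.
  have [N hN] := ipath_neq zy; exists N => M NM; case: (onb) => _ -> // _.
  rewrite scale0r /P (repM rep) rep_sstar0// ?(repx0 rep)//.
  by rewrite /tdom ipath_d => /(ipath_eq_le NM).
have [w' [N hN] ww'] := dense_approx onb sV eV w (divr_gt0 d0 (ltr0Sn R 1)).
exists N; rewrite -[w](subrK w') (repxD rep) innerDl scalerDl (hN N (leNn N)).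
rewrite opprD addrACA subrr addr0; apply: le_trans (hnD _ _) _.
rewrite [d]splitr hnN lerD//.
  apply: le_trans (rep_le _ _) _; apply: le_trans (ltW ww').
  rewrite -[leRHS]mul1r ler_wpM2r ?hn_ge0//; apply: proj_nm.
  exact: (ck_range_proj fam).
rewrite hnZ (basis_one onb)// mulr1; apply: le_trans (cauchy_schwarz _ _) _.
by rewrite (basis_one onb)// mulr1 ltW.
Qed.

(** A nonzero vector of an invariant closed subspace has a nonzero coefficient at some [e y];
    [rep_cutdown] puts [e y] into the subspace and [rep_connect] the remaining basis vectors. *)
Lemma path_rep_irreducible : irreducible_rep (OGL S s u) pi.
Proof.
have rB : is_rep (OGL S s u) pi.
  case: rep => h1 h2 h3 h4; split=> [a _|c a b z _ _|a b z _ _|a z z' _].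
  - exact: h1.
  - exact: h2.
  - exact: h3.
  - exact: h4.
have T0 : T (x 0 0) by move/paths_inP: Tx; apply.
have vx : vertices (x 0 0) by exact: ipath_vertex.
have ox := orbit_refl S Tx.
split=> //.
  exists (s (x 0 0)), (e x); split; first exact: (OGL_vertex fam A1).
  by rewrite rep_v//; exact: (basis_nz onb).
move=> V [V0 sV] cV hV.
have [hz|[v [Vv v0]]] : (forall v, V v -> v = 0) \/ exists v, V v /\ v <> 0.
- have [h|h] := pselect (exists v, V v /\ v <> 0); first by right.
  by left => v Vv; apply: contrapT => v0; apply: h; exists v.
- by left; apply/seteqP; split=> z //=; [exact: hz|move=> ->].
right; have [y [oy hy]] : exists y, orb y /\ inner v (e y) <> 0 :> R[i].
  apply: contrapT => h; apply: v0; apply: (basis_inner_ext onb) => y oy.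
  by rewrite inner0l; apply: contrapT => h'; apply: h; exists y.
have Vey : V (inner v (e y) *: e y).
  apply: cV; apply/closure_hnP => d d0.
  have [|N hN] := rep_cutdown v oy (d := d / 2); first by rewrite divr_gt0.
  exists (pi (s (y 0 N) * star (s (y 0 N))) v).
    apply: hV => //; have := OGL_gen s u A1 (t := (y 0 N, 1%g, y 0 N)) erefl.
    by rewrite /gen /= (u1 fam) mulr1.
  by rewrite hn_sub; apply: le_lt_trans hN _; rewrite ltr_pdivrMr// ltr_pMr// ltr1n.
have VZ c z : V z -> V (c *: z) by move=> Vz; rewrite -[c *: z]addr0; exact: sV.
have Ve : V (e y).
  have := VZ (inner v (e y))^-1 _ Vey.
  by rewrite scalerA mulVf ?scale1r//; exact/eqP.
apply: (dense_ind onb) => // z oz.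
have [t [c [ht <-]]] := rep_connect oy oz.
apply: hV => //; apply: (subspaceZ _ (OGL_subspace S s u)).
exact: OGL_gen.
Qed.

(** The inner product of the images of [e y] under two generators. It depends on [y] only through
    [coincide] and on the character only at one degree difference. *)
Definition gram_coef (f : Zfun R k) (y : infpath L) (t t' : L * G * L) : R[i] :=
  if pselect (coincide S t t' y) then f (tdeg t - tdeg t') else 0.

Lemma rep_gen_inner t t' y : valid t -> valid t' -> orb y ->
  inner (pi (gen s u t) (e y)) (pi (gen s u t') (e y)) = gram_coef ft y t t'.
Proof.
move=> ht ht' oy; rewrite /gram_coef.
have [d|d] := pselect (tdom t.2 y); last first.
  by rewrite rep_gen0// inner0l; case: pselect => // -[].
have [d'|d'] := pselect (tdom t'.2 y); last first.
  by rewrite [pi (gen s u t') _]rep_gen0// inner0r; case: pselect => // -[].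
rewrite rep_gen// rep_gen// innerZl innerZr; case: (onb) => h1 h2 _.
have o1 := orbit_tact A1 Tmax t.1.2 ht d oy.
have o2 := orbit_tact A1 Tmax t'.1.2 ht' d' oy.
case: pselect => [c|nc] /=.
  by have [_ _ ->] := c; rewrite h1// mulr1 -charN// -charD//.
by rewrite h2 ?mulr0// => e0; apply: nc.
Qed.

Lemma rep_sum_norm (r : seq (R[i] * (L * G * L))) y :
  (forall i, i \in r -> valid i.2) -> orb y ->
  (hn (pi (\sum_(i <- r) i.1 *: gen s u i.2) (e y)) ^+ 2)%:C =
  \sum_(i <- r) \sum_(j <- r) i.1 * (j.1^*)%C * gram_coef ft y i.2 j.2.
Proof.
move=> hr oy.
rewrite -inner_hn !(rep_sum rep) inner_suml [LHS]big_seq [RHS]big_seq.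
apply: eq_bigr => i ir.
rewrite inner_sumr [LHS]big_seq [RHS]big_seq; apply: eq_bigr => j jr.
rewrite !(repZ rep) innerZl innerZr rep_gen_inner//; [by rewrite mulrA|exact: hr|exact: hr].
Qed.

End PathRep.

(** * Comparison of the orbits of one tail *)

Section OrbitCard.
Context {k : nat} {L : kgraph k} {G : groupType} (S : selfsim L G).
Hypothesis A1 : forall g (v : L), vertices v -> ss_act S g v = v.
Hypothesis G_countable : countable [set: G].
Variable T : set L.
Hypothesis Tmax : maximal_tail T.
Implicit Types (x y z : infpath L).
Local Notation orb := (orbit_class S T).

Lemma orbit_sub x z : paths_in (graphT T) x -> orb x z -> orb x `<=` orb z.
Proof.
move=> Tx oz y oy; have [t [ht hd <-]] := orbit_connect A1 oz oy.
by apply: orbit_tact => //; apply: orbit_refl; case: oz.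
Qed.

Lemma orbit_eq x z : paths_in (graphT T) x -> orb x z -> orb x = orb z.
Proof.
move=> Tx oz; apply/seteqP; split; first exact: orbit_sub.
move=> y oy; have oxz : orb z x.
  by apply: (orbit_sub Tx oz); exact: orbit_refl.
by apply: (@orbit_sub z x) => //; case: oz.
Qed.

(** If [z] were outside a finite orbit, one initial segment of [z] would separate it from all
    members, against density of the orbit. *)
Lemma orbit_finite_mem x z : paths_in (graphT T) x -> cofinal_in (graphT T) x ->
  paths_in (graphT T) z -> finite_set (orb x) -> orb x z.
Proof.
move=> Tx cx Tz /finite_seqP[r er]; apply: contrapT => nz.
have [N hN] : exists N, forall y, y \in r -> y 0 N <> z 0 N.
  have : forall y, y \in r -> y <> z.
    by move=> y yr yz; apply: nz; rewrite er /= -yz.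
  elim: r {er} => [|y r IH] h; first by exists 0.
  have [|N hN] := IH; first by move=> w wr; apply: h; rewrite inE wr orbT.
  have [M hM] : exists M, y 0 M <> z 0 M.
    apply: contrapT => hn; apply: (h y); first by rewrite inE eqxx.
    by apply: ipath_eq => M; apply: contrapT => hM; apply: hn; exists M.
  exists (maxN M N) => w; rewrite inE => /predU1P[->|wr] e.
    by apply: hM; apply: ipath_eq_le e; exact: leN_maxl.
  by apply: (hN w wr); apply: ipath_eq_le e; exact: leN_maxr.
have Tl : T (ks (z 0 N)) by rewrite ipath_0s; move/paths_inP: Tz; apply.
have [y oy] := orbit_dense S Tmax Tx cx Tl.
by rewrite ipath_d => ey; apply: (hN y) => //; move: oy; rewrite er.
Qed.

(* If some cofinal path has a finite orbit, that orbit contains all paths of the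
   tail; otherwise all orbits of cofinal paths are countably infinite. *)
Lemma orbit_transport x z : paths_in (graphT T) x -> cofinal_in (graphT T) x ->
  paths_in (graphT T) z -> cofinal_in (graphT T) z ->
  exists phi : infpath L -> infpath L, [/\ forall y, orb z y -> orb x (phi y),
    forall y y', orb z y -> orb z y' -> phi y = phi y' -> y = y' &
    forall w, orb x w -> exists2 y, orb z y & phi y = w].
Proof.
move=> Tx cx Tz cz.
have triv : orb x = orb z ->
  exists phi : infpath L -> infpath L, [/\ forall y, orb z y -> orb x (phi y),
    forall y y', orb z y -> orb z y' -> phi y = phi y' -> y = y' &
    forall w, orb x w -> exists2 y, orb z y & phi y = w].
  by move=> ->; exists id; split=> // w; exists w.
have [fx|ifx] := pselect (finite_set (orb x)).
  by apply: triv; apply: orbit_eq => //; exact: orbit_finite_mem.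
have [fz|ifz] := pselect (finite_set (orb z)).
  by apply/triv/esym; apply: orbit_eq => //; exact: orbit_finite_mem.
have /card_set_bijP[f [_ fI fS]] := eq_card_nat (orbit_countable A1 Tx G_countable) ifx.
have /card_set_bijP[h [_ hI hS]] := eq_card_nat (orbit_countable A1 Tz G_countable) ifz.
have ex y : exists w, orb x w /\ f w = h y.
  by have [w ow e] := fS (h y) I; exists w.
have [phi hphi] := choice ex.
exists phi; split=> [y _|y y' oy oy' e|w ow]; first by case: (hphi y).
  apply: hI; rewrite ?inE//.
  by have [_ <-] := hphi y; have [_ <-] := hphi y'; rewrite e.
have [y oy e] := hS (f w) I; exists y => //.
by have [op ep] := hphi y; apply: fI; rewrite ?inE// ep.
Qed.

End OrbitCard.

(** * Existence of the representation at a given path *)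

Section RepExistence.
Context {R : realType} {k : nat} {L : kgraph k} {G : groupType}.
Variables (S : selfsim L G) (A : cstarAlgType R) (s : L -> A) (u : G -> A).
Hypothesis L_row_finite : row_finite L.
Hypothesis G_countable : countable [set: G].
Hypothesis univ : universal_family S s u.
Hypothesis A1 : forall g (v : L), vertices v -> ss_act S g v = v.
Variables (T : set L) (x : infpath L) (ft : Zfun R k).
Hypotheses (Tmax : maximal_tail T) (Tx : paths_in (graphT T) x) (ft_dual : dual setT ft).
Local Notation orb := (orbit_class S T x).

Section OnBasis.
Variables (H : hilbertType R) (e : infpath L -> H).
Hypothesis onb : orthonormal_basis orb e.

Let nz : exists h : H, h <> 0.
Proof.
exists (e x) => e0; case: onb => h _ _.
have := h x (orbit_refl S Tx); rewrite e0 inner0l => /eqP.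
by rewrite eq_sym oner_eq0.
Qed.
Local Notation B := (bopn nz).

Let s_spec (m : L) (b : bop H) := forall y, orb y ->
  (ks m = y 0 0 -> b (e y) = ft (degdiff (kd m) 0) *: e (prepend m y)) /\
  (ks m <> y 0 0 -> b (e y) = 0).

Let ex_s m : exists b, s_spec m b.
Proof.
apply: (ex_basis_bop (c := fun=> ft (degdiff (kd m) 0))
  (orbit_countable A1 Tx G_countable) onb).
- by move=> y oy h; exact: orbit_prepend.
- by move=> y z oy oz hy hz /prepend_inj[].
- by move=> _; rewrite char_cn.
Qed.

Let ex_u g : exists b : bop H, forall y, orb y ->
  (True -> b (e y) = 1 *: e (act_path S g y)) /\ (~ True -> b (e y) = 0).
Proof.
apply: (ex_basis_bop (P := setT) (c := fun=> 1)
  (orbit_countable A1 Tx G_countable) onb).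
- by move=> y oy h; exact: orbit_act.
- by move=> y z _ _ _ _ /(congr1 (act_path S g^-1%g)); rewrite !act_pathK.
- by move=> _; rewrite cn1.
Qed.

(** Prepending and the group act on the orbit by partial injections, hence by operators on the
    basis. These satisfy the defining relations in B(H), and the universal property extends them to
    [A]. *)
Lemma ex_path_rep : exists pi, path_rep S s u T x ft e pi.
Proof.
have [s' hs'] := choice ex_s; have [u' hu'] := choice ex_u.
have sE m y : orb y -> ks m = y 0 0 ->
    s' m (e y) = ft (degdiff (kd m) 0) *: e (prepend m y).
  by move=> /(hs' m)[].
have s0 m y : orb y -> ks m <> y 0 0 -> s' m (e y) = 0 by move=> /(hs' m)[].
have uE g y : orb y -> u' g (e y) = e (act_path S g y).
  by move=> /(hu' g)[/(_ I) -> _]; rewrite scale1r.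
have oI m : forall y z, orb y -> orb z -> ks m = y 0 0 -> ks m = z 0 0 ->
  prepend m y = prepend m z -> y = z.
  by move=> y z _ _ hy hz /prepend_inj[].
have oP m : forall y, orb y -> ks m = y 0 0 -> orb (prepend m y).
  by move=> y oy h; exact: orbit_prepend.
have ssE m y : orb y -> ks m = y 0 0 -> badj (s' m) (e (prepend m y)) =
    ((ft (degdiff (kd m) 0))^*)%C *: e y.
  by move=> oy hy; exact: (basis_adj onb (hs' m) (@oP m) (@oI m) oy hy).
have ss0 m z : orb z -> ~ tdom m z -> badj (s' m) (e z) = 0.
  move=> oz hz; apply: (basis_adj0 onb (hs' m) (@oP m) oz).
  by move=> y oy hy ez; apply: hz; rewrite -ez; exact: prepend_init.
have usE g y : orb y -> badj (u' g) (e y) = e (act_path S g^-1%g y).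
  move=> oy; have oy' : orb (act_path S g^-1%g y) by exact: orbit_act.
  have := basis_adj onb (P := setT) (c := fun=> 1) (hu' g) _ _ oy' I.
  rewrite act_pathVK conjc1 scale1r; apply.
    by move=> z oz _; exact: orbit_act.
  by move=> z w _ _ _ _ /(congr1 (act_path S g^-1%g)); rewrite !act_pathK.
have ftJ m : ft (degdiff (kd m) 0) * ((ft (degdiff (kd m) 0))^*)%C = 1.
  by rewrite unimodular_conj// char_cn.
have ftJ' m : ((ft (degdiff (kd m) 0))^*)%C * ft (degdiff (kd m) 0) = 1.
  by rewrite mulrC.
have sv v y : vertices v -> orb y -> y 0 0 = v -> s' v (e y) = e y.
  move=> vv oy yv; rewrite sE ?vertex_sE// vv degdiffnn (char0 ft_dual) scale1r.
  by rewrite -yv prepend_vertex.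
have sv0 v y : vertices v -> orb y -> y 0 0 <> v -> s' v (e y) = 0.
  by move=> vv oy yv; rewrite s0// vertex_sE// => /esym.
have sse m y : orb y -> (tdom m y -> s' m (badj (s' m) (e y)) = e y) /\
    (~ tdom m y -> s' m (badj (s' m) (e y)) = 0).
  move=> oy; split=> [hd|hd].
    have [w hw ey] := prependE hd.
    have ow : orb w.
      have -> : w = pshift (kd m) y by rewrite ey shift_prepend.
      exact: orbit_shift.
    by rewrite ey ssE// bopZ sE// scalerA ftJ' scale1r.
  rewrite ss0//; have := bop_sub (s' m) 0 0; rewrite subrr => ->.
  by rewrite subrr.
have sse' m y : orb y -> ks m = y 0 0 -> badj (s' m) (s' m (e y)) = e y.
  move=> oy hy; rewrite sE//.
  have := bopZ (bstar (s' m)); rewrite /= => ->.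
  by rewrite ssE// scalerA ftJ scale1r.
have b0 (f : bop H) : f 0 = 0 by have := bop_sub f 0 0; rewrite !subrr.
have ba0 (f : bop H) : badj f 0 = 0 by exact: (b0 (bstar f)).
have fam : ssgraph_family S (s' : L -> B) (u' : G -> B).
  split; first split.
  - move=> m; apply: (basis_bop_ext onb) => y oy /=.
    have [hy|hy] := pselect (ks m = y 0 0); first by rewrite sse'.
    by rewrite s0// ba0 b0.
  - split=> [v vv|v w vv vw vw'].
      split; apply: (basis_bop_ext onb) => y oy /=; last first.
        have [yv|yv] := pselect (y 0 0 = v); first by rewrite !sv.
        by rewrite sv0// b0.
      have [yv|yv] := pselect (y 0 0 = v).
        rewrite sv//; have hy : ks v = y 0 0 by rewrite vertex_sE.
        have := ssE v y oy hy; rewrite vv degdiffnn (char0 ft_dual) conjc1 scale1r.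
        by rewrite (_ : prepend v y = y)// -yv prepend_vertex.
      by rewrite ss0 ?sv0// /tdom vv.
    apply: (basis_bop_ext onb) => y oy /=.
    have [yw|yw] := pselect (y 0 0 = w); last by rewrite [s' w _]sv0// b0.
    by rewrite [s' w _]sv// sv0// yw => /esym.
  - move=> m n hmn; apply: (basis_bop_ext onb) => y oy /=.
    have [hy|hy] := pselect (ks n = y 0 0); last first.
      by rewrite s0 ?ks_comp// (s0 n)// b0.
    rewrite sE ?ks_comp// (sE n)// bopZ sE//; last 2 first.
    - exact: oP.
    - by rewrite prepend_r.
    rewrite scalerA prepend_comp// -(charD ft_dual) -degdiffD addr0 kd_comp//.
    by rewrite addrC.
  - move=> m; apply: (basis_bop_ext onb) => y oy /=.
    have [hy|hy] := pselect (ks m = y 0 0).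
      by rewrite sse'// sv//; exact: vertex_s.
    by rewrite s0// ba0 sv0//; [exact: vertex_s|exact/nesym].
  - move=> v p vv; rewrite fsbig_finite/=; last exact: L_row_finite.
    apply: (basis_bop_ext onb) => y oy; rewrite bop_sum /=.
    have [yv|yv] := pselect (y 0 0 = v); last first.
      rewrite sv0// big_seq big1// => m /(mem_vpaths L_row_finite _ _ vv)[rm _].
      have [_ ->//] := sse m y oy.
      by move=> hd; apply: yv; rewrite -rm -hd ipath_r.
    rewrite sv// (bigD1_seq (y 0 p)) ?vpaths_uniq//=; last first.
      by apply/(mem_vpaths L_row_finite _ _ vv); rewrite ipath_r ipath_d.
    rewrite big_seq_cond big1 ?addr0.
      by have [->] := sse (y 0 p) y oy; rewrite // /tdom ipath_d.
    move=> m /andP[/(mem_vpaths L_row_finite _ _ vv)[rm dm] /eqP mp].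
    have [_ ->//] := sse m y oy.
    by rewrite /tdom dm => /esym.
  - move=> g; split; apply: (basis_bop_ext onb) => y oy /=.
      by rewrite uE// usE ?act_pathK//; exact: orbit_act.
    by rewrite usE// uE ?act_pathVK//; exact: orbit_act.
  - move=> g h; apply: (basis_bop_ext onb) => y oy /=.
    by rewrite !uE ?act_path_mul//; exact: orbit_act.
  - move=> g m; apply: (basis_bop_ext onb) => y oy /=.
    rewrite [u' (ss_res _ _ _) _]uE//.
    have [hy|hy] := pselect (ks m = y 0 0); last first.
      by rewrite s0// b0 s0 ?act_s ?act_path_v//; exact: orbit_act.
    rewrite sE// bopZ uE; last exact: oP.
    rewrite sE ?ss_act_d ?act_path_prepend//; first exact: orbit_act.
    by rewrite act_s// act_path_v.
have [_ _ /(_ B _ _ fam)[phi [h1 h2 h3]]] := univ.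
exists (fun a z => (phi a : bop H) z); split=> //.
- exact: bop_rep.
- by move=> m y oy hy; rewrite h2 sE.
- by move=> m y oy hy; rewrite h2 s0.
- by move=> g y oy; rewrite h3 uE.
Qed.

End OnBasis.

(** The Hilbert space of the orbit of [x0] is reused: [orbit_transport] relabels its basis by the
    orbit of [x]. *)
Lemma ex_path_rep_any (x0 : infpath L) (H : hilbertType R) (e0 : infpath L -> H) :
  cofinal_in (graphT T) x -> paths_in (graphT T) x0 -> cofinal_in (graphT T) x0 ->
  orthonormal_basis (orbit_class S T x0) e0 ->
  exists (e : infpath L -> H) pi, path_rep S s u T x ft e pi.
Proof.
move=> cx Tx0 cx0 onb0.
have [phi [h1 h2 h3]] := orbit_transport A1 G_countable Tmax Tx0 cx0 Tx cx.
exists (e0 \o phi); apply: ex_path_rep; case: onb0 => e1 eo ed; split=> [y oy|y z oy oz yz|].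
- by apply: e1; exact: h1.
- by apply: eo; [exact: h1|exact: h1|move=> e; apply: yz; exact: h2].
rewrite -ed; congr (closure (span_set _)); apply/seteqP; split=> [_ [y oy <-]|_ [w ow <-]].
  by exists (phi y) => //; exact: h1.
by have [y oy ey] := h3 w ow; exists y => //=; rewrite ey.
Qed.

End RepExistence.

(** * Separating characters *)

Section SquareRoot.
Context {R : realType}.

Lemma eventually_lt_2div (e : R) : 0 < e ->
  exists N : nat, forall n, (N <= n)%N -> 2 / n.+2%:R < e.
Proof.
move=> e0; exists (Num.truncn (2 / e)).+1 => n Nn.
rewrite ltr_pdivrMr ?ltr0n// -ltr_pdivrMl// mulrC.
apply: lt_le_trans (truncnS_gt _) _; rewrite ler_nat.
by apply: leq_trans Nn _; rewrite -addn2 leq_addr.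
Qed.

(* Iteration of y |-> (w + y^2) / 2 from 0, whose fixed point is 1 - sqrt (1 - w). *)
Fixpoint sqrt_iter (w : R) n := if n is n'.+1 then (w + sqrt_iter w n' ^+ 2) / 2 else 0.

(** With q = sqrt (1 - w), the error d becomes d (1 - q - d / 2) <= d (1 - d / 2). On [0, 1] this
    bound increases with d, so 2 / (n + 2) is carried to 2 / (n + 3), uniformly in [w]. *)
Lemma sqrt_iter_bound (w : R) n : 0 <= w <= 1 ->
  [/\ 0 <= sqrt_iter w n, sqrt_iter w n <= 1 - Num.sqrt (1 - w) &
   1 - Num.sqrt (1 - w) - sqrt_iter w n <= 2 / n.+2%:R].
Proof.
move=> /andP[w0 w1]; set q := Num.sqrt (1 - w).
have q0 : 0 <= q by exact: sqrtr_ge0.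
have qq : q ^+ 2 = 1 - w by rewrite sqr_sqrtr// subr_ge0.
have q1 : q <= 1 by rewrite -(@expr_le1 _ 2)// qq; lra.
elim: n => [|n [h1 h2 h3]] /=.
  by split; [exact: lexx|lra|rewrite divff ?pnatr_eq0//; lra].
set y := sqrt_iter w n in h1 h2 h3 *; set d := 1 - q - y in h3 *.
have d0 : 0 <= d by rewrite /d; lra.
have ed : 1 - q - (w + y ^+ 2) / 2 = d * (1 - q - d / 2).
  have -> : w = 1 - q ^+ 2 by rewrite qq; ring.
  by rewrite /d; field.
split; first by rewrite divr_ge0// addr_ge0// sqr_ge0.
  rewrite -subr_ge0 ed mulr_ge0//; rewrite /d; lra.
rewrite ed; apply: (@le_trans _ _ (d * (1 - d / 2))).
  by rewrite ler_wpM2l//; lra.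
have N0 : 0 < n.+2%:R :> R by rewrite ltr0n.
have N1 : 0 < n.+3%:R :> R by rewrite ltr0n.
have d1 : d <= 1 by rewrite /d; lra.
set t := 2 / n.+2%:R in h3.
have t1 : t <= 1 by rewrite /t ler_pdivrMr// mul1r ler_nat.
apply: (@le_trans _ _ (t * (1 - t / 2))); first by nra.
have -> : t * (1 - t / 2) = 2 * (n.+2%:R - 1) / n.+2%:R ^+ 2.
  rewrite /t; move: (n.+2%:R : R) N0 => N N0; field; by rewrite gt_eqF.
have e3 : n.+3%:R = n.+2%:R + 1 :> R by rewrite -natr1.
rewrite e3 ler_pdivrMr ?exprn_gt0// mulrAC ler_pdivlMr; last by rewrite -e3.
set N := n.+2%:R in N0 *; nra.
Qed.

(** For x = Re z >= 0 and |z| = 1, 1 - Re (z^2) = 2 (1 - x) (1 + x) >= 2 (1 - x). Each squaring thus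
    halves the bound on 1 - Re z, and |1 - z|^2 = 2 (1 - Re z). *)
Lemma near_one_of_powers (z : R[i]) (r : nat) : cn z = 1 ->
  (forall j, (j <= r)%N -> 0 < complex.Re (z ^+ (2 ^ j)%N)) ->
  cn (1 - z) ^+ 2 <= 2 * 2^-1 ^+ r.
Proof.
have ReP (w : R[i]) : cn w = 1 -> complex.Re (w ^+ 2) = 2 * complex.Re w ^+ 2 - 1.
  case: w => a b h; have : (a +i* b) * ((a +i* b)^*)%C = 1 by exact: unimodular_conj.
  simpc => -[h1 _]; rewrite expr2; simpc => /=; rewrite expr2; lra.
move=> z1 hz.
have Re1 (w : R[i]) : cn w = 1 -> complex.Re w <= 1 by move=> <-; exact: cn_Re.
have main : 1 - complex.Re z <= 2^-1 ^+ r.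
  elim: r z z1 hz => [|r IH] z z1 hz.
    by rewrite expr0; have := hz 0%N isT; rewrite expn0 expr1; lra.
  have z2 : cn (z ^+ 2) = 1 by rewrite expr2 cnM z1 mulr1.
  have := IH _ z2; rewrite ReP// => h.
  have {}h : 1 - (2 * complex.Re z ^+ 2 - 1) <= 2^-1 ^+ r.
    by apply: h => j jr; rewrite -exprM -expnS; exact: hz.
  have x0 := hz 0%N isT; rewrite expn0 expr1 in x0; have x1 := Re1 _ z1.
  rewrite exprS; nra.
have -> : cn (1 - z) ^+ 2 = 2 - 2 * complex.Re z.
  apply: complexI; rewrite -mulcJ; case: z z1 {hz main} => a b h.
  have : (a +i* b) * ((a +i* b)^*)%C = 1 by exact: unimodular_conj.
  simpc => -[h1 _] /=; congr (_ +i* _); [nra|ring].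
lra.
Qed.

End SquareRoot.

Section CstarRoot.
Context {R : realType} {A : cstarAlgType R}.
Local Notation nm := (@cnorm R A).

Fixpoint root_iter (W : A) n : A :=
  if n is n'.+1 then (2^-1 : R)%:C *: (W + root_iter W n' * root_iter W n') else 0.

(** The scalar iteration at [w = 1] majorizes the iterates and their increments; it increases to 1,
    so the increments are summable. *)
Lemma root_iter_nm (W : A) n : nm W <= 1 ->
  nm (root_iter W n) <= sqrt_iter 1 n /\
  nm (root_iter W n.+1 - root_iter W n) <= sqrt_iter 1 n.+1 - sqrt_iter 1 n.
Proof.
move=> W1; have half0 : 0 <= 2^-1 :> R by rewrite invr_ge0.
have b n' := @sqrt_iter_bound R 1 n' (introT andP (conj ler01 (lexx 1))).
elim: n => [|n [h1 h2]].
  by rewrite /= nm0 subr0 mulr0 addr0 nmZ cn_real ger0_norm//; split=> //; nra.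
set Y := root_iter W n in h1 h2 *; set Y' := root_iter W n.+1 in h2 *.
set y := sqrt_iter 1 n in h1 h2 *; set y' := sqrt_iter 1 n.+1 in h2 *.
have hY' : nm Y' <= y'.
  have := nm_tri Y Y' 0; rewrite !subr0; lra.
split=> //.
have -> : root_iter W n.+2 - Y' = (2^-1 : R)%:C *: (Y' * Y' - Y * Y).
  have eY : Y' = (2^-1 : R)%:C *: (W + Y * Y) by [].
  rewrite [root_iter W n.+2]/= -/Y' {3}eY -scalerBr; congr (_ *: _).
  by rewrite opprD addrACA subrr add0r.
have -> : sqrt_iter 1 n.+2 - y' = 2^-1 * (y' ^+ 2 - y ^+ 2).
  have ey : y' = (1 + y ^+ 2) / 2 by [].
  have -> : sqrt_iter 1 n.+2 = (1 + y' ^+ 2) / 2 by [].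
  by clearbody y y'; lra.
rewrite nmZ cn_real ger0_norm// ler_wpM2l//.
have -> : Y' * Y' - Y * Y = Y' * (Y' - Y) + (Y' - Y) * Y.
  by rewrite mulrBr mulrBl addrA subrK.
apply: le_trans (cnormD _ _) _.
have l1 : nm (Y' * (Y' - Y)) <= y' * (y' - y).
  by apply: le_trans (cnormM _ _) _; rewrite ler_pM ?nm_ge0.
have l2 : nm ((Y' - Y) * Y) <= (y' - y) * y.
  by apply: le_trans (cnormM _ _) _; rewrite ler_pM ?nm_ge0.
by nra.
Qed.

Lemma ex_root_limit (W : A) : nm W <= 1 ->
  exists Z, forall n, nm (root_iter W n - Z) <= 2 / n.+2%:R.
Proof.
move=> W1; have b n := @sqrt_iter_bound R 1 n (introT andP (conj ler01 (lexx 1))).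
have diff n l : nm (root_iter W (n + l) - root_iter W n) <= sqrt_iter 1 (n + l) - sqrt_iter 1 n.
  elim: l => [|l IH]; first by rewrite addn0 !subrr nm0.
  have [_ h] := root_iter_nm (n + l) W1; rewrite addnS.
  apply: le_trans (nm_tri (root_iter W (n + l)%N) _ _) _.
  by apply: le_trans (lerD h IH) _; rewrite addrA subrK.
have diff' n m : (n <= m)%N -> nm (root_iter W m - root_iter W n) <= 2 / n.+2%:R.
  move=> nm'; rewrite -(subnKC nm'); apply: le_trans (diff _ _) _.
  have [_ _ h1] := b n; have [_ h2 _] := b (n + (m - n))%N.
  by move: h1 h2; rewrite subrr sqrtr0 subr0 => h1 h2; apply: le_trans h1; rewrite lerD2r.
have [|Z hZ] := @cnorm_complete R A (root_iter W).
  move=> e e0; have [N hN] := eventually_lt_2div (divr_gt0 e0 (ltr0Sn R 1)).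
  exists N => i j Ni Nj; apply: le_lt_trans (nm_tri (root_iter W N) _ _) _.
  have hN' := hN N (leqnn N).
  have h1 := diff' N i Ni; have h2 := diff' N j Nj; rewrite nm_sub in h2.
  by apply: le_lt_trans (lerD h1 h2) _; rewrite [e]splitr ltrD.
exists Z => n; apply/ler_addgt0Pr => e e0; have [N hN] := hZ e e0.
apply: le_trans (nm_tri (root_iter W (maxn n N)) _ _) _.
rewrite lerD//; first by rewrite nm_sub; apply: diff'; exact: leq_maxl.
by apply/ltW/hN; exact: leq_maxr.
Qed.

End CstarRoot.

(** * Elements acting by scalars that depend on the character *)

Section Bump.
Context {R : realType} {k : nat} {L : kgraph k} {G : groupType}.
Variables (S : selfsim L G) (A : cstarAlgType R) (s : L -> A) (u : G -> A).
Hypothesis L_row_finite : row_finite L.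
Hypothesis G_countable : countable [set: G].
Hypothesis fam : ssgraph_family S s u.
Hypothesis A1 : forall g (v : L), vertices v -> ss_act S g v = v.
Variables (T0 : set L) (v : L).
Hypotheses (T0max : maximal_tail T0) (Hv : HT S T0 v).
Local Notation B := (OGL S s u).
Local Notation nm := (@cnorm R A).

(* h lies in the corner at v, and every pi_{ft,x} attached to T0 multiplies the
   paths with range v by the scalar c ft. *)
Definition acts (h : A) (c : Zfun R k -> R[i]) := B h /\
  forall (T : set L) (x : infpath L) (ft : Zfun R k) (H : hilbertType R)
    (e : infpath L -> H) (pi : A -> H -> H),
  maximal_tail T -> dual setT ft -> path_rep S s u T x ft e pi ->
  forall y, orbit_class S T x y ->
    (y 0 0 <> v -> pi h (e y) = 0) /\
    (T = T0 -> y 0 0 = v -> pi h (e y) = c ft *: e y).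

Let vv : vertices v.
Proof. by case: Hv => Tv _; exact: tail_vertex T0max Tv. Qed.

Lemma acts_vertex : acts (s v) (fun=> 1).
Proof.
split; first exact: (OGL_vertex fam A1).
move=> T x ft H e pi Tmax dft prep y oy; split=> [yv|_ yv].
  exact: (rep_v0 prep vv oy).
by rewrite scale1r; exact: (rep_v dft prep vv oy).
Qed.

Lemma acts_mul h h' c c' : acts h c -> acts h' c' ->
  acts (h * h') (fun ft => c ft * c' ft).
Proof.
move=> [Bh hh] [Bh' hh']; split; first exact: (OGL_mul L_row_finite fam A1).
move=> T x ft H e pi Tmax dft prep y oy; have rep : is_rep setT pi by case: prep.
have [a1 a2] := hh _ _ _ _ _ _ Tmax dft prep y oy.
have [b1 b2] := hh' _ _ _ _ _ _ Tmax dft prep y oy.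
split=> [yv|eT yv]; rewrite (repM rep); first by rewrite b1// (repx0 rep).
by rewrite b2// (repxZ rep) a2// scalerA mulrC.
Qed.

Lemma acts_lin (a : R[i]) h h' c c' : acts h c -> acts h' c' ->
  acts (a *: h + h') (fun ft => a * c ft + c' ft).
Proof.
move=> [Bh hh] [Bh' hh']; have [_ Bs] := OGL_subspace S s u.
split; first exact: Bs.
move=> T x ft H e pi Tmax dft prep y oy; have rep : is_rep setT pi by case: prep.
have [a1 a2] := hh _ _ _ _ _ _ Tmax dft prep y oy.
have [b1 b2] := hh' _ _ _ _ _ _ Tmax dft prep y oy.
split=> [yv|eT yv]; rewrite (rep_lin2 rep).
  by rewrite a1// b1// scaler0 addr0.
by rewrite a2// b2// scalerA scalerDl.
Qed.

Lemma acts_ext h c c' : (forall ft, dual setT ft -> c ft = c' ft) -> acts h c -> acts h c'.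
Proof.
move=> cc [Bh hh]; split=> // T x ft H e pi Tmax dft prep y oy.
by rewrite -cc//; exact: (hh _ _ _ _ _ _ Tmax dft prep y oy).
Qed.

Lemma acts0 : acts 0 (fun=> 0).
Proof.
have := acts_lin (-1) acts_vertex acts_vertex.
by rewrite scaleN1r addNr; apply: acts_ext => ft _; rewrite mulN1r addNr.
Qed.

Lemma acts_scale (a : R[i]) h c : acts h c -> acts (a *: h) (fun ft => a * c ft).
Proof.
move=> hc; have := acts_lin a hc acts0; rewrite addr0.
by apply: acts_ext => ft _; rewrite addr0.
Qed.

(** The rate 2 / (n + 2) is the one shared by [ex_root_limit] and [sqrt_iter_bound]. *)
Lemma acts_limit (Y : nat -> A) Z (c : nat -> Zfun R k -> R[i]) c' :
  (forall n, acts (Y n) (c n)) -> (forall n, nm (Y n - Z) <= 2 / n.+2%:R) ->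
  (forall ft, dual setT ft -> forall n, cn (c n ft - c' ft) <= 2 / n.+2%:R) ->
  acts Z c'.
Proof.
move=> hY hZ hc.
have small (d : R) : 0 < d -> exists n : nat, 2 / n.+2%:R < d.
  by move=> /eventually_lt_2div[N hN]; exists N; exact: hN.
split.
  apply: (OGL_closed (S := S) (s := s) (u := u)) => d d0.
  have [n hn] := small d d0; exists (Y n); first by case: (hY n).
  by rewrite nm_sub; apply: le_lt_trans (hZ n) _.
move=> T x ft H e pi Tmax dft prep y oy; have rep : is_rep setT pi by case: prep.
have app n : hn (pi Z (e y) - pi (Y n) (e y)) <= 2 / n.+2%:R.
  rewrite -(repN rep) -(repD rep); apply: le_trans (rep_le dft prep _ _) _.
  by rewrite (basis_one (path_rep_onb prep) oy) mulr1 nm_sub.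
split=> [yv|eT yv].
  apply: hn_le0 => d d0; have [n hn'] := small d d0.
  have [b1 _] := (hY n).2 _ _ _ _ _ _ Tmax dft prep y oy.
  have := app n; rewrite b1// subr0 => h1; apply: le_trans h1 _; exact: ltW.
apply/eqP; rewrite -subr_eq0; apply/eqP; apply: hn_le0 => d d0.
have [n hn'] := small (d / 2) (divr_gt0 d0 (ltr0Sn R 1)).
have [_ b2] := (hY n).2 _ _ _ _ _ _ Tmax dft prep y oy.
apply: le_trans (hn_tri (pi (Y n) (e y)) _ _) _; rewrite [d]splitr lerD//.
  by apply: le_trans (app n) _; exact: ltW.
rewrite b2// -scalerBl hnZ (basis_one (path_rep_onb prep) oy) mulr1.
by apply: le_trans (hc _ dft n) _; exact: ltW.
Qed.

Section Translation.
Variables (p q : Nk k).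
Hypothesis Ppq : Per S (graphT T0) (degdiff p q).

Lemma ex_partner : exists nu : L -> L, forall m, kr m = v -> kd m = p -> T0 (ks m) ->
  [/\ kr (nu m) = v, kd (nu m) = q & cyc S T0 m (nu m)].
Proof.
have h m : exists n, kr m = v -> kd m = p -> T0 (ks m) ->
  [/\ kr n = v, kd n = q & cyc S T0 m n].
  have [[rm dm Tm]|hn] := pselect [/\ kr m = v, kd m = p & T0 (ks m)]; last first.
    by exists m => *; case: hn.
  case: Hv => _ /(_ _ _ Ppq m rm dm Tm)[n [[h1 h2 h3 h4] _]].
  by exists n.
by have [nu hnu] := choice h; exists nu.
Qed.

(** For a path [y] of the tail at [v], exactly one [g m] is an initial segment, and replacing it by
    [f m] returns [y] because the pair is cycline; only the scalar remains. The roles of [f] and [g]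
    can be exchanged, which treats a translation and its adjoint together. *)
Lemma acts_matching (r : seq L) (f g : L -> L) (p' q' : Nk k) : uniq r ->
  (forall m, m \in r -> [/\ kr (g m) = v, kd (f m) = p', kd (g m) = q' &
    cyc S T0 (f m) (g m)]) ->
  {in r &, injective g} ->
  (forall y, paths_in (graphT T0) y -> y 0 0 = v -> exists2 m, m \in r & y 0 q' = g m) ->
  acts (\sum_(m <- r) s (f m) * star (s (g m))) (fun ft => ft (degdiff p' q')).
Proof.
move=> ru fgP gI gS.
have gE m : s (f m) * star (s (g m)) = gen s u (f m, 1%g, g m).
  by rewrite /gen /= (u1 fam) mulr1.
split.
  apply: subspace_sum => [|m /fgP[_ _ _ /cycP[_ h _]]]; first exact: OGL_subspace.
  by rewrite gE; exact: (OGL_gen s u A1).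
move=> T x ft H e pi Tmax dft prep y oy; have rep : is_rep setT pi by case: prep.
split=> [yv|eT yv]; rewrite (rep_sum rep).
  rewrite big_seq big1// => m mr; rewrite gE (rep_gen0 L_row_finite fam dft prep)//.
  by move=> /= hd; have [h _ _ _] := fgP m mr; apply: yv; rewrite -h -hd ipath_r.
subst T; have Ty := orbit_in oy; have [m mr em] := gS y Ty yv.
have [_ df dg /cycP[_ sfg hx]] := fgP m mr.
have dy : tdom (g m) y by rewrite /tdom dg.
rewrite (bigD1_seq m)//= big_seq_cond big1 ?addr0.
  rewrite gE (rep_gen (t := (f m, 1%g, g m)) fam A1 dft prep)//= df dg.
  suff -> : tact S (f m) 1%g (g m) y = y by [].
  rewrite /tact act_path1 hx; first by rewrite -{1}em dg prepend_shift.
    exact: paths_in_shift.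
  by rewrite shift_r -ipath_0s dg em.
move=> m' /andP[mr' /eqP mm']; rewrite gE (rep_gen0 L_row_finite fam dft prep)//=.
by have [_ _ dg' _] := fgP m' mr'; rewrite /tdom dg' em => /(gI _ _ mr mr')/esym.
Qed.

Lemma ex_translation : exists V V' : A, [/\ V' = star V, nm V <= 1,
  acts V (fun ft => ft (degdiff p q)) & acts V' (fun ft => ((ft (degdiff p q))^*)%C)].
Proof.
have [nu hnu] := ex_partner.
pose r := [seq m <- vpaths v p | `[< T0 (ks m) >]].
have rP m : (m \in r) <-> [/\ kr m = v, kd m = p & T0 (ks m)].
  rewrite mem_filter; split=> [/andP[/asboolP Tm /(mem_vpaths L_row_finite _ _ vv)[]]//|].
  move=> [rm dm Tm]; apply/andP; split; first exact/asboolP.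
  by apply/(mem_vpaths L_row_finite _ _ vv).
have ru : uniq r by rewrite filter_uniq// vpaths_uniq.
have nuP m : m \in r -> [/\ kr (nu m) = v, kd (nu m) = q & cyc S T0 m (nu m)].
  by move=> /rP[]; exact: hnu.
have nuI : {in r &, injective nu}.
  move=> m m' mr mr' e; have [_ _ c] := nuP m mr; have [_ _ c'] := nuP m' mr'.
  have /rP[_ dm _] := mr; have /rP[_ dm' _] := mr'.
  apply: (cyc_eq A1 G_countable T0max); last by rewrite dm dm'.
  by apply: cyc_trans c _; rewrite e; exact: cyc_sym.
have rinit y : paths_in (graphT T0) y -> y 0 0 = v -> y 0 p \in r.
  by move=> /paths_inP Ty yv; apply/rP; rewrite ipath_r ipath_d ipath_0s.
exists (\sum_(m <- r) s m * star (s (nu m))), (\sum_(m <- r) s (nu m) * star (s m)).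
have sV : \sum_(m <- r) s (nu m) * star (s m) = star (\sum_(m <- r) s m * star (s (nu m))).
  by rewrite star_sum; apply: eq_bigr => m _; rewrite starM starK.
split=> //.
(* Used with [g := id] to compute V^* V, and with [g := nu] to see that V^* V is idempotent. *)
- have orth (F F' g : L -> L) d : (forall m, m \in r -> kd (g m) = d) -> {in r &, injective g} ->
    (\sum_(m <- r) s (F m) * star (s (g m))) * (\sum_(m <- r) s (g m) * star (s (F' m))) =
    \sum_(m <- r) s (F m) * s (ks (g m)) * star (s (F' m)).
    move=> dg gI; rewrite mulr_suml [LHS]big_seq [RHS]big_seq; apply: eq_bigr => m mr.
    rewrite mulr_sumr (bigD1_seq m)//= big_seq_cond big1 ?addr0.
      by rewrite mulrA -[_ * star (s (g m)) * _]mulrA (ck_starl fam).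
    move=> m' /andP[mr' /eqP mm']; rewrite mulrA -[_ * star _ * s (g m')]mulrA.
    rewrite (ck_orth L_row_finite fam) ?mulr0 ?mul0r//; first by rewrite !dg.
    by move=> /(gI _ _ mr mr')/esym.
  have VV : star (\sum_(m <- r) s m * star (s (nu m))) * (\sum_(m <- r) s m * star (s (nu m))) =
      \sum_(m <- r) s (nu m) * star (s (nu m)).
    rewrite -sV (orth nu nu id p)// => [|m /rP[]//].
    rewrite [LHS]big_seq [RHS]big_seq; apply: eq_bigr => m /nuP[_ _ /cycP[_ h _]].
    by rewrite h (ck_r fam).
  apply: pisom_nm; rewrite VV; split.
    by rewrite star_sum; apply: eq_bigr => m _; rewrite starM starK.
  rewrite (orth nu nu nu q)// => [|m /nuP[]//].
  by apply: eq_bigr => m _; rewrite (ck_r fam).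
- apply: (@acts_matching r id nu) => //.
    by move=> m mr; have [? ? ?] := nuP m mr; have /rP[] := mr.
  (* Here [y] begins with m = y(0, p), and as (m, nu m) is cycline it also begins with [nu m]. *)
  move=> y Ty yv; have mr := rinit y Ty yv; exists (y 0 p) => //.
  have [_ dn /cycP[_ sn hx]] := nuP _ mr.
  have := hx (pshift p y) (paths_in_shift p Ty); rewrite prepend_shift shift_r -sn ipath_0s.
  by move=> /(_ erefl) {1}->; rewrite -dn prepend_init// shift_r -sn ipath_0s.
- apply: acts_ext (_ : acts _ (fun ft => ft (degdiff q p))).
    by move=> ft dft; rewrite degdiffC (charN dft).
  apply: (@acts_matching r nu id) => //.
    by move=> m mr; have [? ? /cyc_sym ?] := nuP m mr; have /rP[] := mr.
  by move=> y Ty yv; exists (y 0 p) => //; exact: rinit.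
Qed.

(* (s_v - L + C) / 2 with C, S the real and imaginary parts of w V and
   L = 1 - sqrt (1 - S^2): the positive part of the real part of w V. *)
Lemma ex_cos_plus (w : R[i]) : cn w = 1 -> exists h,
  acts h (fun ft => (Num.max 0 (complex.Re (w * ft (degdiff p q))))%:C).
Proof.
move=> cw; have [V [V' [eV nV aV aV']]] := ex_translation.
pose half : R[i] := (2^-1 : R)%:C.
have aU := acts_scale w aV; have aU' := acts_scale (w^*)%C aV'.
set U := w *: V in aU; set U' := (w^*)%C *: V' in aU'.
have nU : nm U <= 1 by rewrite nmZ cw mul1r.
have nU' : nm U' <= 1 by rewrite nmZ cn_conj cw mul1r eV nm_star.
pose zz (ft : Zfun R k) := w * ft (degdiff p q).
have aC : acts (half *: (1 *: U + U')) (fun ft => (complex.Re (zz ft))%:C).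
  apply: acts_ext (acts_scale half (acts_lin 1 aU aU')) => ft dft.
  rewrite mul1r -rmorphM/= -/(zz ft) /half; case: (zz ft) => a b; simpc.
  by congr (_ +i* _); rewrite /=; field.
pose Sn := (half * - 'i%C) *: (U - U').
have aS : acts Sn (fun ft => (complex.Im (zz ft))%:C).
  have aD := acts_lin (-1) aU' aU; rewrite scaleN1r addrC in aD.
  apply: acts_ext (acts_scale (half * - 'i%C) aD) => ft dft.
  rewrite mulN1r -rmorphM/= -/(zz ft) /half; case: (zz ft) => a b; simpc.
  by congr (_ +i* _); rewrite /=; field.
have nS : nm Sn <= 1.
  rewrite nmZ cnM /half cn_real ger0_norm ?invr_ge0// cnN.
  have -> : cn ('i%C : R[i]) = 1.
    by rewrite /cn normc_def /= expr0n expr1n add0r sqrtr1.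
  rewrite mulr1 ler_pdivrMl// mulr1; apply: le_trans (cnormD _ _) _.
  by rewrite nmN; lra.
pose W := Sn * Sn.
have nW : nm W <= 1.
  by apply: le_trans (cnormM _ _) _; rewrite mulr_ile1 ?nm_ge0.
have aW : acts W (fun ft => ((complex.Im (zz ft)) ^+ 2)%:C).
  by apply: acts_ext (acts_mul aS aS) => ft _; rewrite -rmorphM.
have aY n : acts (root_iter W n) (fun ft => (sqrt_iter (complex.Im (zz ft) ^+ 2) n)%:C).
  elim: n => [|n IH]; first by apply: acts_ext acts0.
  have := acts_scale half (acts_lin 1 aW (acts_mul IH IH)); rewrite scale1r.
  apply: acts_ext => ft _; rewrite mul1r /half -!rmorphM -rmorphD -rmorphM /=.
  by congr (_ %:C); rewrite mulrC expr2.
have [Z hZ] := ex_root_limit nW.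
have im2 ft : dual setT ft -> 0 <= complex.Im (zz ft) ^+ 2 <= 1 /\
    1 - complex.Im (zz ft) ^+ 2 = complex.Re (zz ft) ^+ 2.
  move=> dft; have : cn (zz ft) = 1 by rewrite /zz cnM cw mul1r (char_cn dft).
  case: (zz ft) => a b h; have : (a +i* b) * ((a +i* b)^*)%C = 1 by exact: unimodular_conj.
  simpc => -[h1 _] /=; have := sqr_ge0 a; rewrite !expr2 => a0.
  by split; [apply/andP; split; nra|lra].
have aZ : acts Z (fun ft => (1 - `|complex.Re (zz ft)|)%:C).
  apply: (acts_limit aY hZ) => ft dft n.
  have [h1 h2] := im2 ft dft; have [b1 b2 b3] := sqrt_iter_bound n h1.
  rewrite h2 sqrtr_sqr in b2 b3.
  by rewrite -rmorphB cn_real distrC ger0_norm// subr_ge0.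
exists (half *: (1 *: (- 1 *: Z + s v) + half *: (1 *: U + U'))).
apply: acts_ext (acts_scale half (acts_lin 1 (acts_lin (-1) aZ acts_vertex) aC)) => ft dft.
rewrite mul1r mulN1r -/(zz ft) /half; set x := complex.Re (zz ft).
rewrite -rmorphN -(rmorph1 (real_complex R)) -!rmorphD -rmorphM; congr (_ %:C).
by case: (lerP 0 x) => x0; [rewrite ger0_norm//|rewrite ltr0_norm//]; field.
Qed.

End Translation.
End Bump.

(** * The ideals I_{T,f} *)

Section Kernels.
Context {R : realType} {k : nat} {L : kgraph k} {G : groupType}.
Variables (S : selfsim L G) (A : cstarAlgType R) (s : L -> A) (u : G -> A).
Hypothesis L_row_finite : row_finite L.
Hypothesis G_countable : countable [set: G].
Hypothesis univ : universal_family S s u.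
Hypothesis A1 : forall g (v : L), vertices v -> ss_act S g v = v.
Hypothesis A2 : forall T : set L, maximal_tail T ->
  forall m g n, cycline S (graphT T) m g n -> g = 1%g.
Hypothesis A4 : forall T : set L, maximal_tail T ->
  forall f, dual (PerG S (graphT T)) f ->
  forall J, is_ITf S s u T f J ->
  J = ideal_gen (OGL S s u) (ITf_generators S s T f).
Variable I : set L -> Zfun R k -> set A.
Hypothesis I_spec : forall T : set L, maximal_tail T ->
  forall f, dual (Per S (graphT T)) f -> is_ITf S s u T f (I T f).
Local Notation B := (OGL S s u).
Local Notation dualT T := (dual (Per S (graphT T))).
Local Notation nm := (@cnorm R A).
Implicit Types (T : set L) (f : Zfun R k).

Let fam : ssgraph_family S s u. Proof. by case: univ. Qed.

Lemma PerG_Per T : maximal_tail T -> PerG S (graphT T) = Per S (graphT T).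
Proof.
move=> Tmax; apply/seteqP; split=> [a [m [g [n [c ->]]]]|a [m [n [c ->]]]].
  by exists m, n; split=> //; have g1 := A2 Tmax c; rewrite -g1.
by exists m, 1%g, n.
Qed.

Definition realizes T f (x : infpath L) := exists (ft : Zfun R k) (H : hilbertType R)
   (e : infpath L -> H) (pi : A -> H -> H),
  [/\ dual setT ft, forall a, Per S (graphT T) a -> ft a = f a,
      path_rep S s u T x ft e pi & I T f = rep_ker B pi].

Lemma I_at T f (x : infpath L) : maximal_tail T -> dualT T f ->
  paths_in (graphT T) x -> cofinal_in (graphT T) x -> realizes T f x.
Proof.
move=> Tmax df Tx cx.
have [x0 [ft [Tx0 cx0 dft eft [H [e0 [pi0 [prep0 eI]]]]]]] := I_spec Tmax df.
have onb : orthonormal_basis (orbit_class S T x0) e0 by case: prep0.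
have [e [pi prep]] := ex_path_rep_any L_row_finite G_countable univ A1 Tmax Tx dft
  cx Tx0 cx0 onb.
exists ft, H, e, pi; split=> //.
have df' : dual (PerG S (graphT T)) f by rewrite PerG_Per.
rewrite (A4 Tmax df' (I_spec Tmax df)).
apply/esym/(A4 Tmax df'); exists x, ft; split=> //.
by exists H, e, pi.
Qed.

Lemma I_real T f : maximal_tail T -> dualT T f ->
  exists x, [/\ paths_in (graphT T) x, cofinal_in (graphT T) x & realizes T f x].
Proof.
move=> Tmax df; have [x0 [ft [Tx0 cx0 dft eft [H [e0 [pi0 [prep0 eI]]]]]]] := I_spec Tmax df.
by exists x0; split=> //; exact: I_at.
Qed.

Lemma I_Prim T f : maximal_tail T -> dualT T f -> Prim B (I T f).
Proof.
move=> Tmax df; have [x [Tx cx [ft [H [e [pi [dft eft prep eI]]]]]]] := I_real Tmax df.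
exists H, pi; split=> //.
exact: (path_rep_irreducible L_row_finite fam A1 Tx dft prep).
Qed.

Lemma I_vertex T f v : maximal_tail T -> dualT T f -> vertices v ->
  I T f (s v) <-> ~ T v.
Proof.
move=> Tmax df vv; have [x [Tx cx [ft [H [e [pi [dft eft prep ->]]]]]]] := I_real Tmax df.
rewrite -(rep_ker_vertex Tmax Tx cx dft prep vv); split=> [[]//|h].
by split=> //; exact: (OGL_vertex fam A1).
Qed.

Lemma I_closed_ideal T f : maximal_tail T -> dualT T f ->
  closed_ideal B (I T f).
Proof.
move=> Tmax df; have [x [Tx cx [ft [H [e [pi [dft eft prep ->]]]]]]] := I_real Tmax df.
have rep : is_rep setT pi by case: prep.
have Bm := OGL_mul L_row_finite fam A1; have [B0 Bs] := OGL_subspace S s u.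
split.
- by move=> a [].
- split; first by split=> // z; exact: (rep0 rep).
  move=> c a b [Ba ha] [Bb hb]; split; first exact: Bs.
  by move=> z; rewrite (rep_lin2 rep) ha hb scaler0 addr0.
- move=> a ha; split.
    apply: (OGL_closed (S := S) (s := s) (u := u)) => d d0.
    by have [b [Bb _] ab] := ha d d0; exists b.
  move=> z; apply: hn_le0 => d d0.
  have z1 : 0 < hn z + 1 by rewrite ltr_wpDl// hn_ge0.
  have [b [_ hb] ab] := ha _ (divr_gt0 d0 z1).
  have := rep_approx rep (rep_one dft prep) z ab.
  rewrite hb subr0 => h; apply: le_trans h _.
  by rewrite mulrAC ler_pdivrMr// ler_wpM2l ?(ltW d0)// lerDl.
- move=> a j Ba [Bj hj]; split; split; try exact: Bm.
    by move=> z; rewrite (repM rep) hj (repx0 rep).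
  by move=> z; rewrite (repM rep) hj.
Qed.

Lemma I_sub_OGL T f : maximal_tail T -> dualT T f -> I T f `<=` B.
Proof. by move=> Tmax df; case: (I_closed_ideal Tmax df). Qed.

Lemma I_mulr T f a b : maximal_tail T -> dualT T f ->
  I T f a -> B b -> I T f (a * b).
Proof. by move=> Tmax df; case: (I_closed_ideal Tmax df) => _ _ _ h ha /h /(_ ha)[]. Qed.

Lemma I_sub T f T' f' : maximal_tail T -> dualT T f ->
  maximal_tail T' -> dualT T' f' ->
  ITf_generators S s T f `<=` I T' f' -> I T f `<=` I T' f'.
Proof.
move=> Tmax df Tmax' df' h; have df2 : dual (PerG S (graphT T)) f by rewrite PerG_Per.
rewrite (A4 Tmax df2 (I_spec Tmax df)).
by apply: smallest_sub => //; exact: I_closed_ideal.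
Qed.

Definition tail_ideals : set (set A) :=
  [set J | exists T f, [/\ maximal_tail T, dualT T f & J = I T f]].

(** Each basis vector is the image of [e x] under a multiple of a generator, and multiplying by it
    stays in every ideal of [X]; testing at [e x] is enough. *)
Lemma kernel_sub (X : set (set A)) T f x ft (H : hilbertType R) e (pi : A -> H -> H) :
  X `<=` tail_ideals ->
  X !=set0 -> maximal_tail T -> paths_in (graphT T) x -> dual setT ft ->
  path_rep S s u T x ft e pi -> I T f = rep_ker B pi ->
  (forall a, (forall J, X J -> J a) -> pi a (e x) = 0) ->
  \bigcap_(J in X) J `<=` I T f.
Proof.
move=> hX [J0 XJ0] Tmax Tx dft prep eI h a ha.
have rep : is_rep setT pi by case: prep.
have ox := orbit_refl S Tx; rewrite eI.
have Ba : B a.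
  have [T' [f' [Tm' df' eJ]]] := hX _ XJ0.
  by apply: (I_sub_OGL Tm' df'); rewrite -eJ; exact: ha.
split=> //; apply: (rep_eq0 prep) => y oy.
have [t [c [ht <-]]] := rep_connect fam A1 dft prep ox oy.
rewrite -(repM rep); apply: h => J XJ; have [T' [f' [Tm' df' eJ]]] := hX _ XJ.
rewrite eJ; apply: I_mulr => //; first by rewrite -eJ; exact: ha.
apply: (subspaceZ _ (OGL_subspace S s u)); exact: OGL_gen.
Qed.

Lemma ker_approx (H : hilbertType R) (pi : A -> H -> H) (z : H) a b (d : R) :
  is_rep setT pi -> (forall x, pi 1 x = x) -> hn z = 1 -> nm (a - b) < d ->
  hn (pi a z) <= hn (pi b z) + d /\ hn (pi b z) <= hn (pi a z) + d.
Proof.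
move=> rep one z1 ab; have h := rep_approx rep one z ab; rewrite z1 mulr1 in h.
split.
  have -> : pi a z = pi b z + (pi a z - pi b z) by rewrite addrC subrK.
  by apply: le_trans (hnD _ _) _; rewrite lerD2l.
have -> : pi b z = pi a z - (pi a z - pi b z) by rewrite opprB addrC subrK.
by apply: le_trans (hnD _ _) _; rewrite hnN lerD2l.
Qed.

(** An element of the intersection is approximated by a finite sum of generators. If its Gram
    coefficients at [x] are nearly those at a path where the element acts as zero, its value at
    [e x] is small. The extension [ft'] is quantified after [x'] because [I_at] chooses it. *)
Lemma generic_closure (X : set (set A)) T f x :
  X `<=` tail_ideals ->
  maximal_tail T -> dualT T f -> generic S T x ->
  (forall ft (r : seq (L * G * L)) (d : R), dual setT ft ->
    (forall a, Per S (graphT T) a -> ft a = f a) -> (forall t, t \in r -> valid t) ->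
    0 < d -> exists T' f' x', [/\ maximal_tail T', dualT T' f',
      X (I T' f'), paths_in (graphT T') x' & cofinal_in (graphT T') x' /\
      forall ft', dual setT ft' -> (forall a, Per S (graphT T') a -> ft' a = f' a) ->
      exists2 y, orbit_class S T' x' y & forall t t', t \in r -> t' \in r ->
        cn (gram_coef S ft x t t' - gram_coef S ft' y t t') <= d]) ->
  \bigcap_(J in X) J `<=` I T f.
Proof.
move=> hX Tmax df [Tx cx _] happ.
have [ft [H [e [pi [dft eft prep eI]]]]] := I_at Tmax df Tx cx.
(* The empty list of triples only serves to exhibit a member of [X]. *)
have [T1 [f1 [x1 [Tm1 df1 XI1 _ _]]]] :=
  happ ft [::] 1 dft eft (fun t (h : t \in [::]) => False_ind _ (notF h)) ltr01.
apply: (kernel_sub hX (ex_intro _ _ XI1) Tmax Tx dft prep eI) => a ha.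
have Ba : B a by apply: (I_sub_OGL Tm1 df1); exact: ha.
have rep : is_rep setT pi by case: prep.
have ox := orbit_refl S Tx.
apply: hn_le0 => d d0; have d4 : 0 < d / 4 by rewrite divr_gt0.
have [r [hr ab]] := OGL_approx A1 Ba d4.
set b := \sum_(i <- r) _ in ab.
(* The tolerance (d / 4)^2 / (C + 1) keeps the error in the squared norm below (d / 4)^2; the
   summand 1 covers C = 0. *)
pose C := \sum_(i <- r) \sum_(j <- r) cn (i.1 * (j.1^*)%C).
have C0 : 0 <= C by do 2 (apply: sumr_ge0 => ? _); exact: cn_ge0.
have C1 : 0 < C + 1 by lra.
have [|T' [f' [x' [Tm' df' XI Tx' [cx' hy]]]]] :=
  happ ft [seq i.2 | i <- r] _ dft eft _ (divr_gt0 (exprn_gt0 2 d4) C1).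
  by move=> t /mapP[i ir ->]; exact: hr.
have [ft' [H' [e' [pi' [dft' eft' prep' eI']]]]] := I_at Tm' df' Tx' cx'.
have rep' : is_rep setT pi' by case: prep'.
have [y oy hg] := hy ft' dft' eft'.
have diff : hn (pi b (e x)) ^+ 2 <= hn (pi' b (e' y)) ^+ 2 + (d / 4) ^+ 2.
  rewrite -lerBlDl; apply: le_trans (ler_norm _) _.
  rewrite -cn_real rmorphB/= (rep_sum_norm L_row_finite fam A1 Tmax dft prep)//.
  rewrite (rep_sum_norm L_row_finite fam A1 Tm' dft' prep')//.
  rewrite -sumrB; under eq_bigr do rewrite -sumrB.
  apply: le_trans (cn_sum _ _ _) _.
  apply: (@le_trans _ _ (\sum_(i <- r) \sum_(j <- r)
      cn (i.1 * (j.1^*)%C) * ((d / 4) ^+ 2 / (C + 1)))).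
    rewrite [leLHS]big_seq [leRHS]big_seq; apply: ler_sum => i ir.
    apply: le_trans (cn_sum _ _ _) _.
    rewrite [leLHS]big_seq [leRHS]big_seq; apply: ler_sum => j jr.
    by rewrite -mulrBr [leLHS]cnM ler_wpM2l ?cn_ge0// hg// map_f.
  under eq_bigr do rewrite -mulr_suml.
  rewrite -mulr_suml -/C mulrA ler_pdivrMr// mulrC ler_wpM2l ?sqr_ge0//; lra.
have pa' : pi' a (e' y) = 0 by have := ha _ XI; rewrite eI' => -[_]; apply.
have [_ h1] := ker_approx rep' (rep_one dft' prep') (basis_one (path_rep_onb prep') oy) ab.
have [h2 _] := ker_approx rep (rep_one dft prep) (basis_one (path_rep_onb prep) ox) ab.
move: h1 h2 diff; rewrite pa' hn0 add0r.
have := hn_ge0 (pi' b (e' y)); have := hn_ge0 (pi b (e x)).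
move: (hn (pi b _)) (hn (pi' b _)) (hn (pi a _)) => q q' p q0 q0' h1 h2 h3.
(* Since q' <= d / 4, q^2 is at most 2 (d / 4)^2, below (d / 2)^2. *)
suff : q <= d / 2 by lra.
rewrite -ler_sqr ?nnegrE//; last lra.
apply: le_trans h3 _; have : q' ^+ 2 <= (d / 4) ^+ 2 by rewrite ler_sqr ?nnegrE//; lra.
have : 0 <= (d / 4) ^+ 2 by exact: sqr_ge0.
have -> : (d / 2) ^+ 2 = 4 * (d / 4) ^+ 2 by field.
lra.
Qed.

(** As Per = 0, the Gram coefficients at a generic [x] are 0 or 1 and are decided by some x(0, N). A
    tail of the family containing the source of x(0, N) has an orbit member with this initial
    segment, and there the coefficients are the same. *)
Lemma aperiodic_closure (X : set (set A)) T f :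
  X `<=` tail_ideals ->
  Mgamma S T -> dualT T f ->
  (forall v, T v -> exists T' f', [/\ maximal_tail T', dualT T' f',
     X (I T' f') & T' v]) ->
  \bigcap_(J in X) J `<=` I T f.
Proof.
move=> hX [Tmax PT] df hT.
have [v0 Tv0] : T !=set0 by case: Tmax => -[].
have [x [gx _]] := ex_generic A1 G_countable Tmax Tv0; have [Tx _ _] := gx.
apply: (generic_closure hX Tmax df gx) => ft r d dft _ hr d0.
have deg t t' : t \in r -> t' \in r -> coincide S t t' x -> tdeg t - tdeg t' = 0.
  move=> tr tr' /(coincide_deg A1 G_countable Tmax (A2 Tmax) gx (hr _ tr) (hr _ tr')).
  by rewrite PT.
have [|N hN] := coincide_seq A1 G_countable Tmax (A2 Tmax) gx hr.
  by move=> t t' tr tr' /(deg _ _ tr tr')/eqP; rewrite subr_eq0 => /eqP.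
have TxN : T (x N 0) by move/paths_inP: Tx; apply.
have [T' [f' [Tm' df' XI Tv']]] := hT _ TxN.
have [x' [Tx' cx' _]] := I_real Tm' df'.
exists T', f', x'; split=> //; split=> // ft' dft' _.
have [|y oy] := orbit_dense S Tm' Tx' cx' (l := x 0 N); first by rewrite ipath_0s.
rewrite ipath_d => ey; exists y => // t t' tr tr'; rewrite /gram_coef.
have hc := hN y ey t t' tr tr'; case: pselect => [c|nc]; case: pselect => [c'|nc'] /=.
- by rewrite deg// !char0// subrr cn0 ltW.
- by case: nc'; apply/hc.
- by case: nc; apply/hc.
- by rewrite subrr cn0 ltW.
Qed.

(** Tail and path are kept. Only degree differences in Per contribute at a generic path; there the
    extensions agree with the characters, and finitely many occur. *)
Lemma character_closure T f (D : set (Zfun R k)) :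
  maximal_tail T -> dualT T f ->
  D `<=` dualT T ->
  (forall (F : seq (Zk k)) (d : R), 0 < d -> exists2 g, D g &
     forall a, a \in F -> cn (f a - g a) < d) ->
  \bigcap_(J in [set I T g | g in D]) J `<=` I T f.
Proof.
move=> Tmax df dD happ.
have [v0 Tv0] : T !=set0 by case: Tmax => -[].
have [x [gx _]] := ex_generic A1 G_countable Tmax Tv0; have [Tx cx _] := gx.
apply: (generic_closure _ Tmax df gx) => [_ [g Dg <-]|ft r d dft eft hr d0].
  by exists T, g; split=> //; exact: dD.
have [g Dg hg] := happ [seq tdeg t - tdeg t' | t <- r, t' <- r] d d0.
exists T, g, x; split=> //; [exact: dD|by exists g|split=> // ft' dft' eft'].
exists x; first exact: orbit_refl.
move=> t t' tr tr'; rewrite /gram_coef; case: pselect => [c|nc]; last by rewrite subrr cn0 ltW.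
have P := coincide_deg A1 G_countable Tmax (A2 Tmax) gx (hr _ tr) (hr _ tr') c.
by rewrite (eft _ P) (eft' _ P); apply/ltW/hg/allpairsP; exists (t, t').
Qed.

Lemma OGL_path m : B (s m).
Proof.
have := OGL_gen s u A1 (t := (m, 1%g, ks m)) (esym (ks_ks m)).
rewrite /gen /= (u1 fam) mulr1.
by have [-> _] := ck_proj fam (vertex_s m); rewrite (ck_r fam).
Qed.

(** By heredity, a path of the tail that starts in H_T stays in H_T, so both graphs test the pair on
    the same paths. *)
Lemma cycline_HT T m n : maximal_tail T ->
  cycline S (graphHT S T) m 1%g n -> cyc S T m n.
Proof.
move=> Tmax [[Hm Tm] [Hn Tn] smn h]; rewrite ss_act1 in smn.
apply/cycP; split=> // x Tx x0; rewrite -h ?act_path1//.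
have Hx p : HT S T (x p 0).
  have := @HT_her _ _ _ S A1 G_countable T Tmax (x 0 p).
  rewrite ipath_r ipath_0s; apply; last by move/paths_inP: Tx; apply.
  by rewrite x0; exact: (HT_her A1 G_countable Tmax).
move=> p q; split; first by rewrite ipath_r; exact: Hx.
by rewrite ipath_s; move/paths_inP: Tx; apply.
Qed.

(** With Per = 0 a cycline pair has m = n, and f(0) = 1 makes its generator zero; only the vertex
    projections remain. *)
Lemma I_gamma_sub T f T' f' : Mgamma S T -> dualT T f ->
  maximal_tail T' -> dualT T' f' ->
  T' `<=` T -> I T f `<=` I T' f'.
Proof.
move=> [Tmax PT] df Tmax' df' TT.
apply: (I_sub) => //.
move=> _ [[v [vv nTv] <-]|[m [n [c ->]]]].
  apply/(I_vertex) => //.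
  by move=> /TT.
have cmn := cycline_HT Tmax c.
have P : Per S (graphT T) (degdiff (kd m) (kd n)) by exists m, n.
have d0 := P; rewrite PT /= in d0.
have emn : m = n.
  by apply: (cyc_eq A1 G_countable Tmax cmn); exact: degdiff_eq0.
rewrite d0 emn; have f01 : f (0 : Zk k) = 1.
  have P0 : Per S (graphT T) 0 by rewrite PT.
  case: df => fD fn _; have h := fD 0 0 P0 P0; rewrite addr0 in h.
  have : f (0 : Zk k) != 0 by rewrite -normr_eq0 fn// oner_eq0.
  by move=> /mulfI; apply; rewrite -h mulr1.
rewrite f01 scale1r subrr.
by have [_ [I0 _] _ _] := I_closed_ideal Tmax' df'.
Qed.

(** A smaller tail misses H_T by [HT_sub_tail], so [s m] and [s n] lie separately in the target
    ideal for every pair, whatever the scalar between them. *)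
Lemma I_tau_sub T f T' f' : maximal_tail T -> strongly_connected (graphHT S T) ->
  dualT T f ->
  maximal_tail T' -> dualT T' f' ->
  T' `<=` T -> T <> T' -> I T f `<=` I T' f'.
Proof.
move=> Tmax sc df Tmax' df' TT neT.
have cI := I_closed_ideal Tmax' df'.
have vI := I_vertex Tmax' df'.
have HTn v : HT S T v -> ~ T' v.
  move=> Hv T'v; apply: neT; apply/seteqP; split=> //.
  exact: (HT_sub_tail A1 G_countable Tmax sc Tmax' Hv T'v).
apply: (I_sub) => //.
move=> _ [[v [vv nTv] <-]|[m [n [c ->]]]].
  by apply/vI => // /TT.
have sI l : HT S T (kr l) -> I T' f' (s l).
  move=> Hl; rewrite -(ck_l fam).
  apply: (I_mulr) => //; last exact: OGL_path.
  by apply/vI; [exact: vertex_r|exact: HTn].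
case: c => -[Hm _] [Hn _] _ _; have [_ [I0 Is] _ _] := cI.
by rewrite addrC -scaleNr; apply: Is; exact: sI.
Qed.

Lemma closure_cover (X : set (set A)) T f :
  maximal_tail T -> dualT T f ->
  \bigcap_(J in X) J `<=` I T f ->
  forall v, T v -> exists2 J, X J & ~ J (s v).
Proof.
move=> Tmax df h v Tv; apply: contrapT => hn.
have vv := tail_vertex Tmax Tv.
have vI := I_vertex Tmax df vv.
apply: (vI.1 _ Tv); apply: h => J XJ; apply: contrapT => nJ.
by apply: hn; exists J.
Qed.

Variables (T0 : set L) (v : L) (f0 : Zfun R k).
Hypotheses (T0max : maximal_tail T0) (Hv : HT S T0 v)
  (f0_dual : dualT T0 f0).

Let re_plus (f : Zfun R k) (b : Zk k) : R :=
  Num.max 0 (complex.Re (((f0 b)^*)%C * f b)).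

Lemma dual_muln (f : Zfun R k) (a : Zk k) (n : nat) : dualT T0 f -> Per S (graphT T0) a ->
  Per S (graphT T0) (a *+ n.+1) /\ f (a *+ n.+1) = f a ^+ n.+1.
Proof.
move=> [fD _ _] Pa; elim: n => [|n [Pn en]]; first by rewrite mulr1n expr1.
have Pn1 : Per S (graphT T0) (a *+ n.+2).
  by rewrite mulrS; apply: (PerD A1 G_countable T0max).
by split=> //; rewrite mulrS fD// en -exprS.
Qed.

Lemma dual_cn (f : Zfun R k) (a : Zk k) : dualT T0 f -> Per S (graphT T0) a -> cn (f a) = 1.
Proof. by move=> [_ h _] /h e; apply: complexI; rewrite -cnE e rmorph1. Qed.

Lemma ex_bump (r : seq (Zk k)) : (forall b, b \in r -> Per S (graphT T0) b) ->
  exists h, acts S s u T0 v h (fun ft => (\prod_(b <- r) re_plus ft b)%:C).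
Proof.
elim: r => [|b r IH] hr.
  exists (s v); apply: acts_ext (acts_vertex fam A1 T0max Hv) => ft _.
  by rewrite big_nil rmorph1.
have [|h hh] := IH; first by move=> b' b'r; apply: hr; rewrite inE b'r orbT.
have Pb := hr b (mem_head _ _); have [m [n [_ eb]]] := Pb.
have Pmn : Per S (graphT T0) (degdiff (kd m) (kd n)) by rewrite -eb.
have [|h' hh'] := ex_cos_plus L_row_finite G_countable fam A1 T0max Hv Pmn (w := ((f0 b)^*)%C).
  by rewrite cn_conj; exact: dual_cn.
exists (h' * h); apply: acts_ext (acts_mul L_row_finite fam A1 hh' hh) => ft _.
by rewrite big_cons rmorphM /re_plus -eb.
Qed.

(** The factors at 2^j a with j <= r all equal 1 at [f0]. If f(a) is at distance at least [d] from
    f0(a), one of them vanishes at [f]. *)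
Lemma bump_separation (F : seq (Zk k)) (d : R) : 0 < d -> exists h,
  [/\ B h, forall T f, maximal_tail T -> dualT T f -> ~ T v -> I T f h,
      forall f, dualT T0 f ->
        (exists2 a, a \in F & d <= cn (f0 a - f a)) -> I T0 f h &
      ~ I T0 f0 h].
Proof.
move=> d0.
(* This is the number of doublings for which [near_one_of_powers] gives distance less than [d]. *)
have [r hr] : exists r : nat, 2 * 2^-1 ^+ r < d ^+ 2.
  have [|||N hN] := @expr_lt_eps R (2^-1) (d ^+ 2 / 2).
  - by rewrite invr_ge0.
  - by rewrite invf_lt1// ltr1n.
  - by rewrite divr_gt0// exprn_gt0.
  by exists N; rewrite mulrC -ltr_pdivlMr//; exact: hN.
(* Points outside Per cannot separate characters, as both extensions by zero vanish there. *)
pose F' := [seq a <- F | `[< Per S (graphT T0) a >]].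
have F'P a : a \in F' <-> a \in F /\ Per S (graphT T0) a.
  by rewrite mem_filter; split=> [/andP[/asboolP]//|[aF Pa]]; apply/andP; split=> //; exact/asboolP.
pose bs := [seq a *+ (2 ^ j)%N | a <- F', j <- iota 0 r.+1].
have ex2 j : exists n, (2 ^ j)%N = n.+1.
  by exists (2 ^ j).-1; rewrite prednK// expn_gt0.
have bsP b : b \in bs -> Per S (graphT T0) b.
  move=> /allpairsP[[a j] [/= /F'P[_ Pa] _ ->]]; have [n ->] := ex2 j.
  by have [] := dual_muln n f0_dual Pa.
have [h [Bh hh]] := ex_bump bsP.
have ge0 f (q : seq (Zk k)) : 0 <= \prod_(b <- q) re_plus f b.
  by apply: prodr_ge0 => b _; rewrite /re_plus le_max lexx.
exists h; split=> //.
- move=> T f Tmax df nTv.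
  have [x [Tx cx [ft [H [e [pi [dft eft prep ->]]]]]]] :=
    I_real Tmax df.
  split=> //; apply: (rep_eq0 prep) => y oy.
  have [h1 _] := hh _ _ _ _ _ _ Tmax dft prep y oy; apply: h1 => yv; apply: nTv.
  by rewrite -yv; have /paths_inP := orbit_in oy; apply.
- move=> f df [a aF da].
  have Pa : Per S (graphT T0) a.
    apply: contrapT => nP; move: da; case: f0_dual => _ _ ->//; case: df => _ _ ->//.
    by rewrite subrr cn0 leNgt d0.
  have [x [Tx cx [ft [H [e [pi [dft eft prep ->]]]]]]] :=
    I_real T0max df.
  split=> //; apply: (rep_eq0 prep) => y oy.
  have [h1 h2] := hh _ _ _ _ _ _ T0max dft prep y oy.
  have [yv|yv] := pselect (y 0 0 = v); last exact: h1.
  rewrite h2//.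
  pose z := ((f0 a)^*)%C * f a.
  have cz : cn z = 1 by rewrite cnM cn_conj !dual_cn// mulr1.
  (* Otherwise [near_one_of_powers] puts z within [d] of 1, that is, f(a) within [d] of f0(a). *)
  have [j jr zj] : exists2 j, (j <= r)%N & complex.Re (z ^+ (2 ^ j)%N) <= 0.
    apply: contrapT => hn; have := @near_one_of_powers R z r cz.
    have hz j : (j <= r)%N -> 0 < complex.Re (z ^+ (2 ^ j)%N).
      by move=> jr; rewrite ltNge; apply/negP => hj; apply: hn; exists j.
    move=> /(_ hz); have e1 : cn (1 - z) = cn (f0 a - f a).
      have -> : f0 a - f a = f0 a * (1 - z).
        by rewrite mulrBr mulr1 /z mulrA unimodular_conj ?mul1r//; exact: dual_cn.
      by rewrite cnM dual_cn// mul1r.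
    rewrite e1 leNgt => /negP; apply; apply: lt_le_trans hr _.
    by rewrite ler_sqr ?nnegrE ?cn_ge0// ltW.
  suff -> : \prod_(b <- bs) re_plus ft b = 0 by rewrite rmorph0 scale0r.
  have bin : a *+ (2 ^ j)%N \in bs.
    apply/allpairsP; exists (a, j); split=> //; first by apply/F'P.
    by rewrite mem_iota add0n ltnS.
  rewrite (big_rem _ bin)/= [X in X * _](_ : _ = 0) ?mul0r//.
  apply/eqP; rewrite /re_plus; have [n en] := ex2 j.
  have [P1 e1] := dual_muln n df Pa; have [_ e0] := dual_muln n f0_dual Pa.
  rewrite eft en// e1 e0 rmorphXn/= -exprMn -/z -en.
  by rewrite eq_le le_max lexx andbT ge_max lexx zj.
have [x [Tx cx [ft [H [e [pi [dft eft prep ->]]]]]]] :=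
  I_real T0max f0_dual.
move=> [_ hz].
have [T0v _] := Hv; have [y oy yv] := ex_orbit_at S T0max Tx cx T0v.
have [_ h2] := hh _ _ _ _ _ _ T0max dft prep y oy.
apply: (basis_nz (path_rep_onb prep) oy); rewrite -(hz (e y)) h2//.
rewrite big_seq big1 ?rmorph1 ?scale1r// => b /bsP Pb.
rewrite /re_plus (eft _ Pb) mulrC unimodular_conj; last exact: dual_cn.
by rewrite /= max_r.
Qed.

End Kernels.

(** One direction intersects finitely many evaluation neighbourhoods. For the other, the filter
    based on the sets [E] converges to [f] because it does so under each evaluation. *)
Lemma closure_ptwsP (R : realType) (k : nat) (D : set (Zfun R k)) (f : Zfun R k) :
  closure D f <-> forall (F : seq (Zk k)) (d : R), 0 < d -> exists2 g, D g &
     forall a, a \in F -> cn (f a - g a) < d.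
Proof.
split=> [h F d d0|h U].
  have nb : nbhs f [set g : Zfun R k | forall a, a \in F -> cn (f a - g a) < d].
    elim: F => [|a F IH].
      by apply: filterS (filterT (F := nbhs f)) => g _ a.
    have hc : (fun g : Zfun R k => g a : (complex R : numFieldType)) @ nbhs f --> f a.
      exact: (@proj_continuous _ (fun=> (complex R : numFieldType)) a f).
    have := hc => /cvgrPdist_lt /(_ d%:C); rewrite ltcR => /(_ d0) ha.
    apply: filterS (filterI ha IH) => g /= [h1 h2] b; rewrite inE => /predU1P[->|bF].
      by rewrite -ltcR -cnE.
    exact: h2.
  by have [g [Dg hg]] := h _ nb; exists g.
pose E (z : seq (Zk k) * R) := [set g : Zfun R k | D g /\ forall a, a \in z.1 -> cn (f a - g a) < z.2].
pose Fl := filter_from [set z : seq (Zk k) * R | 0 < z.2] E.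
have FF : Filter Fl.
  apply: filter_from_filter; first by exists ([::], 1) => /=.
  move=> [F1 d1] [F2 d2] /= h1 h2; exists (F1 ++ F2, Num.min d1 d2).
    by rewrite /= lt_min h1.
  move=> g [Dg hg]; split; split=> // a aF.
    have := hg a; rewrite /= mem_cat aF => /(_ isT).
    by rewrite lt_min => /andP[].
  have := hg a; rewrite /= mem_cat aF orbT => /(_ isT).
  by rewrite lt_min => /andP[].
have hev a : (fun g : Zfun R k => g a : (complex R : numFieldType)) @ Fl --> f a.
  apply/cvgrPdist_lt => /= d d0.
  have dE := gt0_real d0.
  exists ([:: a], complex.Re d); first by rewrite /= -ltcR -dE.
  by move=> g [_ hg] /=; rewrite cnE dE ltcR; apply: hg; rewrite inE.
have hcv : Fl --> f.
  apply/cvg_sup => a; rewrite cvg_image; last first.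
    by rewrite eqEsubset; split=> w // _; exists (fun=> w).
  move=> W /= /(hev a) hW; exists ((fun g : Zfun R k => g a) @^-1` W) => //.
  by rewrite eqEsubset; split=> [j [? + <-//]|j Wj]; exists (fun=> j).
move=> nU; have [[F d] /= d0 hU] := hcv U nU.
have [g Dg hg] := h F d d0; exists g; split=> //.
exact: (hU g (conj Dg hg)).
Qed.

Theorem theorem2p1 (R : realType) (k : nat) (k_gt0 : (0 < k)%N)
    (L : kgraph k) (L_row_finite : row_finite L) (L_source_free : source_free L)
    (G : groupType) (G_countable : countable [set: G])
    (S : selfsim L G) (S_pseudo_free : pseudo_free S)
    (A : cstarAlgType R) (s : L -> A) (u : G -> A)
    (A_universal : universal_family S s u)
    (A1 : forall g (v : L), vertices v -> ss_act S g v = v)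
    (A2 : forall T : set L, maximal_tail T ->
       forall m g n, cycline S (graphT T) m g n -> g = 1%g)
    (A3 : forall T : set L, Mtau S T -> strongly_connected (graphHT S T))
    (A4 : forall T : set L, maximal_tail T ->
       forall f, dual (PerG S (graphT T)) f ->
       forall J, is_ITf S s u T f J ->
       J = ideal_gen (OGL S s u) (ITf_generators S s T f))
    (I : set L -> Zfun R k -> set A)
    (I_spec : forall T : set L, maximal_tail T ->
       forall f, dual (Per S (graphT T)) f -> is_ITf S s u T f (I T f))
    (W : set (set L)) (W_nonempty : W !=set0) (W_gamma : W `<=` Mgamma S)
    (Y : set (set L)) (Y_nonempty : Y !=set0) (Y_tau : Y `<=` Mtau S)
    (D : set L -> set (Zfun R k))
    (D_nonempty : forall T, Y T -> D T !=set0)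
    (D_dual : forall T, Y T -> D T `<=` dual (PerG S (graphT T)))
    (S0 : set L) (S0_gamma : Mgamma S S0)
    (T0 : set L) (T0_tau : Mtau S T0)
    (f0 : Zfun R k) (f0_dual : dual (PerG S (graphT T0)) f0) :
  let I1 (T : set L) := I T (trivial_char R (Per S (graphT T))) in
  let clos := jacobson_closure (OGL S s u) in
  let IW := [set I1 T | T in W] in
  let IY := [set J | exists T f, [/\ Y T, D T f & J = I T f]] in
  [/\ clos IW (I1 S0) <-> S0 `<=` \bigcup_(T in W) T,
      clos IW (I T0 f0) <-> T0 `<=` \bigcup_(T in W) T,
      clos IY (I1 S0) <-> S0 `<=` \bigcup_(T in Y) T &
      clos IY (I T0 f0) <->
        (exists T, [/\ Y T, T <> T0 & T0 `<=` T]) \/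
        [/\ ~ (exists T, [/\ Y T, T <> T0 & T0 `<=` T]), Y T0 &
            closure (D T0) f0]].
Proof.
move=> I1 clos IW IY.
have gmax T : Mgamma S T -> maximal_tail T by case.
have tmax T : Mtau S T -> maximal_tail T by case.
have perE T : maximal_tail T -> PerG S (graphT T) = Per S (graphT T).
  exact: (PerG_Per A2).
have triv T : Mgamma S T -> dual (Per S (graphT T)) (trivial_char R (Per S (graphT T))).
  move=> [_ ->]; split=> [a b -> ->|a ->|a na]; rewrite /trivial_char.
  - by rewrite addr0 mem_set ?mulr1.
  - by rewrite mem_set// normr1.
  - by rewrite memNset.
have T0max := tmax _ T0_tau; have S0max := gmax _ S0_gamma.
have df0 : dual (Per S (graphT T0)) f0 by rewrite -perE.
have dS0 := triv _ S0_gamma.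
have dD T f : Y T -> D T f -> dual (Per S (graphT T)) f.
  by move=> YT /(D_dual _ YT); rewrite perE//; exact/tmax/Y_tau.
have prim := I_Prim L_row_finite G_countable A_universal A1 A2 A4 I_spec.
have closE X T f : maximal_tail T -> dual (Per S (graphT T)) f ->
    (clos X (I T f) <-> \bigcap_(J in X) J `<=` I T f).
  by move=> Tm df; split=> [[]//|h]; split=> //; exact: prim.
have vert := I_vertex L_row_finite G_countable A_universal A1 A2 A4 I_spec.
have cover := closure_cover L_row_finite G_countable A_universal A1 A2 A4 I_spec.
have IW_real : IW `<=` tail_ideals S I.
  move=> J [T WT <-]; exists T, (trivial_char R (Per S (graphT T))); split=> //.
    exact/gmax/W_gamma.
  exact/triv/W_gamma.
have IY_real : IY `<=` tail_ideals S I.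
  move=> J [T [f [YT Df ->]]]; exists T, f; split=> //; last exact: dD.
  exact/tmax/Y_tau.
have coverW T f : maximal_tail T -> dual (Per S (graphT T)) f ->
    \bigcap_(J in IW) J `<=` I T f -> T `<=` \bigcup_(T in W) T.
  move=> Tm df h v Tv; have vv := tail_vertex Tm Tv.
  have [_ [T' WT' <-] nJ] := cover _ _ _ Tm df h v Tv.
  exists T' => //; apply: contrapT => nT; apply: nJ.
  by apply/vert => //; [exact/gmax/W_gamma|exact/triv/W_gamma].
have coverY T f : maximal_tail T -> dual (Per S (graphT T)) f ->
    \bigcap_(J in IY) J `<=` I T f -> T `<=` \bigcup_(T in Y) T.
  move=> Tm df h v Tv; have vv := tail_vertex Tm Tv.
  have [_ [T' [f' [YT' Df' ->]]] nJ] := cover _ _ _ Tm df h v Tv.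
  exists T' => //; apply: contrapT => nT; apply: nJ.
  by apply/vert => //; [exact/tmax/Y_tau|exact: dD].
have aper := aperiodic_closure L_row_finite G_countable A_universal A1 A2 A4 I_spec.
have [v0 Hv0] := HT_nonempty A1 G_countable T0max.
have [T0v0 _] := Hv0.
have sub0 T' : maximal_tail T' -> T' v0 -> T0 `<=` T'.
  by move=> Tm' T'v; exact: (HT_sub_tail A1 G_countable T0max (A3 _ T0_tau) Tm' Hv0).
split.
- split=> [/closE -/(_ S0max dS0)|h]; first exact: coverW.
  apply/closE => //; apply: (aper _ _ _ IW_real S0_gamma dS0) => v /h[T WT Tv].
  exists T, (trivial_char R (Per S (graphT T))); split=> //.
  + exact/gmax/W_gamma.
  + exact/triv/W_gamma.
  + by exists T.
- split=> [/closE -/(_ T0max df0)|h]; first exact: coverW.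
  (* A single member of the family already lies below I_{T0,f0}: the tail of [W] through [v0]
     contains [T0]. *)
  apply/closE => //; have [T WT Tv0] := h _ T0v0.
  have gT := W_gamma _ WT; have Tm := gmax _ gT.
  apply: subset_trans (I_gamma_sub L_row_finite G_countable A_universal A1 A2 A4 I_spec
    gT (triv _ gT) T0max df0 (sub0 _ Tm Tv0)).
  by apply: bigcap_inf; exists T.
- split=> [/closE -/(_ S0max dS0)|h]; first exact: coverY.
  apply/closE => //; apply: (aper _ _ _ IY_real S0_gamma dS0) => v /h[T YT Tv].
  have [f Df] := D_nonempty _ YT; exists T, f; split=> //.
  + exact/tmax/Y_tau.
  + exact: dD.
  + by exists T, f.
split=> [/closE -/(_ T0max df0) h|h].
  have [h1|h1] := pselect (exists T, [/\ Y T, T <> T0 & T0 `<=` T]); [by left|right].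
  have YT0 : Y T0.
    have [T YT Tv0] := coverY _ _ T0max df0 h _ T0v0.
    have TT := sub0 _ (tmax _ (Y_tau _ YT)) Tv0.
    have [<-//|ne] := pselect (T = T0).
    by exfalso; apply: h1; exists T.
  (* If some [F] and [d] leave every character of [D T0] at distance at least [d] from [f0] at a
     point of [F], the element [b] for them lies in all ideals of [IY] but not in I_{T0,f0}. *)
  split=> //; apply/closure_ptwsP => F d d0; apply: contrapT => hn.
  have [b [Bb b1 b2 b3]] := bump_separation L_row_finite G_countable A_universal
    A1 A2 A4 I_spec T0max Hv0 df0 F d0.
  apply: b3; apply: h => _ [T [f [YT Df ->]]].
  (* Another tail of [Y] avoids [v0], since by [sub0] it would otherwise contain [T0], against
     [h1]. *)
  have [eT|ne] := pselect (T = T0); last first.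
    apply: b1; [exact/tmax/Y_tau|exact: dD|] => Tv0.
    by apply: h1; exists T; split=> //; apply: sub0 => //; exact/tmax/Y_tau.
  rewrite eT in YT Df *; apply: b2; first exact: dD.
  apply: contrapT => hn'; apply: hn; exists f => // a aF.
  by rewrite ltNge; apply/negP => da; apply: hn'; exists a.
apply/closE => //; case: h => [[T [YT ne sub]]|[_ YT0 hc]].
  have [f Df] := D_nonempty _ YT; have tT := Y_tau _ YT.
  apply: subset_trans (I_tau_sub L_row_finite G_countable A_universal A1 A2 A4 I_spec
    (tmax _ tT) (A3 _ tT) (dD _ _ YT Df) T0max df0 sub ne).
  by apply: bigcap_inf; exists T, f.
have ch := character_closure L_row_finite G_countable A_universal A1 A2 A4 I_spec
  T0max df0 (fun f => dD T0 f YT0) ((closure_ptwsP (D T0) f0).1 hc).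
apply: subset_trans ch => a ha _ [f Df <-].
by apply: ha; exists T0, f.
Qed.
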